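(* For every $n\ge 2$ there exist $\delta=\delta_n>0$ and a constant $K_n>0$ such that for every prime $p$, all $r_1,\dots,r_n\in\mathbb{N}_0$ with $C=(p^{r_1},\dots,p^{r_n})$, and all characters $\psi,\psi'$ attached to integers $\psi_1,\dots,\psi_n$ and $\psi_1',\dots,\psi_n'$ for which the Kloosterman sum $\mathrm{Kl}_p(\psi,\psi',C^{\ast}w_{\ast})$ is well-defined, $$\big|\mathrm{Kl}_p(\psi,\psi',C^{\ast}w_{\ast})\big|\le K_n\Big(\max_{1\le j\le n}|\psi_j|_p^{-1/2}\Big)\Big(\prod_{1\le k\le n}p^{r_k}\Big)^{1-\delta}.$$
   Context: $|\cdot|_p$ is the $p$-adic absolute value with $|p|_p=1/p$ (and $|0|_p^{-1/2}=+\infty$, so the bound is void if some $\psi_j=0$). Let $G=\mathrm{GL}(n+1)$, $T$ the diagonal torus, $U$ the group of upper triangular unipotent matrices, $U^\top$ the lower triangular unipotent matrices. For $u\in U$ and $1\le i\le j\le n$, $u_{ij}$ denotes the entry of $u$ in row $i$ and column $j+1$, so $u_{jj}$ is the $j$-th superdiagonal entry. $e$ denotes the standard additive character of $\mathbb{Q}_p/\mathbb{Z}_p$ (so $e(x)=\exp(2\pi i x)$ for $x\in\mathbb{Z}[1/p]$). For integers $\psi_j,\psi_j'$ put $\psi(u)=e(\sum_{j=1}^n\psi_ju_{jj})$ and $\psi'(u)=e(\sum_{j=1}^n\psi'_ju_{jj})$. Kloosterman sums: for a signed permutation matrix $w$ put $U_w=U\cap w^{-1}U^\top w$ and $\bar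 U_w=U\cap w^{-1}Uw$. For $N=tw$ with $t\in T(\mathbb{Q}_p)$ put $C(N)=U(\mathbb{Q}_p)NU(\mathbb{Q}_p)\cap G(\mathbb{Z}_p)$ and $X(N)=U(\mathbb{Z}_p)\backslash C(N)/U_w(\mathbb{Z}_p)$. Each $x\in C(N)$ is uniquely $x=u(x)Nu'(x)$ with $u(x)\in U(\mathbb{Q}_p)$, $u'(x)\in U_w(\mathbb{Q}_p)$; this induces maps $u:X(N)\to U(\mathbb{Z}_p)\backslash U(\mathbb{Q}_p)$ and $u':X(N)\to U_w(\mathbb{Q}_p)/U_w(\mathbb{Z}_p)$, and $$\mathrm{Kl}_p(\psi,\psi',N)=\sum_{x\in X(N)}\psi(u(x))\,\psi'(u'(x)).$$ The Kloosterman sum is called well-defined if $\psi(NvN^{-1})=\psi'(v)$ for all $v\in\bar U_w(\mathbb{Q}_p)$. $w_{\ast}$ is the $(n+1)\times(n+1)$ matrix $\begin{pmatrix}&&(-1)^n\\&-I_{n-1}&\\1&&\end{pmatrix}$. $C^{\ast}=\mathrm{diag}(p^{-r_1},p^{r_1-r_2},\dots,p^{r_{n-1}-r_n},p^{r_n})$. *)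

(* Defs.v *)
From HB Require Import structures.
From mathcomp Require Import all_boot all_order all_algebra.
From mathcomp Require Import all_classical all_reals all_analysis.
From mathcomp Require Import complex.

Set Implicit Arguments.
Unset Strict Implicit.
Unset Printing Implicit Defensive.

Import Order.TTheory GRing.Theory Num.Theory.

Local Open Scope classical_set_scope.
Local Open Scope ring_scope.

(* Z_p is the inverse limit of the rings Z/p^(k+1); the levels start at Z/p since
   'Z_1 is not the trivial ring. *)
Definition coherent (p : nat) (x : forall k, 'Z_(p ^ k.+1)) : Prop :=
  forall k, x k = (x k.+1 : nat)%:R.

Record padic_int (p : nat) (pp : prime p) := PadicInt {
  digits :> forall k, 'Z_(p ^ k.+1);
  digitsP : coherent digits }.

Section PadicInt.
Variables (p : nat) (pp : prime p).
Local Notation Zp := (padic_int pp).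

Lemma padic_int_eq (x y : Zp) : (forall k, x k = y k) -> x = y.
Proof.
case: x y => [x cx] [y cy] /= xy; have {}xy : x = y by apply: functional_extensionality_dep.
by case: _ / xy cy => cy; congr PadicInt; exact: Prop_irrelevance.
Qed.

Let pX_gt1 k : (1 < p ^ k.+1)%N.
Proof. by rewrite -(exp1n k.+1) ltn_exp2r // prime_gt1. Qed.

Let red_nat k m : ((m%:R : 'Z_(p ^ k.+2)) : nat)%:R = m%:R :> 'Z_(p ^ k.+1).
Proof.
apply: ord_inj; rewrite (val_Zp_nat (pX_gt1 k)) (val_Zp_nat (pX_gt1 k)).
by rewrite (val_Zp_nat (pX_gt1 k.+1)) modn_dvdm // dvdn_exp2l.
Qed.

Let red_natE k (a : 'Z_(p ^ k.+2)) (b : nat) :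
  a = b%:R -> (a : nat)%:R = b%:R :> 'Z_(p ^ k.+1).
Proof. by move=> ->; rewrite red_nat. Qed.

Lemma coherent_nat m : coherent (fun k => m%:R : 'Z_(p ^ k.+1)).
Proof. by move=> k; rewrite red_nat. Qed.

Lemma coherent_add (x y : Zp) : coherent (fun k => x k + y k).
Proof.
move=> k; rewrite (digitsP x k) (digitsP y k) -natrD; symmetry.
by apply: red_natE; rewrite natrD !natr_Zp.
Qed.

Lemma coherent_mul (x y : Zp) : coherent (fun k => x k * y k).
Proof.
move=> k; rewrite (digitsP x k) (digitsP y k) -natrM; symmetry.
by apply: red_natE; rewrite natrM !natr_Zp.
Qed.

Lemma coherent_opp (x : Zp) : coherent (fun k => - x k).
Proof.
move=> k; apply/eqP; rewrite eq_sym -addr_eq0 [in X in _ + X](digitsP x k) -natrD.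
apply/eqP; rewrite -[RHS]/(0%:R); rewrite -(red_nat k (_ + _)) natrD !natr_Zp.
by rewrite addNr.
Qed.

Definition padic_int0 : Zp := PadicInt pp (coherent_nat 0).
Definition padic_int1 : Zp := PadicInt pp (coherent_nat 1).
Definition padic_int_add (x y : Zp) : Zp := PadicInt pp (coherent_add x y).
Definition padic_int_opp (x : Zp) : Zp := PadicInt pp (coherent_opp x).
Definition padic_int_mul (x y : Zp) : Zp := PadicInt pp (coherent_mul x y).

HB.instance Definition _ := gen_eqMixin Zp.
HB.instance Definition _ := gen_choiceMixin Zp.

Let addA : associative padic_int_add.
Proof. by move=> x y z; apply: padic_int_eq => k /=; rewrite addrA. Qed.
Let addC : commutative padic_int_add.
Proof. by move=> x y; apply: padic_int_eq => k /=; rewrite addrC. Qed.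
Let add0 : left_id padic_int0 padic_int_add.
Proof. by move=> x; apply: padic_int_eq => k /=; rewrite add0r. Qed.
Let addN : left_inverse padic_int0 padic_int_opp padic_int_add.
Proof. by move=> x; apply: padic_int_eq => k /=; rewrite addNr. Qed.

HB.instance Definition _ := GRing.isZmodule.Build Zp addA addC add0 addN.

Let mulA : associative padic_int_mul.
Proof. by move=> x y z; apply: padic_int_eq => k /=; rewrite mulrA. Qed.
Let mulC : commutative padic_int_mul.
Proof. by move=> x y; apply: padic_int_eq => k /=; rewrite mulrC. Qed.
Let mul1 : left_id padic_int1 padic_int_mul.
Proof. by move=> x; apply: padic_int_eq => k /=; rewrite mul1r. Qed.
Let mulD : left_distributive padic_int_mul padic_int_add.
Proof. by move=> x y z; apply: padic_int_eq => k /=; rewrite mulrDl. Qed.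
Let one_neq0 : padic_int1 != 0.
Proof. by apply/eqP => /(congr1 (fun x : Zp => x 0)) /eqP; rewrite /= oner_eq0. Qed.

HB.instance Definition _ :=
  GRing.Zmodule_isComNzRing.Build Zp mulA mulC mul1 mulD one_neq0.

Definition padic_int_unit : pred Zp := fun x => `[< exists y : Zp, y * x = 1 >].
Definition padic_int_inv (x : Zp) : Zp := xget x [set y : Zp | y * x = 1].

Let mulV : {in padic_int_unit, left_inverse 1 padic_int_inv *%R}.
Proof.
by move=> x /asboolP[y yx]; rewrite /padic_int_inv; case: xgetP => // /(_ y).
Qed.
Let unitP (x y : Zp) : y * x = 1 -> padic_int_unit x.
Proof. by move=> yx; apply/asboolP; exists y. Qed.
Let inv_out : {in [predC padic_int_unit], padic_int_inv =1 id}.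
Proof.
move=> x /negP nx; rewrite /padic_int_inv; case: xgetP => // y _ yx.
by case: nx; exact: unitP yx.
Qed.

HB.instance Definition _ :=
  GRing.ComNzRing_hasMulInverse.Build Zp mulV unitP inv_out.

Let coherent_mod (x : Zp) k i : (x (k + i)%N = x k %[mod p ^ k.+1])%N.
Proof.
elim: i => [|i IHi]; first by rewrite addn0.
rewrite -IHi addnS (digitsP x (k + i)) val_Zp_nat ?pX_gt1 //.
by rewrite modn_dvdm // dvdn_exp2l // ltnS leq_addr.
Qed.

Let digit_neq0 (x : Zp) k i : x k != 0 -> ~~ (p ^ k.+1 %| x (k + i)%N)%N.
Proof.
apply: contra => /eqP; rewrite coherent_mod => xk0.
by apply/eqP; rewrite -[x k]natr_Zp -(Zp_nat_mod (pX_gt1 k)) xk0.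
Qed.

Let mul_eq0 (x y : Zp) : x * y = 0 -> (x == 0) || (y == 0).
Proof.
move=> xy0; apply: contraPT xy0; rewrite negb_or => /andP[x0 y0].
have nz (z : Zp) : z != 0 -> exists k, z k != 0.
  move=> z0; apply: contrapT => /forallNP z_eq0; move/eqP: z0; apply.
  by apply: padic_int_eq => k; apply/eqP; move/negP: (z_eq0 k); rewrite negbK.
have [[k xk] [l yl]] := (nz _ x0, nz _ y0).
move=> /(congr1 (fun z : Zp => z (k + l)%N : nat)) /=.
rewrite [X in (_ %% X)%N]Zp_cast ?pX_gt1 // => /eqP; apply/negP.
have := digit_neq0 k yl; rewrite addnC; have := digit_neq0 l xk.
move: (x _ : nat) (y _ : nat) => a b na nb.
have a0 : (0 < a)%N by rewrite lt0n; apply: contra na => /eqP->.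
have b0 : (0 < b)%N by rewrite lt0n; apply: contra nb => /eqP->.
move: na nb; rewrite -/(_ %| _)%N !pfactor_dvdn ?muln_gt0 ?a0 // lognM //.
by rewrite -!ltnNge !ltnS => ? ?; exact: leq_add.
Qed.

HB.instance Definition _ :=
  GRing.ComUnitRing_isIntegral.Build Zp mul_eq0.

End PadicInt.

Notation Zp_ pp := (padic_int pp).
Notation Qp_ pp := {fraction padic_int pp}.

Section Characters.
Variables (p : nat) (pp : prime p).
Local Notation Zp := (Zp_ pp).
Local Notation Qp := (Qp_ pp).

Definition ZpQp : Zp -> Qp := @FracField.tofrac Zp.

(* A pair (m, k) such that x is congruent to m / p^k modulo Z_p; it exists, and
   m / p^k is unique modulo Z. *)
Definition padic_frac (x : Qp) : int * nat :=
  xget (0, 0%N) [set mk | range ZpQp (x - mk.1%:~R / p%:R ^+ mk.2)].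

Definition padic_e (R : realType) (x : Qp) : R[i] :=
  let q : R := (padic_frac x).1%:~R / p%:R ^+ (padic_frac x).2 in
  Complex (cos (2 * pi * q)) (sin (2 * pi * q)).

(* The j-th superdiagonal entry of u, for j counted from 0. *)
Definition superdiag n (u : 'M[Qp]_n.+1) (j : 'I_n) : Qp :=
  u (widen_ord (leqnSn n) j) (lift ord0 j).

Definition psi_char (R : realType) n (psi : 'I_n -> int) (u : 'M[Qp]_n.+1) : R[i] :=
  padic_e R (\sum_(j < n) (psi j)%:~R * superdiag u j).

End Characters.

Section Kloosterman.
Variables (p : nat) (pp : prime p) (n : nat).
Local Notation Zp := (Zp_ pp).
Local Notation Qp := (Qp_ pp).
Local Notation M := 'M[Qp]_n.+1.

Definition GL_Zp : set M :=
  [set map_mx (@ZpQp p pp) A | A in [set A : 'M[Zp]_n.+1 | A \in unitmx]].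

Definition Ulow : set M := [set u | is_trig_mx u /\ forall i, u i i = 1].
Definition Uup : set M := [set u | Ulow u^T].

Definition U_ (w : M) : set M :=
  Uup `&` [set invmx w *m v *m w | v in Ulow].
Definition Ubar_ (w : M) : set M :=
  Uup `&` [set invmx w *m v *m w | v in Uup].

Definition bigcell (N : M) : set M :=
  [set x | exists u v, [/\ Uup u, Uup v & x = u *m N *m v]] `&` GL_Zp.

Definition double_coset (w x : M) : set M :=
  [set y | exists a b, [/\ (Uup `&` GL_Zp) a, (U_ w `&` GL_Zp) b & y = a *m x *m b]].

(* In the next three definitions N = t *m w. *)
Definition X_ (t w : M) : set (set M) :=
  [set double_coset w x | x in bigcell (t *m w)].

(* The pair (u(x), u'(x)). *)
Definition bruhat (t w x : M) : M * M :=
  xget (0, 0) [set uv | [/\ Uup uv.1, U_ w uv.2 & x = uv.1 *m (t *m w) *m uv.2]].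

(* The summand does not depend on the representative xget 0 c of the double
   coset c, since psi and psi' are trivial on integral matrices. For t invertible
   diagonal and w a signed permutation matrix the index set is finite, so the
   finite-support sum is the full sum. *)
Definition Kl (R : realType) (psi psi' : 'I_n -> int) (t w : M) : R[i] :=
  \sum_(c \in X_ t w)
    let: (u, u') := bruhat t w (xget 0 c) in
    psi_char R psi u * psi_char R psi' u'.

Definition Kl_well_defined (R : realType) (psi psi' : 'I_n -> int) (t w : M) : Prop :=
  let N := t *m w in
  forall v, Ubar_ w v -> psi_char R psi (N *m v *m invmx N) = psi_char R psi' v.

Definition w_star : M :=
  \matrix_(i, j)
    if (i == 0) && (j == ord_max) then (-1) ^+ n
    else if (i == ord_max) && (j == 0) then 1
    else if [&& i == j, i != 0 & i != ord_max] then -1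
    else 0.

(* r_k for 1 <= k <= n (so r_k is r at the ordinal k - 1), and 0 for k = 0 and
   k = n + 1. *)
Definition ext_exp (r : 'I_n -> nat) (k : nat) : nat :=
  if k is k'.+1 then oapp r 0%N (insub k') else 0%N.

Definition C_star (r : 'I_n -> nat) : M :=
  diag_mx (\row_i (p%:R : Qp) ^ ((ext_exp r i)%:Z - (ext_exp r i.+1)%:Z)).

End Kloosterman.

Definition padic_abs (R : realType) (p : nat) (m : int) : R :=
  if m == 0 then 0 else p%:R ^- logn p `|m|%N.

(* |m|_p^(-1/2), with value +oo at m = 0, where powR would give 0. *)
Definition padic_abs_invsqrt (R : realType) (p : nat) (m : int) : \bar R :=
  if m == 0 then +oo%E else (padic_abs R p m `^ (- 2^-1))%:E.

(* Main.v *)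
(*
The cosets are parametrised by the Heisenberg part u' = (a_i, b_i, z) of x = u N u', which is
determined modulo integral matrices. Integrality of the minors of x on its last rows bounds the
denominators of a_i, b_i and of the partial sums z - sum_(l >= k) a_l b_l by powers p^(r_k), which
gives the trivial bound |X(N)| <= prod (r_k + 1) p^(r_k).

Conjugation by diagonal elements diag(tau, .., tau, 1, .., 1) with tau a unit permutes X(N). It
scales one superdiagonal entry u_k by tau, the corner entries of u' by 1/tau or 1, and fixes the
others modulo integers. Hence the part of the sum where psi_k u_k has denominator larger than p^E
for some k is an average of classical Kloosterman sums modulo p^M with M > E, for which the fourth
moment method gives a saving of p^(-(E/3)/4).

If all psi_k u_k have denominator at most p^E, then also the minors on the rows k, k+2, .., n are
nearly integral, whereas well-definedness forces the exponents r_k to be nearly convex. Together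
they leave at most p^(S - r_1 + O(E)) cosets, where S = sum r_k, and r_1 >= S / n - O(E).
Take E = S / (8 n^3); if some psi_j is divisible by p^E the trivial bound suffices.
*)
Require Import Defs.
From HB Require Import structures.
From mathcomp Require Import all_boot all_order all_algebra.
From mathcomp Require Import all_classical all_reals all_analysis.
From mathcomp Require Import complex.
From mathcomp Require Import zify ring lra.

Set Implicit Arguments.
Unset Strict Implicit.
Unset Printing Implicit Defensive.

Import Order.TTheory GRing.Theory Num.Theory.
Local Open Scope ring_scope.

(** One-variable sums appear because a diagonal f acting by x -> f x (f o [sg])^-1 fixes [N]: a unit
    tau then enters the phase as tau times psi_k u_k plus 1/tau times corner entries of u', so an
    orbit sum is a Kloosterman sum whose modulus is the larger of the two denominators. This gives
    nothing on cosets where every psi_k u_k is almost integral, and those must be counted with a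
    power saving. With e = E + max_k v_p(psi_k), the exponents in that count add up to exactly S + n
    e - r_1, so the point is that r_1 cannot be small. One surviving coset forces r_n <= r_(n-1) +
    e, and near-convexity carries this slope bound back to the start, so the r_k are almost
    decreasing and S <= n r_1 + n^3 e. The constant 8 n^3 keeps the error n^2 e + n^3 e below S / 2.
    The final delta is 1 / (24 * 8 n^3): a factor 3 comes from a product of three residues vanishing
    modulo p^M, a factor 4 from the fourth moment, and a factor 2 from sharing the saving with the
    polynomial factors (S + 1)^n. *)

Lemma fraction_ratio (R : idomainType) (x : {fraction R}) :
  exists n d : R, d != 0 /\ x * FracField.tofrac d = FracField.tofrac n.
Proof.
exists (frac (generic_quotient.repr x)).1, (frac (generic_quotient.repr x)).2.
split; first exact: denom_ratioP.
rewrite -{1}[x]generic_quotient.reprK; unlock FracField.tofrac.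
rewrite -[LHS]FracField.pi_mul; apply/generic_quotient.eqmodP => /=.
rewrite FracField.equivfE /FracField.mulf !numden_Ratio ?mulf_neq0 ?oner_eq0 ?denom_ratioP //.
by rewrite !mulr1 mulrC.
Qed.

(** * Arithmetic of p-adic integers through their residues *)

Section PadicInteger.
Variables (p : nat) (pp : prime p).
Local Notation Zp := (Zp_ pp).
Implicit Types (x y : Zp) (k : nat).

Lemma expS_gt1 k : (1 < p ^ k.+1)%N.
Proof. by rewrite -(exp1n k.+1) ltn_exp2r // prime_gt1. Qed.

Definition dg x k : nat := x k.

Lemma dg_lt x k : (dg x k < p ^ k.+1)%N.
Proof. by rewrite /dg -[X in (_ < X)%N](Zp_cast (expS_gt1 k)) ltn_ord. Qed.

Lemma dg_ext x y : (forall k, dg x k = dg y k) -> x = y.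
Proof. by move=> h; apply: padic_int_eq => k; apply: ord_inj; exact: h. Qed.

Lemma dgD x y k : dg (x + y) k = ((dg x k + dg y k) %% p ^ k.+1)%N.
Proof. by rewrite /dg /= [X in (_ %% X)%N](Zp_cast (expS_gt1 k)). Qed.

Lemma dgM x y k : dg (x * y) k = ((dg x k * dg y k) %% p ^ k.+1)%N.
Proof. by rewrite /dg /= [X in (_ %% X)%N](Zp_cast (expS_gt1 k)). Qed.

Lemma dg1 k : dg 1 k = 1%N.
Proof. by rewrite /dg /= modn_small // (Zp_cast (expS_gt1 k)) expS_gt1. Qed.

Lemma dg_nat m k : dg m%:R k = (m %% p ^ k.+1)%N.
Proof.
elim: m => [|m IHm]; first by rewrite mod0n.
by rewrite -addn1 natrD dgD IHm dg1 modnDml.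
Qed.

Lemma dg_modS x k : dg x k.+1 = dg x k %[mod p ^ k.+1].
Proof.
have /(congr1 (@nat_of_ord _)) := digitsP x k.
by rewrite val_Zp_nat ?expS_gt1 // /dg => ->; rewrite modn_mod.
Qed.

Lemma dg_mod x k j : (k <= j)%N -> (dg x j %% p ^ k.+1)%N = dg x k.
Proof.
move=> /subnK <-; elim: (j - k)%N => [|i IHi]; first by rewrite modn_small ?dg_lt.
rewrite -IHi addSn -(modn_dvdm _ (dvdn_exp2l p (_ : k.+1 <= (i + k).+1)%N)).
  by rewrite dg_modS modn_dvdm // dvdn_exp2l // ltnS leq_addl.
by rewrite ltnS leq_addl.
Qed.

(** Completeness of [Zp]. Quotients by p and inverses of units are obtained from it, level by
    level. *)
Lemma padic_int_lim (f : nat -> nat) :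
  (forall k, f k.+1 = f k %[mod p ^ k.+1]) ->
  exists x, forall k, dg x k = (f k %% p ^ k.+1)%N.
Proof.
move=> cf.
have co : coherent (fun k => (f k)%:R : 'Z_(p ^ k.+1)).
  move=> k; apply: ord_inj; rewrite !val_Zp_nat ?expS_gt1 //.
  by rewrite modn_dvdm ?dvdn_exp2l // cf.
by exists (PadicInt pp co) => k; rewrite /dg /= val_Zp_nat ?expS_gt1.
Qed.

Lemma dg0_divp y : dg y 0 = 0%N -> exists z, y = p%:R * z.
Proof.
move=> y0.
have dvd k : (p %| dg y k)%N by rewrite /dvdn -[X in (_ %% X)%N]expn1 dg_mod // y0.
have [k|z zE] := @padic_int_lim (fun k => dg y k.+1 %/ p)%N.
  rewrite !modn_divl -[in RHS](dg_mod y (leqnSn k.+1)).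
  by rewrite -!expnSr modn_mod.
exists z; apply: dg_ext => k; rewrite dgM zE dg_nat modnMm.
by rewrite mulnC divnK // dg_mod.
Qed.

Lemma padic_int_approx y k :
  exists m : nat, (m < p ^ k)%N /\ exists z, y = m%:R + p%:R ^+ k * z.
Proof.
elim: k => [|k [m [mlt [z ->]]]]; first by exists 0%N; split=> //; exists y; rewrite mul1r add0r.
have [w wE] : exists w, z - (dg z 0)%:R = p%:R * w.
  apply: dg0_divp; have := dgD (z - (dg z 0)%:R) (dg z 0)%:R 0.
  rewrite subrK dg_nat expn1 (modn_small (_ : dg z 0 < p)%N).
    have := dg_lt (z - (dg z 0)%:R) 0; have := dg_lt z 0; rewrite expn1.
    move: (dg (_ - _) _) => b; move: (dg _ _) => a ap bp /esym h.
    have : (b + a == 0 + a %[mod p])%N by rewrite h add0n modn_small.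
    by rewrite eqn_modDr mod0n modn_small // => /eqP.
  by have := dg_lt z 0; rewrite expn1.
exists (m + p ^ k * dg z 0)%N; split.
  have := dg_lt z 0; rewrite expn1 => zlt; rewrite expnSr.
  apply: (@leq_trans (p ^ k + p ^ k * dg z 0)%N); first by rewrite ltn_add2r.
  by rewrite -mulnS leq_mul2l zlt orbT.
exists w; rewrite natrD natrM natrX exprSr -mulrA -wE mulrBr -addrA.
by congr (_ + _); rewrite addrC subrK.
Qed.

Lemma dg0_unit x : dg x 0 != 0%N -> exists y, x * y = 1.
Proof.
move=> x0.
have cop k : coprime (dg x k) (p ^ k.+1).
  rewrite coprime_sym coprimeXl // prime_coprime //; apply: contra x0 => /eqP h.
  by rewrite -(dg_mod x (leq0n k)) expn1; apply/eqP.
have cop' k : coprime (p ^ k.+1) (dg x k) by rewrite coprime_sym.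
(* Bezout coefficients invert x at every level; they are coherent because inverses modulo p^(k+1)
   are unique. *)
pose f k := (egcdn (dg x k) (p ^ k.+1)).1.
have x0k k : (0 < dg x k)%N.
  by rewrite lt0n; apply: contra x0 => /eqP h; rewrite -(dg_mod x (leq0n k)) h mod0n.
have fE k : (dg x k * f k = 1 %[mod p ^ k.+1])%N.
  have := @egcdnP (dg x k) (p ^ k.+1) (x0k k); rewrite /f; case: egcdnP => //= a b e _ _.
  by rewrite mulnC e (eqP (cop k)) modnMDl.
have [k|y yE] := @padic_int_lim f.
  have e1 : (f k.+1 * dg x k = 1 %[mod p ^ k.+1])%N.
    rewrite -(dg_mod x (leqnSn k)) modnMmr mulnC -(modn_dvdm _ (dvdn_exp2l p (leqnSn k.+1))).
    by rewrite fE modn_dvdm // dvdn_exp2l.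
  by rewrite -[f k.+1]muln1 -modnMmr -(fE k) modnMmr mulnA -modnMml e1 modnMml mul1n.
exists y; apply: dg_ext => k.
by rewrite dgM yE modnMmr fE dg1 modn_small // expS_gt1.
Qed.

Lemma padic_nat_dvd m k (z : Zp) : m%:R = p%:R ^+ k * z -> (p ^ k %| m)%N.
Proof.
case: k => [|k] mE; first by rewrite dvd1n.
have := dg_nat m k; rewrite mE dgM -natrX dg_nat modnn mul0n mod0n => h.
by rewrite /dvdn -h.
Qed.

Lemma padic_int_natr_neq0 m : (0 < m)%N -> (m%:R : Zp) != 0.
Proof.
move=> m0; apply/eqP => /(congr1 (fun z => dg z m)).
rewrite dg_nat (_ : dg 0 m = 0%N) // modn_small; first by move=> e; rewrite e in m0.
by apply: (ltn_trans (ltnSn m)); apply: ltn_expl; exact: prime_gt1.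
Qed.

Lemma padic_int_pfactor y : y != 0 -> exists k u v, [/\ y = p%:R ^+ k * u & u * v = 1].
Proof.
move=> y0; have [k] : exists k, dg y k != 0%N.
  apply: contrapT => /forallNP h; move/eqP: y0; apply; apply: dg_ext => k.
  by rewrite (_ : dg 0 k = 0%N) //; apply/eqP; move/negP: (h k); rewrite negbK.
(* Induction on a level with nonzero residue, which drops by one each time p is divided out. *)
elim: k y {y0} => [|k IHk] y yk; first by have [v] := dg0_unit yk; exists 0%N, y, v; rewrite mul1r.
have [/dg0_divp[z zE]|/dg0_unit[v]] := eqVneq (dg y 0) 0%N; last first.
  by exists 0%N, y, v; rewrite mul1r.
have [|j [u [v [e1 e2]]]] := IHk z; last by exists j.+1, u, v; rewrite zE e1 mulrA exprS.
apply: contra yk => /eqP zk0; rewrite zE dgM.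
have := dg_mod z (leqnSn k); rewrite zk0 => /eqP /dvdnP[c ->].
by rewrite dg_nat modnMml mulnCA -expnS modnMl.
Qed.

End PadicInteger.

(** * Integrality and denominators in Q_p *)

Section PadicField.
Variables (p : nat) (pp : prime p).
Local Notation Zp := (Zp_ pp).
Local Notation Qp := (Qp_ pp).
Local Notation P := (p%:R : Qp).
Implicit Types (x y : Qp) (e f : int).

Definition isint x : Prop := exists z : Zp, x = ZpQp z.

Lemma isint0 : isint 0. Proof. by exists 0; rewrite /ZpQp tofrac0. Qed.

Lemma isint1 : isint 1. Proof. by exists 1; rewrite /ZpQp tofrac1. Qed.

Lemma isintD x y : isint x -> isint y -> isint (x + y).
Proof. by move=> [u ->] [v ->]; exists (u + v); rewrite /ZpQp tofracD. Qed.
Lemma isintN x : isint x -> isint (- x).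
Proof. by move=> [u ->]; exists (- u); rewrite /ZpQp tofracN. Qed.
Lemma isintB x y : isint x -> isint y -> isint (x - y).
Proof. by move=> ix iy; apply: isintD => //; apply: isintN. Qed.
Lemma isintM x y : isint x -> isint y -> isint (x * y).
Proof. by move=> [u ->] [v ->]; exists (u * v); rewrite /ZpQp tofracM. Qed.
Lemma isintX x k : isint x -> isint (x ^+ k).
Proof. by move=> [u ->]; exists (u ^+ k); rewrite /ZpQp tofracXn. Qed.
Lemma isint_nat m : isint m%:R.
Proof. by exists m%:R; rewrite /ZpQp tofracMn tofrac1. Qed.
Lemma isint_int (m : int) : isint m%:~R.
Proof. by case: m => m; rewrite ?NegzE ?mulrNz; [|apply: isintN]; apply: isint_nat. Qed.
Lemma isint_sum (I : Type) (r : seq I) (Q : pred I) (F : I -> Qp) :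
  (forall i, Q i -> isint (F i)) -> isint (\sum_(i <- r | Q i) F i).
Proof. by move=> h; elim/big_ind: _ => //; [exact: isint0|exact: isintD]. Qed.
Lemma isintNE x : isint (- x) <-> isint x.
Proof. by split=> /isintN; rewrite ?opprK. Qed.
Lemma isintDr x y : isint y -> isint (x + y) <-> isint x.
Proof. by move=> iy; split=> [/isintB/(_ iy)|/isintD]; rewrite ?addrK //; apply. Qed.

Lemma P_neq0 : P != 0.
Proof.
have -> : P = ZpQp (p%:R : Zp) by rewrite /ZpQp tofracMn tofrac1.
by rewrite tofrac_eq0 padic_int_natr_neq0 // prime_gt0.
Qed.

Lemma isint_PzD x e f : (e <= f)%R -> isint (x * P ^ e) -> isint (x * P ^ f).
Proof.
move=> ef ix; rewrite -(subrK e f) [_ + e]addrC expfzDr ?P_neq0 // mulrA.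
apply: isintM => //; have : 0 <= f - e by rewrite subr_ge0.
by case: (f - e) => // k _; apply: isintX; exact: isint_nat.
Qed.

Lemma isint_Pz e : 0 <= e -> isint (P ^ e).
Proof. by move=> e0; rewrite -[P ^ e]mul1r; apply: (isint_PzD e0); rewrite mul1r; exact: isint1. Qed.

Lemma isint_frac m k : isint (m%:R / P ^+ k) -> (p ^ k %| m)%N.
Proof.
move=> [z zE]; apply: (@padic_nat_dvd _ pp _ _ z); apply/eqP.
rewrite -tofrac_eq tofracM -/(ZpQp z) -zE tofracXn !tofracMn !tofrac1.
by rewrite mulrC divfK // expf_neq0 // P_neq0.
Qed.

Lemma isint_Pz1 e : isint (P ^ e) -> 0 <= e.
Proof.
case: e => // k; rewrite NegzE -exprnN -[_ ^- _]mul1r -[1]/(1%:R) => /isint_frac.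
by rewrite dvdn1 => /eqP e; have := expS_gt1 pp k; rewrite e.
Qed.

Lemma isint_fracz (m : int) k : isint (m%:~R / P ^+ k) -> exists c : int, m = c * (p ^ k)%N%:Z.
Proof.
case: m => m; rewrite ?NegzE.
  by move=> /isint_frac /dvdnP[c ->]; exists c%:Z; rewrite PoszM.
rewrite mulrNz mulNr => /isintNE /isint_frac /dvdnP[c ->].
by exists (- c%:Z); rewrite PoszM mulNr.
Qed.

Lemma isint_bounded x : exists k : nat, isint (x * P ^+ k).
Proof.

have [n [d [d0 xd]]] := fraction_ratio x.
have [k [u [v [dE uv]]]] := padic_int_pfactor d0.
exists k, (n * v); rewrite /ZpQp tofracM -xd dE -mulrA -tofracM -mulrA uv mulr1.
by rewrite tofracXn tofracMn tofrac1.
Qed.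

Lemma isint_approx x k : isint (x * P ^+ k) ->
  exists m : nat, (m < p ^ k)%N /\ isint (x - m%:R / P ^+ k).
Proof.
move=> [y yE]; have [m [mlt [z zE]]] := padic_int_approx y k.
exists m; split=> //; exists z; rewrite -[x](mulfK (expf_neq0 k P_neq0)) yE -mulrBl.
rewrite zE /ZpQp tofracD tofracM tofracXn !tofracMn !tofrac1 addrAC subrr add0r.
by rewrite mulrAC mulfV ?mul1r // expf_neq0 // P_neq0.
Qed.

(** Numerators are taken in 1, ..., p^k rather than 0, ..., p^k - 1: they are then positive with
    p-adic valuation at most k, so [logn] measures them correctly. *)
Lemma isint_approx1 x k : isint (x * P ^+ k) ->
  exists m : nat, [/\ (0 < m)%N, (m <= p ^ k)%N & isint (x - m%:R / P ^+ k)].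
Proof.
move=> /isint_approx[[|m] [mlt im]]; last by exists m.+1; split=> //; exact: ltnW.
exists (p ^ k)%N; split=> //.
rewrite natrX divff ?expf_neq0 ?P_neq0 //; apply: isintB isint1.
by move: im; rewrite mul0r subr0.
Qed.

End PadicField.

(** * The additive character of Q_p / Z_p *)

Section UnitCircle.
Variable R : realType.
Implicit Types q : R.

Definition cis q : R[i] := Complex (cos (2 * pi * q)) (sin (2 * pi * q)).

Lemma cisD q1 q2 : cis (q1 + q2) = cis q1 * cis q2.
Proof.
apply/eqP; rewrite eq_complex /cis /= mulrDr cosD sinD eqxx /=.
by rewrite [X in _ == X]addrC mulrC [X in _ + X]mulrC addrC [X in X + _]mulrC [X in _ + X]mulrC.
Qed.

Lemma cis0 : cis 0 = 1.
Proof. by rewrite /cis mulr0 cos0 sin0. Qed.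

Lemma cis1 : cis 1 = 1.
Proof. by rewrite /cis mulr1 mulr_natl cos2pi sin2pi. Qed.

Lemma cis_nat m : cis m%:R = 1.
Proof. by elim: m => [|m IH]; rewrite ?cis0 // -addn1 natrD cisD IH cis1 mulr1. Qed.

Lemma cis_int (m : int) : cis m%:~R = 1.
Proof.
case: m => m; first exact: cis_nat.
have := cisD (- m.+1%:R) m.+1%:R; rewrite addNr cis0 cis_nat mulr1 NegzE => e.
by rewrite mulrNz e.
Qed.

Lemma cis_norm q : Normc.normc (cis q) = 1.
Proof. by rewrite /Normc.normc /cis cos2Dsin2 sqrtr1. Qed.

(** The fractional part t lies in [0, 1); if t > 0 then sin(pi t) > 0 and cos(2 pi t) = 1 - 2
    sin^2(pi t) < 1. *)
Lemma cis_eq1 q : cis q = 1 -> exists m : int, q = m%:~R.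
Proof.
move=> q1; exists (Num.floor q).
set m := Num.floor q; have /andP[h1 h2] := floor_itv q.
have : cis (q - m%:~R) = 1.
  by rewrite -[LHS]mulr1 -(cis_int m) -cisD subrK cis_int.
set t := q - m%:~R; have t0 : 0 <= t by rewrite subr_ge0.
have t1 : t < 1 by rewrite ltrBlDl -[1]/(1%:~R) -intrD.
move=> /(congr1 (@complex.Re R)) /= c1.
apply/eqP; rewrite -subr_eq0 -/t eq_le t0 andbT leNgt; apply/negP => tp.
have : 0 < sin (pi * t).
  by apply: sin_gt0_pi; rewrite mulr_gt0 ?pi_gt0 //= gtr_pMr ?pi_gt0.
have := cos2Dsin2 (pi * t); move: c1.
rewrite (_ : 2 * pi * t = pi * t + pi * t); last by ring.
rewrite cosD => e1 e2 s0; have := mulr_gt0 s0 s0; nra.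
Qed.

End UnitCircle.

Lemma frac_addE (F : fieldType) (P : F) (m n : int) (q k l : nat) : P = q%:R -> P != 0 ->
  (m * (q ^ l)%N%:Z + n * (q ^ k)%N%:Z)%:~R / P ^+ (k + l) = m%:~R / P ^+ k + n%:~R / P ^+ l.
Proof.
move=> -> P0; rewrite intrD !rmorphM /= -!pmulrn !natrX exprD; field.
by rewrite !expf_neq0.
Qed.

Lemma addrBB (V : zmodType) (x y a b : V) : x - a + (y - b) = x + y - (a + b).
Proof. by rewrite opprD addrACA. Qed.

Section PadicCharacter.
Variables (R : realType) (p : nat) (pp : prime p).
Local Notation Zp := (Zp_ pp).
Local Notation Qp := (Qp_ pp).
Local Notation P := (p%:R : Qp).
Implicit Types x y : Qp.
Local Notation e := (padic_e R).

Let pR0 : (p%:R : R) != 0.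
Proof. by rewrite pnatr_eq0 -lt0n prime_gt0. Qed.

(** Frees [padic_e] from the choice in [padic_frac]: two fractions congruent to x modulo Z_p differ
    by an element of Z[1/p] that lies in Z_p, hence by an ordinary integer. *)
Lemma padic_eE x (m : int) k : isint (x - m%:~R / P ^+ k) -> e x = cis (m%:~R / p%:R ^+ k).
Proof.
move=> ix; rewrite /padic_e; set mk := padic_frac x.
have [z _ zE] : range (@ZpQp p pp) (x - mk.1%:~R / P ^+ mk.2).
  apply: (@xgetPex _ (0, 0%N) [set mk | range (@ZpQp p pp) (x - mk.1%:~R / P ^+ mk.2)]%classic).
  by exists (m, k); case: ix => z zE; exists z.
rewrite -/(cis _); case: mk zE => m' k' /= zE.
have [c cE] : exists c : int, m * (p ^ k')%N%:Z + (- m') * (p ^ k)%N%:Z = c * (p ^ (k + k'))%N%:Z.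
  apply: (@isint_fracz _ pp); rewrite (frac_addE _ _ _ _ (erefl P) (P_neq0 pp)).
  have /isintB/(_ ix) : isint (x - m'%:~R / P ^+ k') by exists z.
  by rewrite opprB addrC addrA subrK mulrNz mulNr.
have -> : m'%:~R / p%:R ^+ k' = m%:~R / p%:R ^+ k - c%:~R :> R.
  apply/eqP; rewrite eq_sym subr_eq addrC -subr_eq -mulNr -mulrNz.
  rewrite -(frac_addE _ _ _ _ (erefl _) pR0) cE rmorphM /= -pmulrn natrX mulfK //.
  by rewrite expf_neq0.
by rewrite cisD -mulrNz cis_int mulr1.
Qed.

Lemma padic_eD x y : e (x + y) = e x * e y.
Proof.
have [k kx] := isint_bounded x; have [l ly] := isint_bounded y.
have [m [_ mx]] := isint_approx kx; have [n [_ ny]] := isint_approx ly.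
rewrite (@padic_eE x m k mx) (@padic_eE y n l ny).
rewrite (@padic_eE (x + y) (m%:Z * (p ^ l)%N%:Z + n%:Z * (p ^ k)%N%:Z) (k + l)).
  by rewrite -cisD (frac_addE _ _ _ _ (erefl _) pR0).
rewrite (frac_addE _ _ _ _ (erefl P) (P_neq0 pp)) -addrBB.
exact: isintD mx ny.
Qed.

Lemma padic_e_int x : isint x -> e x = 1.
Proof. by move=> ix; rewrite (@padic_eE x 0 0) ?mul0r ?cis0 // subr0. Qed.

Lemma padic_e_norm x : Normc.normc (e x) = 1.
Proof. exact: cis_norm. Qed.

(** Faithfulness of the character; it converts the well-definedness hypothesis into an integrality
    condition. *)
Lemma padic_e_eq1 x : e x = 1 -> isint x.
Proof.
have [k kx] := isint_bounded x; have [m [_ mx]] := isint_approx kx.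
rewrite (@padic_eE x m k mx) => /cis_eq1[c cE].
have mc : m = (c * (p ^ k)%N%:Z) :> int.
  apply/eqP; rewrite -(eqr_int R) rmorphM /= -!pmulrn natrX -cE divfK //.
  by rewrite expf_neq0.
rewrite -[x](subrK (m%:R / P ^+ k)); apply: (isintD mx).
rewrite [m%:R]pmulrn mc rmorphM /= -pmulrn natrX mulfK ?expf_neq0 ?P_neq0 //.
exact: isint_int.
Qed.

End PadicCharacter.

(** * The fourth moment of Kloosterman sums modulo q *)

Section AdditiveCharacter.
Variables (R : realType) (q : nat).
Hypothesis q1 : (1 < q)%N.
Local Notation A := 'Z_q.

Definition zchar (a : A) : R[i] := cis ((a : nat)%:R / q%:R).

Let q0 : (q%:R : R) != 0. Proof. by rewrite pnatr_eq0; case: q q1. Qed.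

Lemma cis_modn m : cis ((m %% q)%N%:R / q%:R : R) = cis (m%:R / q%:R).
Proof.
rewrite {2}(divn_eq m q) natrD natrM mulrDl mulfK // cisD.
by rewrite [(m %/ q)%:R]pmulrn cis_int mul1r.
Qed.

Lemma zcharD a b : zchar (a + b) = zchar a * zchar b.
Proof.
rewrite /zchar -cisD -mulrDl -natrD -(cis_modn (a + b)); congr (cis (_%:R / _)).
by rewrite /= [X in (_ %% X)%N](Zp_cast q1).
Qed.

Lemma zchar_nat m : zchar m%:R = cis (m%:R / q%:R).
Proof. by rewrite /zchar val_Zp_nat // cis_modn. Qed.

Lemma zchar0 : zchar 0 = 1.
Proof. by rewrite /zchar mul0r cis0. Qed.

Lemma zchar_eq1 a : zchar a = 1 -> a = 0.
Proof.
move=> /cis_eq1[m mE]; apply: ord_inj => /=.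
have : (a : nat)%:Z = (m * q%:Z) :> int.
  by apply/eqP; rewrite -(eqr_int R) rmorphM /= -!pmulrn -mE divfK.
have aq : (a < q)%N by have := ltn_ord a; rewrite [X in (_ < X)%N](Zp_cast q1).
move: (a : nat) aq => b bq bE; have := bq; rewrite -ltz_nat bE.
have : 0 <= (b%:Z : int) by []; rewrite bE.
have [m0|m0|m0] := ltrgtP m 0; last by move: bE; rewrite m0 mul0r => -[->].
  by rewrite leNgt nmulr_rlt0 // => /negP[]; rewrite ltz_nat; case: q q1.
move=> _; rewrite ltNge ler_peMl ?lez_nat //.
Qed.

Lemma norm_normc (z : R[i]) : `|z| = (Normc.normc z)%:C%C.
Proof. by []. Qed.

Lemma zchar_norm a : `|zchar a| = 1.
Proof. by rewrite norm_normc cis_norm. Qed.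

Lemma zcharN a : zchar (- a) = (zchar a)^*.
Proof.
have h : zchar a * zchar (- a) = 1 by rewrite -zcharD subrr zchar0.
have h' : zchar a * (zchar a)^* = 1 by rewrite -normCK zchar_norm expr1n.
have z0 : zchar a != 0 by rewrite -normr_eq0 zchar_norm oner_eq0.
by apply: (mulfI z0); rewrite h h'.
Qed.

Lemma zchar_sum a : \sum_(x : A) zchar (x * a) = if a == 0 then q%:R else 0.
Proof.
case: eqVneq => [->|a0].
  rewrite (eq_bigr (fun=> 1)) => [|x _]; last by rewrite mulr0 zchar0.
  by rewrite sumr_const card_ord [X in _ *+ X](Zp_cast q1).
have s : zchar a * \sum_(x : A) zchar (x * a) = \sum_(x : A) zchar (x * a).
  rewrite mulr_sumr [RHS](reindex_inj (addrI 1)) /=; apply: eq_bigr => x _.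
  by rewrite mulrDl mul1r zcharD.
apply/eqP; have : (zchar a - 1) * \sum_(x : A) zchar (x * a) = 0.
  by rewrite mulrBl s mul1r subrr.
move/eqP; rewrite mulf_eq0 subr_eq0 => /orP[/eqP/zchar_eq1 e|//].
by rewrite e eqxx in a0.
Qed.

(** Expanding the square and summing over a and b leaves, by orthogonality, only the pairs on which
    both [h1] and [h2] agree. *)
Lemma zchar_parseval (Y : finType) (Q : pred Y) (h1 h2 : Y -> A) :
  \sum_(a : A) \sum_(b : A) `|\sum_(y | Q y) zchar (a * h1 y + b * h2 y)| ^+ 2 =
  q%:R ^+ 2 * #|[set y : Y * Y | [&& Q y.1, Q y.2, h1 y.1 == h1 y.2 & h2 y.1 == h2 y.2]]|%:R.
Proof.
pose D (h : Y -> A) y1 y2 : R[i] := if h y1 - h y2 == 0 then q%:R else 0.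
transitivity (\sum_(y1 | Q y1) \sum_(y2 | Q y2) D h1 y1 y2 * D h2 y1 y2).
  transitivity (\sum_a \sum_b \sum_(y1 | Q y1) \sum_(y2 | Q y2)
     zchar (a * (h1 y1 - h1 y2)) * zchar (b * (h2 y1 - h2 y2))).
    apply: eq_bigr => a _; apply: eq_bigr => b _.
    rewrite normCK rmorph_sum mulr_suml /=; apply: eq_bigr => y1 _.
    rewrite mulr_sumr; apply: eq_bigr => y2 _.
    by rewrite -zcharN -!zcharD; congr zchar; ring.
  under eq_bigr do rewrite exchange_big /=.
  rewrite exchange_big /=; apply: eq_bigr => y1 _.
  under eq_bigr do rewrite exchange_big /=.
  rewrite exchange_big /=; apply: eq_bigr => y2 _.
  rewrite /D -!zchar_sum mulr_suml; apply: eq_bigr => a _.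
  by rewrite mulr_sumr.
rewrite pair_big /= -sum1_card natr_sum mulr_sumr [RHS]big_mkcond [LHS]big_mkcond /=.
apply: eq_bigr => -[y1 y2] _; rewrite inE /= /D !subr_eq0.
case: (Q y1) (Q y2) => -[] //=; case: eqP => _ /=; case: eqP => _ /=; rewrite ?mul0r ?mulr0 //.
by rewrite mulr1 expr2.
Qed.

Definition kloost (a b : A) : R[i] :=
  \sum_(x : A | x \is a GRing.unit) zchar (a * x + b / x).

Lemma kloost_scale a b c : c \is a GRing.unit -> kloost (a * c) (b / c) = kloost a b.
Proof.
move=> cu; rewrite /kloost [RHS](reindex_inj (mulrI cu)) /=.
apply: eq_big => [x|x xu]; first by rewrite unitrM cu.
by congr zchar; rewrite invrM // -!mulrA [x^-1 * _]mulrC.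
Qed.

Definition kloost_quads := [set y : (A * A) * (A * A) |
  [&& (y.1.1 \is a GRing.unit) && (y.1.2 \is a GRing.unit),
      (y.2.1 \is a GRing.unit) && (y.2.2 \is a GRing.unit),
      y.1.1 + y.1.2 == y.2.1 + y.2.2 & y.1.1^-1 + y.1.2^-1 == y.2.1^-1 + y.2.2^-1]].

(** K(a, b)^2 is the exponential sum over pairs of units with frequencies x + y and 1/x + 1/y, so
    its mean square falls under [zchar_parseval]. *)
Lemma kloost_moment4 : \sum_(a : A) \sum_(b : A) `|kloost a b| ^+ 4 = q%:R ^+ 2 * #|kloost_quads|%:R.
Proof.
rewrite -(zchar_parseval (fun y : A * A => (y.1 \is a GRing.unit) && (y.2 \is a GRing.unit))
  (fun y => y.1 + y.2) (fun y => y.1^-1 + y.2^-1)).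
apply: eq_bigr => a _; apply: eq_bigr => b _.
rewrite (exprM _ 2 2) -normrX; congr (`|_| ^+ 2).
rewrite expr2 /kloost mulr_suml.
rewrite -(pair_big (fun x : A => x \is a GRing.unit) (fun x : A => x \is a GRing.unit)
  (fun x y => zchar (a * (x + y) + b * (x^-1 + y^-1)))) /=.
apply: eq_bigr => x _; rewrite mulr_sumr; apply: eq_bigr => y _.
by rewrite -zcharD; congr zchar; ring.
Qed.

(* K(a c, b / c) = K(a, b) for every unit c, so the fourth moment over all pairs counts
   |K(a, b)|^4 at least #units times. *)
Lemma kloost_bound_quads a b : (a \is a GRing.unit) || (b \is a GRing.unit) ->
  `|kloost a b| ^+ 4 *+ #|[set c : A | c \is a GRing.unit]| <= q%:R ^+ 2 * #|kloost_quads|%:R.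
Proof.
move=> ab; rewrite -kloost_moment4 pair_big /=.
pose f (c : A) := (a * c, b / c).
have fi : {in [set c : A | c \is a GRing.unit] &, injective f}.
  move=> c d; rewrite !inE => cu du e; case/orP: ab => u.
    by apply: (mulrI u); exact: (congr1 fst e).
  by apply: invr_inj; apply: (mulrI u); exact: (congr1 snd e).
apply: (@le_trans _ _ (\sum_(y in f @: [set c : A | c \is a GRing.unit]) `|kloost y.1 y.2| ^+ 4)).
  rewrite big_imset //= -sumr_const; apply: ler_sum => c; rewrite inE => cu.
  by rewrite kloost_scale.
rewrite big_mkcond; apply: ler_sum => y _; case: ifP => // _; exact: exprn_ge0.
Qed.

(* If x1 + x2 = x3 + x4 and the same holds for the inverses, then eliminating x4 gives
   (x1 + x2) (x1 - x3) (x3 - x2) = 0. *)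
Lemma kloost_quads_card :
  (#|kloost_quads| <= #|[set y : A * A * A | ((y.1.1 + y.1.2) * (y.1.1 - y.2) * (y.2 - y.1.2) == 0)%R]|)%N.
Proof.
pose f (y : (A * A) * (A * A)) := (y.1, y.2.1).
rewrite -(@card_in_imset _ _ f); last first.
  move=> [[x1 x2] [x3 x4]] [[y1 y2] [y3 y4]]; rewrite !inE /=.
  move=> /and4P[_ _ /eqP e1 _] /and4P[_ _ /eqP e2 _] [] e e' e''; subst.
  by congr (_, (_, _)); apply: (addrI y3); rewrite -e1 -e2.
apply: subset_leq_card; apply/fintype.subsetP => _ /imsetP[[[x1 x2] [x3 x4]] + ->].
rewrite !inE /= => /and4P[/andP[u1 u2] /andP[u3 u4] /eqP e1 /eqP e2]; apply/eqP.
have e3 : (x1 + x2) * (x3 * x4) = (x3 + x4) * (x1 * x2).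
  have -> : x1 + x2 = (x1^-1 + x2^-1) * (x1 * x2).
    by rewrite mulrDl mulKr // [x1 * x2]mulrC mulKr // addrC.
  by rewrite e2 -mulrA [x1 * x2 * _]mulrC mulrA mulrDl mulKr // [x3 * x4]mulrC mulKr // [x4 + _]addrC.
rewrite e1 in e3 *; have x4E : x2 = x3 + x4 - x1 by rewrite -e1 addrC addKr.
have -> : x1 - x3 = x4 - x2 by rewrite x4E; ring.
rewrite -mulrA -[RHS](subrr ((x3 + x4) * (x3 * x4))) {2}e3 -mulrBr; congr (_ * _).
by rewrite x4E; ring.
Qed.

End AdditiveCharacter.

(** * Kloosterman sums to prime power moduli *)

Section PrimePower.
Variables (R : realType) (p : nat) (pp : prime p) (M : nat).
Hypothesis M0 : (0 < M)%N.
Local Notation A := 'Z_(p ^ M).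

Lemma expM_gt1 : (1 < p ^ M)%N.
Proof. by case: M M0 => // k _; exact: expS_gt1. Qed.

Lemma Zp_small (a : A) : (a < p ^ M)%N.
Proof. by rewrite -[X in (_ < X)%N](Zp_cast expM_gt1) ltn_ord. Qed.

Lemma card_Zp_dvd J : (J <= M)%N -> (#|[set a : A | (p ^ J %| a)%N]| <= p ^ (M - J))%N.
Proof.
move=> JM; pose f (a : A) : 'I_(p ^ (M - J)).+1 := inord (a %/ p ^ J).
have p0 : (0 < p)%N by exact: prime_gt0.
have fE a : f a = (a %/ p ^ J)%N :> nat.
  by rewrite inordK // ltnS ltnW // ltn_divLR ?expn_gt0 ?p0 // -expnD subnK // Zp_small.
rewrite -(@card_in_imset _ _ f).
  apply: (@leq_trans #|[set x : 'I_(p ^ (M - J)).+1 | x != ord_max]|); last first.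
    by rewrite cardsE cardC1 card_ord.
  apply: subset_leq_card; apply/fintype.subsetP => _ /imsetP[a _ ->]; rewrite inE -val_eqE [val _]fE /=.
  by rewrite neq_ltn ltn_divLR ?expn_gt0 ?p0 // -expnD subnK // Zp_small.
move=> a b; rewrite !inE => da db /(congr1 (@nat_of_ord _)); rewrite !fE => e.
by apply: ord_inj; rewrite -(divnK da) -(divnK db) e.
Qed.

(** If p^J divided none of the three, their valuations would add up to at most 3 (J - 1) < M. *)
Lemma dvd_Zp_prod3 J (x y z : A) : (3 * J.-1 < M)%N -> (J <= M)%N -> x * y * z = 0 ->
  [|| (p ^ J %| x)%N, (p ^ J %| y)%N | (p ^ J %| z)%N].
Proof.
move=> JM JM' xyz.
have d : (p ^ M %| x * y * z)%N.
  have : (x * y * z)%N%:R = 0 :> A by rewrite !natrM !natr_Zp.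
  by move=> /(congr1 (@nat_of_ord _)); rewrite val_Zp_nat ?expM_gt1 // => /eqP.
have [->|x0] := posnP (x : nat); first by rewrite dvdn0.
have [->|y0] := posnP (y : nat); first by rewrite dvdn0 orbT.
have [->|z0] := posnP (z : nat); first by rewrite dvdn0 !orbT.
move: d; rewrite !pfactor_dvdn ?muln_gt0 ?x0 ?y0 ?z0 // !lognM ?muln_gt0 ?x0 //.
by case: leqP => //=; case: leqP => //=; case: leqP => //=; lia.
Qed.

(** Each of the three factors of the cubic relation becomes a coordinate after an injective change
    of variables ([f1], [f2], [f3]). If p^J divides it, it has p^(M-J) values, and the other two
    coordinates are free. *)
Lemma kloost_quads_bound J : (3 * J.-1 < M)%N -> (J <= M)%N ->
  (#|kloost_quads (p ^ M)| <= 3 * p ^ (3 * M - J))%N.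
Proof.
move=> JM JM'; apply: (leq_trans (kloost_quads_card _)).
pose V := [set a : A | (p ^ J %| a)%N].
pose T := [set y : A * A * A | (y.1.1 \in V)].
pose f1 (y : A * A * A) := (y.1.1 + y.1.2, y.1.1, y.2).
pose f2 (y : A * A * A) := (y.1.1 - y.2, y.1.1, y.1.2).
pose f3 (y : A * A * A) := (y.2 - y.1.2, y.1.1, y.2).
have cT : (#|T| <= p ^ (3 * M - J))%N.
  have -> : T = finset.setX (finset.setX V [set: A]) [set: A].
    by apply/setP => -[[x y] z]; rewrite !inE /= !andbT.
  have cA : #|A| = (p ^ M)%N by rewrite card_ord (Zp_cast expM_gt1).
  rewrite !cardsX !cardsT !cA.
  apply: (@leq_trans (p ^ (M - J) * p ^ M * p ^ M)).
    by rewrite !leq_mul2r card_Zp_dvd // !orbT.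
  by rewrite -!expnD leq_exp2l ?prime_gt1 //; lia.
pose W (f : A * A * A -> A * A * A) := [set y | f y \in T].
have cW f : injective f -> (#|W f| <= p ^ (3 * M - J))%N.
  move=> fi; apply: leq_trans cT; rewrite -(card_imset _ fi); apply: subset_leq_card.
  by apply/fintype.subsetP => _ /imsetP[y + ->]; rewrite inE.
have f1i : injective f1 by move=> [[x y] z] [[x' y'] z'] e; have /= e1 := congr1 (fun u => u.1.1) e;
  have /= e2 := congr1 (fun u => u.1.2) e; have /= e3 := congr1 (fun u => u.2) e; subst;
  rewrite (addrI _ e1).
have f2i : injective f2 by move=> [[x y] z] [[x' y'] z'] e; have /= e1 := congr1 (fun u => u.1.1) e;
  have /= e2 := congr1 (fun u => u.1.2) e; have /= e3 := congr1 (fun u => u.2) e; subst;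
  rewrite (oppr_inj (addrI _ e1)).
have f3i : injective f3 by move=> [[x y] z] [[x' y'] z'] e; have /= e1 := congr1 (fun u => u.1.1) e;
  have /= e2 := congr1 (fun u => u.1.2) e; have /= e3 := congr1 (fun u => u.2) e; subst;
  rewrite (oppr_inj (addrI _ e1)).
set B := (p ^ (3 * M - J))%N in cW *.
apply: (@leq_trans #|W f1 :|: W f2 :|: W f3|).
  apply: subset_leq_card; apply/fintype.subsetP => y; rewrite !inE /=.
  by move=> /eqP/(dvd_Zp_prod3 JM JM')/or3P[] ->; rewrite ?orbT.
apply: (leq_trans (leq_card_setU _ _)); rewrite !mulSn mul0n addn0 addnA leq_add ?cW //.
by apply: (leq_trans (leq_card_setU _ _)); rewrite leq_add ?cW.
Qed.

Lemma card_Zp_units : #|[set c : A | c \is a GRing.unit]| = totient (p ^ M).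
Proof.
rewrite -card_units_Zp; last by rewrite expn_gt0 prime_gt0.
by rewrite cardsT card_sub cardsE.
Qed.

Lemma totient_pfactor_ge : (p ^ M <= 2 * totient (p ^ M))%N.
Proof.
case: M M0 => // k _; rewrite totient_pfactor // expnS /= mulnA leq_mul2r; apply/orP; right.
by have := prime_gt1 pp; lia.
Qed.

(** With q = p^M and t the totient of q, the moment bound reads |K|^4 t <= q^2 * 3 q^3 p^-J, and q
    <= 2 t turns 3 q^5 into 3 * 2^5 t^5 = 96 t^5. *)
Lemma kloost_bound J (a b : A) : (3 * J.-1 < M)%N -> (J <= M)%N ->
  (a \is a GRing.unit) || (b \is a GRing.unit) ->
  (Normc.normc (kloost R a b) / (totient (p ^ M))%:R) ^+ 4 <= 96 * p%:R ^- J.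
Proof.
move=> JM JM' ab; have := kloost_bound_quads R expM_gt1 ab.
rewrite card_Zp_units norm_normc; set n := Normc.normc _; set t := totient _.
rewrite -rmorphXn -rmorphMn -!(rmorph_nat (real_complex R)) -rmorphXn -rmorphM /= lecR => h.
have t0 : (0 < t%:R :> R) by rewrite ltr0n totient_gt0 expn_gt0 prime_gt0.
have p0 : (0 < p%:R :> R) by rewrite ltr0n prime_gt0.
have tq : (p%:R ^+ M <= 2 * t%:R :> R).
  by rewrite -natrX -natrM ler_nat totient_pfactor_ge.
have qb : (#|kloost_quads (p ^ M)|%:R * p%:R ^+ J <= 3 * p%:R ^+ (3 * M) :> R).
  rewrite -!natrX -!natrM ler_nat.
  apply: (leq_trans (leq_mul (kloost_quads_bound JM JM') (leqnn _))).
  by rewrite -mulnA -expnD subnK //; lia.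
rewrite expr_div_n ler_pdivrMr ?exprn_gt0 // -(ler_pM2r t0).
rewrite mulr_natr; apply: (le_trans h).
rewrite (_ : 96 / p%:R ^+ J * t%:R ^+ 4 * t%:R = 96 * t%:R * t%:R ^+ 4 / p%:R ^+ J); last by ring.
rewrite ler_pdivlMr ?exprn_gt0 // -[leLHS]mulrA.
apply: (le_trans (ler_wpM2l _ qb)); first by rewrite exprn_ge0 ?ler0n.
rewrite natrX.
have -> : (p%:R ^+ M) ^+ 2 * (3 * p%:R ^+ (3 * M)) = 3 * (p%:R ^+ M) ^+ 5 :> R.
  by rewrite [(3 * M)%N]mulnC [in p%:R ^+ (M * 3)]exprM; ring.
have -> : 96 * t%:R * (t%:R) ^+ 4 = 3 * (2 * t%:R) ^+ 5 :> R by ring.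
by rewrite ler_pM2l // lerXn2r // nnegrE ?exprn_ge0 ?mulr_ge0 // ltW.
Qed.

End PrimePower.

(** * Upper unitriangular matrices *)

Section Unipotent.
Variables (F : fieldType) (n : nat).
Local Notation M := 'M[F]_n.+1.
Implicit Types u v : M.

Definition unip u := (forall i j : 'I_n.+1, (j < i)%N -> u i j = 0) /\ forall i, u i i = 1.

Lemma unip1 : unip 1%:M.
Proof.
split=> [i j ji|i]; rewrite mxE ?eqxx //.
by case: eqVneq => // e; rewrite e ltnn in ji.
Qed.

Lemma unipM_entry u v i j : unip u -> unip v ->
  (u *m v) i j = \sum_(l < n.+1 | (i <= l <= j)%N) u i l * v l j.
Proof.
move=> [u0 _] [v0 _]; rewrite mxE [RHS]big_mkcond /=; apply: eq_bigr => l _.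
case: leqP => [il|li] /=; last by rewrite u0 ?mul0r.
by case: leqP => [//|jl]; rewrite v0 ?mulr0.
Qed.

Lemma unipM u v : unip u -> unip v -> unip (u *m v).
Proof.
move=> uu uv; split=> [i j ji|i]; rewrite unipM_entry //.
  by rewrite big_pred0 // => l; apply/negbTE/negP => /andP[il lj];
    have := leq_ltn_trans (leq_trans il lj) ji; rewrite ltnn.
rewrite (big_pred1 i) ?uu.2 ?uv.2 ?mulr1 // => l.
by rewrite -eqn_leq eq_sym.
Qed.

Lemma det_unip u : unip u -> \det u = 1.
Proof.
move=> [u0 u1]; rewrite -det_tr det_trig; last first.
  by apply/is_trig_mxP => i j ij; rewrite mxE u0.
by rewrite big1 // => i _; rewrite mxE u1.
Qed.

Lemma unip_unit u : unip u -> u \in unitmx.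
Proof. by move=> uu; rewrite unitmxE det_unip ?unitr1. Qed.

Lemma unipV u : unip u -> unip (invmx u).
Proof.
move=> uu; have e := mulmxV (unip_unit uu); set v := invmx u in e *.
(* Back substitution from the bottom row: k bounds the distance of row i from it. *)
have h k (i j : 'I_n.+1) : (n - i <= k)%N -> (j <= i)%N -> v i j = (i == j)%:R.
  elim: k i j => [|k IHk] i j ik ji.
    have := congr1 (fun A : M => A i j) e; rewrite mxE (bigD1 i) //= big1 => [|l li]; last first.
      rewrite uu.1 ?mul0r // ltn_neqAle li /=; have := ltn_ord l; have := ltn_ord i; lia.
    by rewrite addr0 uu.2 mul1r mxE.
  have := congr1 (fun A : M => A i j) e; rewrite mxE (bigD1 i) //= big1 => [|l li]; last first.
    have [il|li'] := leqP i l; last by rewrite uu.1 ?mul0r.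
    have il' : (i < l)%N by rewrite ltn_neqAle eq_sym li.
    rewrite IHk ?(leq_trans ji) //; last by have := ltn_ord l; lia.
    by case: eqVneq => [lj|_]; rewrite ?mulr0 //; subst; have := leq_trans il' ji; rewrite ltnn.
  by rewrite addr0 uu.2 mul1r mxE.
split=> [i j ji|i]; rewrite (h n) ?leq_subr ?eqxx //; last exact: ltnW.
by case: eqVneq => // ij; rewrite ij ltnn in ji.
Qed.

Definition sdiag u (j : 'I_n) : F := u (widen_ord (leqnSn n) j) (lift ord0 j).

Lemma sdiagM u v j : unip u -> unip v -> sdiag (u *m v) j = sdiag u j + sdiag v j.
Proof.
move=> uu uv; rewrite /sdiag unipM_entry //.
set i := widen_ord _ j; set i' := lift ord0 j.
have ii' : i' = i.+1 :> nat by [].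
rewrite (bigD1 i) /=; last by rewrite leqnn /= leqnSn.
rewrite (big_pred1 i') ?uu.2 ?uv.2 ?mulr1 ?mul1r 1?addrC // => l.
by rewrite /= -(inj_eq val_inj) -[in RHS](inj_eq val_inj) /= /bump /=; lia.
Qed.

End Unipotent.

(** * The Weyl element, its Heisenberg group and its Bruhat cell *)

Section WStar.
Variables (F : fieldType) (n : nat).
Hypothesis n2 : (2 <= n)%N.
Local Notation M := 'M[F]_n.+1.
Local Notation mx := (@ord_max n).
Implicit Types (i j : 'I_n.+1) (A u v : M).

(** [w_star] is monomial with permutation [sg] and row signs [eps]. On the [inner] indices 1, ...,
    n-1 it is -1, so it commutes with every matrix supported on that block and trivial elsewhere. *)
Definition sg i : 'I_n.+1 := if i == ord0 then mx else if i == mx then ord0 else i.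
Definition eps i : F := if i == ord0 then (-1) ^+ n else if i == mx then 1 else -1.
Definition inner i := (i != ord0) && (i != mx).

Lemma max_neq0 : mx != ord0.
Proof. by rewrite -val_eqE /= -lt0n; case: n n2. Qed.

Lemma sgK : involutive sg.
Proof.
move=> i; rewrite /sg; case: (eqVneq i ord0) => [->|i0]; rewrite ?(negbTE max_neq0) ?eqxx //.
by case: (eqVneq i mx) => [->|im]; rewrite ?eqxx // (negbTE i0) (negbTE im).
Qed.

Lemma sg_inner i : inner i -> sg i = i.
Proof. by rewrite /sg => /andP[/negbTE-> /negbTE->]. Qed.

Lemma sg0 : sg ord0 = mx. Proof. by []. Qed.

Lemma sgm : sg mx = ord0. Proof. by rewrite /sg (negbTE max_neq0) eqxx. Qed.

Variant idx_spec : 'I_n.+1 -> bool -> bool -> bool -> Prop :=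
| Idx0 : idx_spec ord0 true false false
| IdxM : idx_spec mx false true false
| IdxI i of inner i : idx_spec i false false true.

Lemma idxP i : idx_spec i (i == ord0) (i == mx) (inner i).
Proof.
rewrite /inner; have [->|i0] := eqVneq i ord0.
  by rewrite eq_sym (negbTE max_neq0) /=; exact: Idx0.
have [->|im] := eqVneq i mx; first exact: IdxM.
by apply: IdxI; rewrite /inner i0 im.
Qed.

Lemma eps_neq0 i : eps i != 0.
Proof. by rewrite /eps; case: idxP => *; rewrite ?expf_neq0 ?oppr_eq0 ?oner_eq0. Qed.

Definition wst : M := \matrix_(i, j)
    if (i == 0) && (j == mx) then (-1) ^+ n
    else if (i == mx) && (j == 0) then 1
    else if [&& i == j, i != 0 & i != mx] then -1
    else 0.

Lemma wstE i j : wst i j = if j == sg i then eps i else 0.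
Proof.
rewrite mxE -[(0 : 'I_n.+1)]/(@ord0 n) /sg /eps; case: (idxP i) => /= [||k _].
- by case: (j == mx); rewrite ?andbF.
- by rewrite andbF.
- by rewrite andbT eq_sym.
Qed.

Lemma wst_mull A i j : (wst *m A) i j = eps i * A (sg i) j.
Proof.
rewrite mxE (bigD1 (sg i)) //= wstE eqxx big1 ?addr0 // => l ls.
by rewrite wstE (negbTE ls) mul0r.
Qed.

Lemma wst_mulr A i j : (A *m wst) i j = A i (sg j) * eps (sg j).
Proof.
rewrite mxE (bigD1 (sg j)) //= wstE sgK eqxx big1 ?addr0 // => l ls.
rewrite wstE; case: eqVneq => [e|_]; last by rewrite mulr0.
by rewrite e sgK eqxx in ls.
Qed.

Lemma wst_unit : wst \in unitmx.
Proof.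
pose w' : M := \matrix_(i, j) if j == sg i then (eps j)^-1 else 0.
have: wst *m w' = 1%:M.
  apply/matrixP => i j; rewrite wst_mull !mxE sgK [j == i]eq_sym.
  by case: eqVneq => [->|_]; rewrite ?divff ?eps_neq0 ?mulr0.
by move=> /mulmx1_unit[].
Qed.

(** The Heisenberg group of dimension 2 n - 1, which turns out to be [U_ w_star]. Although a and b
    are functions of all indices, only their inner values enter. *)
Definition heis (a b : 'I_n.+1 -> F) (z : F) : M := \matrix_(i, j)
  if i == j then 1 else if i == ord0 then (if j == mx then z else a j)
  else if j == mx then b i else 0.

Lemma heisE a b z i j : heis a b z i j =
  if i == j then 1 else if i == ord0 then (if j == mx then z else a j)
  else if j == mx then b i else 0.
Proof. by rewrite mxE. Qed.

Lemma heis_unip a b z : unip (heis a b z).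
Proof.
split=> [i j ji|i]; rewrite mxE ?eqxx //.
case: eqVneq => [e|ij]; first by rewrite e ltnn in ji.
case: (idxP i) ji ij => [|jm|k _ ki]; first by rewrite ltn0.
  by rewrite eq_sym => /negbTE ->.
by case: (idxP j) ki => //= ; rewrite ltnNge leq_ord.
Qed.

Lemma heisP u : unip u -> (forall i j, inner i -> inner j -> i != j -> u i j = 0) ->
  u = heis (u ord0) (fun i => u i mx) (u ord0 mx).
Proof.
move=> uu u0; apply/matrixP => i j; rewrite mxE.
case: eqVneq => [->|ij]; first by rewrite uu.2.
case: (idxP i) ij => [|mj|k ik kj]; first by case: (idxP j).
  rewrite eq_sym (negbTE mj) uu.1 // ltn_neqAle leq_ord andbT.
  by apply: contra mj => /eqP e; apply/eqP/ord_inj.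
case: (idxP j) kj => // [k0|l il kl]; last by rewrite u0.
by rewrite uu.1 // lt0n.
Qed.

(** Conjugation by [wst] keeps an inner entry in place up to sign, hence above the diagonal, so it
    has to vanish; it sends the first row and the last column below the diagonal. *)
Lemma heis_conj u : unip u ->
  (exists v, unip v^T /\ wst *m u = v *m wst) <->
  (forall i j, inner i -> inner j -> i != j -> u i j = 0).
Proof.
move=> uu; split=> [[v [uv e]] i j ii ij nij|u0].
  have [ji|ij'] := ltnP j i; first by rewrite uu.1.
  have {}ij' : (i < j)%N by rewrite ltn_neqAle nij.
  have := congr1 (fun A : M => A i j) e; rewrite wst_mull wst_mulr !sg_inner //.
  have := uv.1 j i ij'; rewrite mxE => ->; rewrite mul0r => /eqP.
  by rewrite mulf_eq0 (negbTE (eps_neq0 _)) => /eqP.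
exists (\matrix_(i, j) (eps i * u (sg i) (sg j) / eps j)); split; last first.
  by apply/matrixP => i j; rewrite wst_mull wst_mulr mxE sgK mulfVK ?eps_neq0.
split=> [i j ji|i]; rewrite !mxE; last by rewrite uu.2 mulr1 divff ?eps_neq0.
rewrite [u _ _](_ : _ = 0) ?mulr0 ?mul0r //.
case: (idxP i) ji => [|jm|k ik jk]; first by rewrite ltn0.
  rewrite sgm; case: (idxP j) jm => [_|/[!ltnn]//|l il _].
    by rewrite sg0 uu.1 //= lt0n; exact: max_neq0.
  by rewrite (sg_inner il) uu.1 // lt0n; move: il => /andP[].
rewrite (sg_inner ik); case: (idxP j) jk => [||l il] jk.
- rewrite sg0 uu.1 //; move/andP: ik => [_]; rewrite -val_eqE /= ltn_neqAle => ->; exact: leq_ord.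
- by move: jk; rewrite ltnNge leq_ord.
- by rewrite (sg_inner il) u0 // -val_eqE; case: ltngtP jk.
Qed.

Section BigCell.
Variable D : 'I_n.+1 -> F.
Hypothesis D0 : forall i, D i != 0.
Let t : M := diag_mx (\row_i D i).
Let N : M := t *m wst.

Lemma cell_mull A i j : (N *m A) i j = D i * eps i * A (sg i) j.
Proof. by rewrite /N -mulmxA mul_diag_mx mxE wst_mull mxE mulrA. Qed.

Lemma cell_mulr A i j : (A *m N) i j = A i (sg j) * (D (sg j) * eps (sg j)).
Proof. by rewrite /N mulmxA wst_mulr mul_mx_diag !mxE mulrA. Qed.

Lemma cell_unit : N \in unitmx.
Proof.
rewrite /N unitmx_mul wst_unit andbT unitmxE det_diag unitfE; apply/prodf_neq0 => i _.
by rewrite mxE.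
Qed.

(** Factor v as [vb] times a Heisenberg element, with [vb] supported on the inner block. There [wst]
    is scalar, so moving [vb] through [N] only conjugates it by the diagonal D, and the result [V]
    is again upper unipotent. *)
Lemma bigcell_decomp v : unip v -> exists V a b z, unip V /\ N *m v = V *m N *m heis a b z.
Proof.
move=> uv.
pose vb : M := \matrix_(i, j) if i == j then 1 else if inner i && inner j then v i j else 0.
pose V : M := \matrix_(i, j) if i == j then 1 else
   if inner i && inner j then D i * v i j / D j else 0.
have uvb : unip vb.
  split=> [i j ji|i]; rewrite mxE ?eqxx //; case: eqVneq => [e|_]; first by rewrite e ltnn in ji.
  by case: ifP => // _; rewrite uv.1.
have uV : unip V.
  split=> [i j ji|i]; rewrite mxE ?eqxx //; case: eqVneq => [e|_]; first by rewrite e ltnn in ji.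
  by case: ifP => // _; rewrite uv.1 // mulr0 mul0r.
have e1 : N *m vb = V *m N.
  apply/matrixP => i j; rewrite cell_mull cell_mulr !mxE -{1}(sgK j) (can_eq sgK).
  case: eqVneq => [->|ij]; first by rewrite mulr1 mul1r.
  case: (boolP (inner (sg i) && inner j)) => [/andP[ii jj]|]; last first.
    rewrite mulr0; case: ifP => [|_ _]; last by rewrite mul0r.
    by move=> /andP[ii jj]; rewrite (sg_inner ii) ii -{1}[j]sgK (sg_inner jj) jj.
  have ii' : inner i by rewrite -(sgK i) (sg_inner ii).
  rewrite !(sg_inner jj) !(sg_inner ii') ii' jj /= /eps.
  move: ii' jj => /andP[/negbTE-> /negbTE->] /andP[/negbTE-> /negbTE->].
  by rewrite !mulrA divfK //; ring.
have ub := unip_unit uvb.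
(* Row 0 of [vb] is trivial, so a and z are read off v itself; the last column has to be corrected
   by the inverse of [vb]. *)
pose b i := (invmx vb *m v) i mx.
exists V, (v ord0), b, (v ord0 mx); split=> //.
rewrite -e1 -mulmxA; congr (_ *m _).
apply/matrixP => i j.
case: (idxP i) => [||k ik].
- rewrite mxE (bigD1 ord0) //= big1 ?addr0 => [|l l0]; last first.
    by rewrite mxE eq_sym (negbTE l0) /inner eqxx /= mul0r.
  rewrite mxE eqxx mul1r heisE; case: eqVneq => [<-|_]; first by rewrite uv.2.
  by rewrite eqxx; case: (eqVneq j mx) => [->|].
- rewrite mxE (bigD1 mx) //= big1 ?addr0 => [|l l0]; last first.
    by rewrite mxE eq_sym (negbTE l0) /inner eqxx andbF /= mul0r.
  rewrite mxE eqxx mul1r heisE; case: eqVneq => [<-|mj]; first by rewrite uv.2.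
  rewrite (negbTE max_neq0) uv.1 // ltn_neqAle leq_ord andbT.
  by apply: contra mj => /eqP e; apply/eqP/ord_inj.
case: (eqVneq j mx) => [->|jm].
  have : v k mx = (vb *m (invmx vb *m v)) k mx by rewrite mulmxA mulmxV // mul1mx.
  move=> ->; rewrite !mxE; apply: eq_bigr => l _.
  have [il|] := boolP (inner l).
    by rewrite heisE; move: il => /andP[/negbTE-> /negbTE->]; rewrite eqxx.
  move=> il; have -> : vb k l = 0.
    by rewrite mxE (negbTE il) andbF; case: eqVneq => // e; rewrite -e ik in il.
  by rewrite !mul0r.
case: (eqVneq j ord0) => [->|j0].
  rewrite (uv.1 k ord0); last by rewrite lt0n; case/andP: ik.
  rewrite mxE big1 // => l _; rewrite heisE; case: eqVneq => [->|l0].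
    by rewrite mxE /inner eqxx andbF; move: ik => /andP[/negbTE-> _]; rewrite mul0r.
  by rewrite ?(negbTE l0) eq_sym (negbTE max_neq0) mulr0.
have ij : inner j by rewrite /inner j0 jm.
rewrite mxE (bigD1 j) //= big1 ?addr0 => [|l lj]; last first.
  rewrite heisE (negbTE lj) (negbTE jm); case: eqVneq => [e|_]; last by rewrite mulr0.
  by rewrite mxE e /inner eqxx andbF; move: ik => /andP[/negbTE-> _]; rewrite mul0r.
by rewrite heisE eqxx mulr1 mxE ik ij; case: eqVneq => [->|//]; rewrite uv.2.
Qed.

(** The quotient [U] of the two left factors maps one cell element to the other. Column 0 of
    [N *m heis] is a multiple of the last basis vector, which forces the last column of [U]; the
    inner columns are diagonal above the last row, which then forces the inner columns of [U]. *)
Lemma bigcell_uniq u a b z u1 a1 b1 z1 : unip u -> unip u1 ->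
  u *m N *m heis a b z = u1 *m N *m heis a1 b1 z1 ->
  u = u1 /\ heis a b z = heis a1 b1 z1.
Proof.
move=> uu uu1 e.
pose U := invmx u1 *m u.
have uU : unip U by apply: unipM => //; exact: unipV.
have {}e : U *m (N *m heis a b z) = N *m heis a1 b1 z1.
  by rewrite /U -mulmxA [u *m (N *m _)]mulmxA e -[u1 *m N *m _]mulmxA mulKmx // unip_unit.
have N0 (a' b' : 'I_n.+1 -> F) (z' : F) i : i != mx -> (N *m heis a' b' z') i ord0 = 0.
  move=> im; rewrite cell_mull heisE; case: eqVneq => [e0|s0].
    by rewrite -(sgK i) e0 sg0 eqxx in im.
  by rewrite eq_sym (negbTE max_neq0) mulr0.
have Nm (a' b' : 'I_n.+1 -> F) (z' : F) : (N *m heis a' b' z') mx ord0 = D mx.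
  by rewrite cell_mull sgm heisE eqxx mulr1 /eps (negbTE max_neq0) eqxx mulr1.
have Um i : i != mx -> U i mx = 0.
  move=> im; have := congr1 (fun A : M => A i ord0) e.
  rewrite (N0 a1) // mxE (bigD1 mx) //= big1 => [|l lm]; last by rewrite N0 ?mulr0.
  by rewrite addr0 Nm => /eqP; rewrite mulf_eq0 (negbTE (D0 _)) orbF => /eqP.
have Ni (a' b' : 'I_n.+1 -> F) (z' : F) i j : i != mx -> inner j ->
    (N *m heis a' b' z') i j = if i == j then - D i else 0.
  move=> im ij; rewrite cell_mull heisE.
  case: (idxP i) im => // [_|k ik _].
    have/andP[j0 jm] := ij; rewrite sg0 [mx == j]eq_sym [ord0 == j]eq_sym (negbTE j0) (negbTE jm).
    by rewrite (negbTE max_neq0) mulr0.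
  have/andP[j0 jm] := ij; rewrite sg_inner // (negbTE jm) /eps; move: (ik) => /andP[/negbTE-> /negbTE->].
  by case: eqVneq; rewrite ?mulr0 // mulr1 mulrN1.
have U1 : U = 1%:M.
  apply/matrixP => i j; rewrite [RHS]mxE.
  case: (eqVneq i j) => [->|ij]; first by rewrite uU.2.
  case: (idxP j) ij => [i0|im|k ik ne].
  - by rewrite uU.1 // lt0n.
  - by rewrite Um.
  case: (eqVneq i mx) => [->|im].
    rewrite uU.1 //; case/andP: ik => _; rewrite -val_eqE /= ltn_neqAle => ->; exact: leq_ord.
  have := congr1 (fun A : M => A i k) e.
  rewrite Ni // (negbTE ne) mxE (bigD1 k) //= big1 => [|l lk]; last first.
    case: (eqVneq l mx) => [->|lm]; first by rewrite Um ?mul0r.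
    by rewrite Ni // (negbTE lk) mulr0.
  rewrite addr0 Ni ?eqxx //; last by case/andP: ik.
  by move=> /eqP; rewrite mulf_eq0 oppr_eq0 (negbTE (D0 _)) orbF => /eqP.
split; last by move: e; rewrite U1 mul1mx => /(congr1 (mulmx (invmx N))); rewrite !mulKmx // cell_unit.
have : u1 *m U = u1 by rewrite U1 mulmx1.
by rewrite /U mulKVmx // unip_unit.
Qed.

End BigCell.

End WStar.

(** * Integrality of minors and the denominators it allows *)

Section Minors.
Variables (F : fieldType) (n : nat).
Hypothesis n2 : (2 <= n)%N.
Local Notation M := 'M[F]_n.+1.
Local Notation mx := (@ord_max n).
Variable I : F -> Prop.
Hypotheses (I0 : I 0) (I1 : I 1) (IN : forall x, I x -> I (- x))
  (ID : forall x y, I x -> I y -> I (x + y)) (IM : forall x y, I x -> I y -> I (x * y)).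
Implicit Types (A V W : M).

Let Iprod (T : Type) (s : seq T) (Q : pred T) (f : T -> F) :
  (forall i, Q i -> I (f i)) -> I (\prod_(i <- s | Q i) f i).
Proof. by move=> h; elim/big_ind: _. Qed.

Let Isum (T : Type) (s : seq T) (Q : pred T) (f : T -> F) :
  (forall i, Q i -> I (f i)) -> I (\sum_(i <- s | Q i) f i).
Proof. by move=> h; elim/big_ind: _. Qed.

Lemma det_integral A : (forall i j, I (A i j)) -> I (\det A).
Proof.
move=> IA; apply: Isum => s _; apply: IM; last by apply: Iprod.
by case: (perm.odd_perm s); rewrite ?expr0 ?expr1 //; exact: IN.
Qed.

Lemma det_integral_row A i0 c : (forall i j, i != i0 -> I (A i j)) ->
  (forall j, I (c * A i0 j)) -> I (c * \det A).
Proof.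
move=> IA IA0; pose d : 'rV[F]_n.+1 := \row_i if i == i0 then c else 1.
have -> : c * \det A = \det (diag_mx d *m A).
  rewrite det_mulmx det_diag (bigD1 i0) //= !mxE eqxx big1 ?mulr1 // => i ii.
  by rewrite mxE (negbTE ii).
apply: det_integral => i j; rewrite mul_diag_mx !mxE.
by case: eqVneq => [->//|ii]; rewrite mul1r; exact: IA.
Qed.

(** A factor with square 1 is its own inverse, so multiplying by it once more removes it. This
    discards the signs in a minor without computing them. *)
Lemma prod_sign_integral (T : finType) (Q : pred T) (f : T -> F) (s : pred T) y :
  (forall i, Q i -> ~~ s i -> f i ^+ 2 = 1 /\ I (f i)) ->
  I (y * \prod_(i | Q i) f i) -> I (y * \prod_(i | Q i && s i) f i).
Proof.
move=> h; rewrite (bigID s) /=; set A := \prod_(i | Q i && s i) _; set B := \prod_(i | _) _.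
have B2 : B * B = 1.
  by rewrite -big_split /=; apply: big1 => i /andP[qi si]; rewrite -expr2; case: (h _ qi si).
have IB : I B by apply: Iprod => i /andP[qi si]; case: (h _ qi si).
by move=> /IM/(_ IB); rewrite mulrA -mulrA B2 mulr1.
Qed.

Variables (P : F) (rr : nat -> nat).
Hypotheses (P0 : P != 0) (r0 : rr 0 = 0%N) (rn : rr n.+1 = 0%N).
Let D i : F := P ^ ((rr i)%:Z - (rr i.+1)%:Z).

Lemma prod_torus k : (k <= n.+1)%N ->
  \prod_(i < n.+1 | (k <= i)%N) D i = P ^ (rr k)%:Z.
Proof.
move=> kn; rewrite -(big_mkord (fun i => (k <= i)%N) (fun i => P ^ ((rr i)%:Z - (rr i.+1)%:Z))).
rewrite -(@big_nat_widenl _ _ _ k 0 n.+1 xpredT) //.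
rewrite (eq_bigr (fun i => P ^ (rr i)%:Z / P ^ (rr i.+1)%:Z)) => [|i _]; last first.
  by rewrite expfzDr // invr_expz.
have [kn'|kn'|->] := ltngtP k n.+1; last 1 first.
- by rewrite big_geq // rn expr0z.
- rewrite GRing.telescope_prodr ?rn ?expr0z ?divr1 // => i _.
  by rewrite unitfE expfz_neq0.
- by rewrite ltnNge kn in kn'.
Qed.

Variables (u : M) (a b : 'I_n.+1 -> F) (z : F).
Hypothesis uu : unip u.
Let Mx : M := diag_mx (\row_i D i) *m wst F n *m heis a b z.
Let x := u *m (diag_mx (\row_i D i) *m wst F n) *m heis a b z.
Hypothesis Ix : forall i j, I (x i j).

Let xE : x = u *m Mx.
Proof. by rewrite /x /Mx -mulmxA. Qed.

Lemma cell_row0 j : Mx ord0 j = D 0%N * (-1) ^+ n * (if j == mx then 1 else 0).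
Proof.
rewrite /Mx cell_mull // sg0 heisE /eps eqxx eq_sym (negbTE (max_neq0 n2)).
by case: (j == mx).
Qed.

Lemma cell_row i j : inner i ->
  Mx i j = - D i * (if i == j then 1 else if j == mx then b i else 0).
Proof.
move=> ii; rewrite /Mx cell_mull // sg_inner // heisE /eps.
by move: ii => /andP[/negbTE-> /negbTE->]; rewrite mulrN1.
Qed.

Lemma cell_rowm j : Mx mx j = D n * (if j == ord0 then 1 else if j == mx then z else a j).
Proof. by rewrite /Mx cell_mull // sgm // heisE eqxx /eps (negbTE (max_neq0 n2)) eqxx mulr1 eq_sym. Qed.

(* As u is upper unitriangular, a minor of x = u Mx on the rows >= k equals that of Mx. It is
   written as the full-size determinant of W, whose rows above k are unit vectors, after the
   choice g of columns; V' makes W triangular. *)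
Lemma minor_bottom (k : nat) (g : 'I_n.+1 -> 'I_n.+1) (V' : M) (f : 'I_n.+1 -> F) :
  let W : M := \matrix_(i, j) if (i < k)%N then (i == j)%:R else Mx i (g j) in
  (k <= n.+1)%N -> unip V' ->
  (forall i j : 'I_n.+1, (i < j)%N -> (W *m V') i j = 0) ->
  (forall i : 'I_n.+1, (i < k)%N -> (W *m V') i i = 1) ->
  (forall i : 'I_n.+1, (k <= i)%N -> (W *m V') i i = D i * f i) ->
  I (P ^ (rr k)%:Z * \prod_(i < n.+1 | (k <= i)%N) f i).
Proof.
move=> W kn uV' trW dW1 dW.
pose V : M := \matrix_(i, j) if (i < k)%N then (i == j)%:R else u i j.
have uV : unip V.
  split=> [i j ji|i]; rewrite mxE ?eqxx ?uu.2; last by case: ifP.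
  by rewrite uu.1 // (negbTE (_ : i != j)) ?if_same // -val_eqE neq_ltn ji orbT.
have IVW : I (\det (V *m W)).
  apply: det_integral => i j; case: (ltnP i k) => ik.
    rewrite mxE (bigD1 i) //= big1 => [|l li]; rewrite mxE ik ?eqxx.
      by rewrite mul1r addr0 mxE ik; case: eqP.
    by rewrite eq_sym (negbTE li) mul0r.
  suff -> : (V *m W) i j = x i (g j) by [].
  rewrite xE !mxE; apply: eq_bigr => l _; rewrite mxE ltnNge ik /=.
  case: (ltnP l k) => lk; first by rewrite uu.1 ?mul0r // (leq_trans lk).
  by rewrite mxE ltnNge lk.
suff <- : \det (V *m W) = P ^ (rr k)%:Z * \prod_(i < n.+1 | (k <= i)%N) f i by [].
rewrite det_mulmx det_unip // mul1r.
have -> : \det W = \det (W *m V') by rewrite det_mulmx (det_unip uV') mulr1.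
rewrite det_trig; last by apply/is_trig_mxP.
rewrite -prod_torus // -big_split /= [RHS]big_mkcond /=; apply: eq_bigr => i _.
by case: (leqP k i) => ik; [rewrite dW|rewrite dW1].
Qed.

(* Rows k, k+2, ..., n of x: subtracting u_(k,k+1) times row k+1 leaves a combination of the rows
   k, k+2, ... of Mx, so that c must absorb the denominator of that superdiagonal entry. *)
Lemma minor_skip (k : 'I_n) (g : 'I_n.+1 -> 'I_n.+1) (f : 'I_n.+1 -> F) c :
  let W : M := \matrix_(i, j) if (i <= k)%N then (i == j)%:R else
    if i == lift ord0 k then Mx (widen_ord (leqnSn n) k) (g j) else Mx i (g j) in
  I c -> I (c * sdiag u k) ->
  (forall i j : 'I_n.+1, (i < j)%N -> W i j = 0) ->
  (W (lift ord0 k) (lift ord0 k) = D k * f (lift ord0 k)) ->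
  (forall i : 'I_n.+1, (k.+1 < i)%N -> W i i = D i * f i) ->
  I (c * P ^ ((rr k)%:Z - (rr k.+1)%:Z + (rr k.+2)%:Z) * \prod_(i < n.+1 | (k < i)%N) f i).
Proof.
set k0 := widen_ord _ k; set k1 := lift ord0 k => W Ic Icu trW dWk dW.
have k1E : k1 = k.+1 :> nat by [].
have k0E : k0 = k :> nat by [].
(* Row k+1 of [V] holds the coefficients of row k minus [sdiag u k] times row k+1 of u. Its entry 1
   at column k is moved to the diagonal, because [W] stores row k of [Mx] in row k+1. *)
pose V : M := \matrix_(i, j) if (i <= k)%N then (i == j)%:R else
   if i == k1 then (if j == k1 then 1 else u k0 j - sdiag u k * u k1 j - (k0 == j)%:R) else u i j.
have uV : unip V.
  split=> [i j ji|i]; rewrite mxE ?eqxx ?uu.2; last by case: ifP => //; case: (i == k1).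
  case: ifP => [_|ik]; first by case: eqVneq ji => // ->; rewrite ltnn.
  case: eqVneq ji => [->|_] ji; last by rewrite uu.1.
  case: eqVneq ji => [->|jk]; first by rewrite ltnn.
  rewrite k1E ltnS leq_eqVlt => /orP[jk'|jk'].
    have -> : j = k0 by apply/ord_inj/eqP.
    by rewrite uu.2 uu.1 // eqxx mulr0 subr0 subrr.
  have nk : (k0 == j) = false by apply/negbTE; rewrite -val_eqE /= neq_ltn jk' orbT.
  by rewrite nk [u k0 j]uu.1 // [u k1 j]uu.1 ?mulr0 ?subr0 // k1E ltnS ltnW.
have VW i j : (V *m W) i j = if (i <= k)%N then (i == j)%:R else
    if i == k1 then x k0 (g j) - sdiag u k * x k1 (g j) else x i (g j).
  case: ifP => ik.
    rewrite mxE (bigD1 i) //= big1 => [|l li]; rewrite mxE ik ?eqxx.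
      by rewrite mul1r addr0 mxE ik.
    by rewrite eq_sym (negbTE li) mul0r.
  case: eqVneq => [->|ik1].
    set m := g j; set s := sdiag u k.
    have -> : x k0 m - s * x k1 m = \sum_l (u k0 l - s * u k1 l) * Mx l m.
      rewrite xE !mxE mulr_sumr -sumrB; apply: eq_bigr => l _.
      by rewrite mulrBl mulrA.
    have k01 : k0 != k1 by rewrite -val_eqE /= neq_ltn ltnSn.
    rewrite mxE (bigD1 k1) //= (bigD1 k0) //= [V k1 k0]uV.1 ?k1E // mul0r add0r.
    rewrite [RHS](bigD1 k1) //= {1}/s /sdiag uu.2 mulr1 subrr mul0r add0r.
    rewrite [RHS](bigD1 k0) //= uu.2 [u k1 k0]uu.1 ?k1E // mulr0 subr0 mul1r.
    rewrite uV.2 mul1r [W k1 j]mxE k1E ltnn eqxx; congr (_ + _).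
    apply: eq_bigr => l /andP[lk1 lk0].
    rewrite [V k1 l]mxE k1E ltnn eqxx (negbTE lk1) [k0 == l]eq_sym (negbTE lk0) subr0.
    rewrite [W l j]mxE; case: leqP => lk; last by rewrite (negbTE lk1).
    have lk' : (l < k)%N by rewrite ltn_neqAle lk andbT; apply: contra lk0 => /eqP e; apply/eqP/ord_inj.
    by rewrite uu.1 // [u k1 l]uu.1 ?k1E ?ltnS // mulr0 subr0 !mul0r.
  rewrite xE !mxE; apply: eq_bigr => l _; rewrite mxE ik (negbTE ik1).
  case: (ltnP l i) => li; first by rewrite uu.1 ?mul0r.
  rewrite [W l j]mxE; have kl : (k.+1 < l)%N.
    apply: leq_trans li; rewrite ltn_neqAle ltnNge ik andbT.
    by apply: contra ik1 => /eqP e; apply/eqP/ord_inj; rewrite k1E.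
  by rewrite leqNgt (ltnW kl) /= ifN // neq_ltn kl orbT.
have Idet : I (c * \det (V *m W)).
  apply: (@det_integral_row _ k1) => [i j ik1|j]; rewrite VW ?k1E.
    by case: ifP; rewrite ?(negbTE ik1) // => _; case: eqP.
  by rewrite ltnn eqxx mulrBr mulrA; apply: ID; [|apply: IN]; apply: IM.
suff <- : c * \det (V *m W) = c * P ^ ((rr k)%:Z - (rr k.+1)%:Z + (rr k.+2)%:Z) * \prod_(i < n.+1 |
  (k < i)%N) f i by [].
rewrite -mulrA det_mulmx det_unip // mul1r det_trig; last by apply/is_trig_mxP.
congr (_ * _); rewrite expfzDr // -prod_torus; last by rewrite ltnS.
rewrite (bigID (fun i : 'I_n.+1 => (k < i)%N)) /= [X in _ * X]big1 => [|i]; last first.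
  by rewrite -leqNgt mxE => ->; rewrite eqxx.
rewrite mulr1 (bigD1 k1) ?k1E //= [X in _ = _ * X](bigD1 k1) ?k1E //= dWk -!mulrA; congr (_ * _).
rewrite mulrCA; congr (_ * _).
have Q (i : 'I_n.+1) : (k < i)%N && (i != k1) = (k.+1 < i)%N.
  by rewrite -val_eqE /= [in RHS]ltn_neqAle eq_sym andbC.
rewrite !(eq_bigl _ _ Q) -big_split; apply: eq_bigr => i ki.
exact: dW.
Qed.

Let innerE (i : 'I_n.+1) : inner i = (0 < i < n)%N.
Proof. by rewrite /inner -!val_eqE /= lt0n [(i < n)%N]ltn_neqAle leq_ord andbT. Qed.

(* Found by // in the side conditions of prod_sign_integral. *)
Let sign_m1 : (-1 : F) ^+ 2 = 1 /\ I (-1).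
Proof. by rewrite sqrrN expr1n; split=> //; exact: IN. Qed.

Let mulmx1E (W : M) i j : (W *m 1%:M) i j = W i j. Proof. by rewrite mulmx1. Qed.

Let ge_inner k (i j : 'I_n.+1) : (0 < k)%N -> (k <= i)%N -> (i < j)%N -> inner i.
Proof. by move=> k0 ki ij; rewrite innerE (leq_trans k0 ki) (leq_trans ij (leq_ord j)). Qed.

(** The minor on the rows i+1, ..., n and the columns i, ..., n-1, where column i is paired with row
    n: it is triangular with entries -D and the corner D_n a_i. *)
Lemma a_bound (i : 'I_n.+1) : inner i -> I (P ^ (rr i.+1)%:Z * a i).
Proof.
move=> ii; have in' := ii; rewrite innerE in in'; have/andP[i0 i_n] := in'.
pose g (j : 'I_n.+1) := if j == mx then i else j.
pose f (j : 'I_n.+1) := if j == mx then a i else -1.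
have W0 (k j : 'I_n.+1) : (i < k)%N -> inner k ->
    Mx k (g j) = - D k * (if k == j then 1 else 0).
  move=> ik kk; rewrite cell_row // /g.
  have [->|jm] := eqVneq j mx; last by rewrite (negbTE jm).
  have/andP[_ /negbTE->] := kk; have/andP[_ /negbTE->] := ii.
  by rewrite (negbTE (_ : k != i)) // -val_eqE neq_ltn ik orbT.
refine ((fun h => _) (@minor_bottom i.+1 g 1%:M f (leqW i_n) (unip1 F n) _ _ _));
  [|move=> k j kj|move=> k ki|move=> k ik].
- have := @prod_sign_integral _ _ _ (pred1 mx) _ _ h.
  rewrite (big_pred1 mx) => [|k]; last first.
    by rewrite /=; case: eqVneq => [->|_]; rewrite ?andbF ?andbT ?leqnn.
  by rewrite /f eqxx; apply=> k _ /negbTE /= kk; rewrite kk.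
- rewrite mulmx1E mxE ltnS; case: leqP => ki.
    by rewrite (negbTE (_ : k != j)) // -val_eqE neq_ltn kj.
  have kk : inner k by apply: ge_inner kj; last exact: ki.
  by rewrite W0 // (negbTE (_ : k != j)) ?mulr0 // -val_eqE neq_ltn kj.
- by rewrite mulmx1E mxE ki eqxx.
- rewrite mulmx1E mxE ltnNge ik /= /f; case: eqVneq => [->|km].
    rewrite cell_rowm /g eqxx; have/andP[/negbTE-> /negbTE->] := ii; by [].
  by rewrite W0 ?eqxx ?mulr1 ?mulrN1 // innerE (leq_trans _ ik) //= ltn_neqAle leq_ord andbT.
Qed.

(** The minor on the rows i, ..., n and the columns 0, i+1, ..., n: row i is paired with the last
    column, where its entry is -D_i b_i, and row n with column 0, where its entry is D_n. *)
Lemma b_bound (i : 'I_n.+1) : inner i -> I (P ^ (rr i)%:Z * b i).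
Proof.
move=> ii; have in' := ii; rewrite innerE in in'; have/andP[i0 i_n] := in'.
have/andP[ni0 nim] := ii.
pose g (j : 'I_n.+1) := if j == i then mx else if j == mx then ord0 else j.
pose f (j : 'I_n.+1) := if j == mx then 1 else if j == i then - b i else -1.
have W0 (k j : 'I_n.+1) : (i <= k)%N -> inner k -> (k <= j)%N ->
    Mx k (g j) = - D k * (if k == j then (if j == i then b i else 1) else 0).
  move=> ik kk kj; rewrite cell_row // /g; have/andP[k0 km] := kk.
  have [ji|ji] := eqVneq j i.
    have ki : k = i by apply/ord_inj/eqP; rewrite eqn_leq ik andbT -ji kj.
    by rewrite ki ji eqxx (negbTE nim) eqxx.
  have [->|jm] := eqVneq j mx; last by rewrite (negbTE jm).
  by rewrite (negbTE k0) (negbTE km) eq_sym (negbTE (max_neq0 n2)).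
refine ((fun h => _) (@minor_bottom i g 1%:M f (leqW (ltnW i_n)) (unip1 F n) _ _ _));
  [|move=> k j kj|move=> k ki|move=> k ik].
- have := @prod_sign_integral _ _ _ (pred1 i) _ _ h.
  rewrite (big_pred1 i) => [|k]; last first.
    by rewrite /=; case: eqVneq => [->|_]; rewrite ?andbF ?andbT ?leqnn.
  rewrite /f (negbTE nim) eqxx mulrN => h'; rewrite -[X in I X]opprK; apply: IN;
    apply: h' => k _ /negbTE ki.
  by rewrite [k == i]ki; case: eqP => // _; rewrite expr1n.
- rewrite mulmx1E mxE; case: ltnP => ki.
    by rewrite (negbTE (_ : k != j)) // -val_eqE neq_ltn kj.
  have kk : inner k by apply: ge_inner kj; last exact: ki.
  by rewrite W0 // ?(ltnW kj) // (negbTE (_ : k != j)) ?mulr0 // -val_eqE neq_ltn kj.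
- by rewrite mulmx1E mxE ki eqxx.
- rewrite mulmx1E mxE ltnNge ik /= /f; case: eqVneq => [->|km].
    by rewrite cell_rowm /g [mx == i]eq_sym (negbTE nim) !eqxx.
  rewrite W0 ?eqxx //; first by case: eqP; rewrite ?mulr1 ?mulrN1 // mulrN mulNr.
  by rewrite innerE (leq_trans _ ik) //= ltn_neqAle leq_ord andbT.
Qed.

Definition zpart (k : nat) := z - \sum_(l < n.+1 | inner l && (k <= l)%N) a l * b l.

(** The minor on the rows and columns k, ..., n. The column operations [V'] subtract b_l times
    column l from the last column; this clears the b_l and leaves D_n times the Schur complement
    [zpart k] in the corner. *)
Lemma z_bound k : (0 < k <= n)%N -> I (P ^ (rr k)%:Z * zpart k).
Proof.
move=> /andP[k0 kn].
pose V' : M := \matrix_(i, j) if i == j then 1 else if (j == mx) && inner i && (k <= i)%N then - b i else 0.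
pose f (j : 'I_n.+1) := if j == mx then zpart k else -1.
have uV' : unip V'.
  split=> [i j ji|i]; rewrite mxE ?eqxx //; case: eqVneq => [e|_]; first by rewrite e ltnn in ji.
  by case: eqVneq ji => [->|//]; rewrite ltnNge leq_ord.
pose W : M := \matrix_(i, j) if (i < k)%N then (i == j)%:R else Mx i (id j).
have WV (i j : 'I_n.+1) : (W *m V') i j = W i j + if j == mx then \sum_(l | inner l && (k <= l)%N) W
  i l * - b l else 0.
  rewrite mxE (bigD1 j) //= [V' _ _]mxE eqxx mulr1; congr (_ + _).
  case: (eqVneq j mx) => [->|jm]; last first.
    by rewrite big1 // => l lj; rewrite [V' _ _]mxE (negbTE lj) (negbTE jm) mulr0.
  rewrite [LHS]big_mkcond [RHS]big_mkcond /=; apply: eq_bigr => l _.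
  rewrite [V' _ _]mxE eqxx /=; case: eqVneq => [->|_] /=; first by rewrite /inner eqxx andbF.
  by case: ifP => //; rewrite mulr0.
have W0 (i j : 'I_n.+1) : (k <= i)%N -> inner i -> (W *m V') i j = - D i * (if i == j then 1 else 0).
  move=> ki ii; rewrite WV mxE ltnNge ki /= cell_row //.
  case: (eqVneq j mx) => [->|jm]; last by rewrite addr0.
  have/andP[_ im] := ii; rewrite (negbTE im).
  rewrite (bigD1 i) ?ii //= big1 => [|l /andP[/andP[il kl] li]].
    by rewrite mxE ltnNge ki /= cell_row // eqxx mulr1 addr0 mulrN subrr mulr0.
  rewrite mxE ltnNge ki /= cell_row // eq_sym (negbTE li).
  by have/andP[_ /negbTE->] := il; rewrite mulr0 mul0r.
refine ((fun h => _) (@minor_bottom k id V' f (leqW kn) uV' _ _ _));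
  [|move=> i j ij|move=> i ik|move=> i ki].
- have := @prod_sign_integral _ _ _ (pred1 mx) _ _ h.
  rewrite (big_pred1 mx) => [|l]; last first.
    by rewrite /=; case: eqVneq => [->|_]; rewrite ?andbF ?andbT //= kn.
  by rewrite /f eqxx; apply=> l _ /negbTE /= kk; rewrite kk.
- case: (ltnP i k) => ik; last first.
    by rewrite W0 // ?(ge_inner k0 ik ij) // (negbTE (_ : i != j)) ?mulr0 // -val_eqE neq_ltn ij.
  rewrite WV mxE ik (negbTE (_ : i != j)) ?add0r -?val_eqE ?neq_ltn ?ij //.
  case: ifP => // _; apply: big1 => l /andP[_ kl].
  by rewrite mxE ik (negbTE (_ : i != l)) ?mul0r // -val_eqE neq_ltn (leq_trans ik kl).
- have im : (i == mx) = false by apply/negbTE; rewrite -val_eqE /= neq_ltn (leq_trans ik kn).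
  by rewrite WV mxE ik eqxx im addr0.
- rewrite /f; case: (eqVneq i mx) => [im|im]; last first.
    rewrite W0 ?eqxx ?mulr1 ?mulrN1 // innerE (leq_trans k0 ki) /=.
    by rewrite ltn_neqAle leq_ord andbT.
  rewrite im WV eqxx mxE ltnNge kn /= cell_rowm (negbTE (max_neq0 n2)) eqxx /zpart mulrBr; congr (_ + _).
  rewrite mulr_sumr -sumrN; apply: eq_bigr => l /andP[il kl].
  rewrite mxE ltnNge kn /= cell_rowm; have/andP[/negbTE-> /negbTE->] := il.
  by rewrite mulrN mulrA.
Qed.

(** Row k is paired with the last column, giving -D_k b_k, or a sign times D_0 when k = 0; row n is
    paired with column l, giving D_n a_l, or D_n when l = 0. For k > 0 the choice l = k is excluded
    because row k has its diagonal entry there, which would destroy triangularity. *)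
Lemma skip_bound (k : 'I_n) (l : 'I_n.+1) c : (k.+1 < n)%N -> (l <= k.+1)%N ->
  (k == 0 :> nat) || (l != widen_ord (leqnSn n) k) -> I c -> I (c * sdiag u k) ->
  I (c * P ^ ((rr k)%:Z - (rr k.+1)%:Z + (rr k.+2)%:Z) *
     ((if k == 0 :> nat then 1 else b (widen_ord (leqnSn n) k)) * (if l == ord0 then 1 else a l))).
Proof.
set k0 := widen_ord _ k; pose k1 := lift ord0 k => kn lk kl Ic Icu.
have k1m : (k1 == mx) = false by apply/negbTE; rewrite -val_eqE /= neq_ltn kn.
have k0m : (k0 == mx) = false by apply/negbTE; rewrite -val_eqE /= neq_ltn (ltnW kn).
have lm : (l == mx) = false by apply/negbTE; rewrite -val_eqE /= neq_ltn (leq_ltn_trans lk kn).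
pose g (j : 'I_n.+1) := if j == k1 then mx else if j == mx then l else j.
pose f (j : 'I_n.+1) := if j == k1 then (if k == 0 :> nat then (-1) ^+ n else - b k0)
   else if j == mx then (if l == ord0 then 1 else a l) else -1.
have W0 (i j : 'I_n.+1) : (k.+1 < i)%N -> inner i -> (i <= j)%N ->
    Mx i (g j) = - D i * (if i == j then 1 else 0).
  move=> ki ii ij; rewrite cell_row // /g; have/andP[i0 im] := ii.
  have -> : (j == k1) = false by apply/negbTE; rewrite -val_eqE /= neq_ltn (leq_trans ki ij) orbT.
  have [->|jm] := eqVneq j mx; last by rewrite (negbTE jm).
  rewrite lm (negbTE im) (negbTE (_ : i != l)) // -val_eqE neq_ltn (leq_ltn_trans lk) ?orbT //.
have Wk (j : 'I_n.+1) : (k.+1 <= j)%N ->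
    Mx k0 (g j) = D k * (if j == k1 then (if k == 0 :> nat then (-1) ^+ n else - b k0) else 0).
  move=> kj; have gm : (g j == mx) = (j == k1).
    rewrite /g; case: (eqVneq j k1) => [_|jk]; first by rewrite eqxx.
    by case: (eqVneq j mx) => [_|jm]; rewrite ?lm // (negbTE jm).
  case: (eqVneq (nat_of_ord k) 0%N) => [kz|kz].
    have -> : k0 = ord0 by apply/ord_inj.
    by rewrite cell_row0 gm kz; case: (j == k1); rewrite ?mulr1 ?mulr0.
  rewrite cell_row ?gm; last by rewrite innerE /= lt0n kz ltn_ord.
  rewrite (negbTE (_ : k0 != g j)); first by case: (j == k1); rewrite ?mulr0 // mulrN mulNr.
  rewrite /g; case: (eqVneq j k1) => _; first by rewrite k0m.
  case: (eqVneq j mx) => _; first by move: kl; rewrite (negbTE kz) eq_sym.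
  by rewrite -val_eqE /= neq_ltn kj.
refine ((fun h => _) (@minor_skip k g f c Ic Icu _ _ _)).
- have := @prod_sign_integral _ _ _ (pred2 k1 mx) _ _ h.
  have -> : \prod_(i < n.+1 | (k < i)%N && pred2 k1 mx i) f i = f k1 * f mx.
    rewrite (bigD1 k1) /=; last by rewrite eqxx ltnS leqnn.
    congr (_ * _); apply: big_pred1 => i /=; case: (eqVneq i mx) => [->|im].
      by rewrite orbT andbT eq_sym k1m andbT ltn_ord.
    by rewrite orbF; case: (i == k1); rewrite ?andbF ?andbT.
  have -> : f k1 = if k == 0 :> nat then (-1) ^+ n else - b k0 by rewrite /f eqxx.
  have -> : f mx = if l == ord0 then 1 else a l by rewrite /f [mx == k1]eq_sym k1m eqxx.
  set Z := if l == _ then _ else _; set Y := c * _ => h'.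
  have {h'} : I (Y * ((if k == 0 :> nat then (-1) ^+ n else - b k0) * Z)).
    by apply: h' => i _ /norP[/negbTE i1 /negbTE im]; rewrite /f i1 im.
  case: eqP => kz h'; last by move/IN: h'; rewrite mulNr mulrN opprK.
  have Is : I ((-1) ^+ n) by elim: (n) => [|i Ii]; rewrite ?expr0 // exprS; apply: IM => //; exact: IN.
  have s2 : (-1) ^+ n * (-1) ^+ n = 1 :> F by rewrite -expr2 sqrr_sign.
  suff <- : (-1) ^+ n * (Y * ((-1) ^+ n * Z)) = Y * (1 * Z) by exact: IM.
  by rewrite mulrCA; congr (Y * _); rewrite mulrA s2.
- move=> i j ij; rewrite mxE; case: leqP => ki.
    by rewrite (negbTE (_ : i != j)) // -val_eqE neq_ltn ij.
  case: eqVneq => [ik|ik].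
    rewrite Wk; last by apply: leq_trans (ltnW ij); rewrite ik.
    by rewrite (negbTE (_ : j != k1)) ?mulr0 // -[k1]/(lift ord0 k) -ik -val_eqE neq_ltn ij orbT.
  have ki' : (k.+1 < i)%N by rewrite ltn_neqAle ki andbT eq_sym; exact: ik.
  rewrite W0 ?(ltnW ij) ?(ge_inner _ ki ij) // (negbTE (_ : i != j)) ?mulr0 // -val_eqE neq_ltn ij //.
- by rewrite mxE /= /bump /= ltnn eqxx Wk // /f eqxx.
- move=> i ki; have ik1 : (i == k1) = false by apply/negbTE; rewrite -val_eqE /= neq_ltn ki orbT.
  rewrite mxE leqNgt (ltnW ki) /= ik1 /f ik1.
  case: (eqVneq i mx) => [im|im].
    by rewrite im cell_rowm /g [mx == k1]eq_sym k1m eqxx lm.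
  rewrite W0 ?eqxx ?mulr1 ?mulrN1 // innerE (leq_trans _ ki) //= ltn_neqAle leq_ord andbT.
  by move: im; rewrite -val_eqE.
Qed.

(** For k = n - 1 a single row remains and the minor is one entry, in column n or n - 1. *)
Lemma skip_bound_last (k : 'I_n) (l : 'I_n.+1) c : k.+1 = n ->
  (l == mx) || (l == widen_ord (leqnSn n) k) -> I c -> I (c * sdiag u k) ->
  I (c * P ^ ((rr k)%:Z - (rr k.+1)%:Z) * (if l == mx then b (widen_ord (leqnSn n) k) else 1)).
Proof.
set k0 := widen_ord _ k; pose k1 := lift ord0 k => kn ll Ic Icu.
have k1m : k1 = mx by apply/ord_inj; exact: kn.
have k0m : (k0 == mx) = false by apply/negbTE; rewrite -val_eqE /= neq_ltn ltn_ord.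
have k0i : inner k0 by rewrite innerE /= ltn_ord andbT; lia.
pose g (j : 'I_n.+1) := l.
pose f (j : 'I_n.+1) : F := - (if l == mx then b k0 else 1).
refine ((fun h => _) (@minor_skip k g f c Ic Icu _ _ _)).
- move: h; rewrite (big_pred1 mx) => [|i]; last first.
    by rewrite /= -val_eqE /=; have := ltn_ord i; lia.
  by rewrite /f mulrN kn rn addr0 => /IN; rewrite opprK.
- move=> i j ij; rewrite mxE; case: leqP => ki; last first.
    by have := ltn_ord j; lia.
  by rewrite (negbTE (_ : i != j)) // -val_eqE neq_ltn ij.
- rewrite mxE /= /bump /= ltnn eqxx /g /f cell_row // -/k0 mulNr mulrN; congr (- (_ * _)).
  by case/orP: ll => /eqP ->; rewrite eqxx ?k0m.
- by move=> i; rewrite kn ltnNge leq_ord.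
Qed.

End Minors.

(** * Counting numerators subject to chains of congruences *)

Section HistoryCount.
Variable T : eqType.

Lemma size_flatten_le (S : Type) (f : S -> seq T) (s : seq S) c :
  (forall x, (size (f x) <= c)%N) -> (size (flatten (map f s)) <= size s * c)%N.
Proof.
move=> h; elim: s => [//|x s IHs] /=.
by rewrite size_cat mulSn leq_add.
Qed.

(** Serves to count families of pairs one pair at a time, when the congruence for each pair has a
    constant term depending on the earlier pairs. *)
Lemma enum_history (L : seq T -> seq T) (c : nat -> nat) (q : nat) :
  (forall h, (size h < q)%N -> (size (L h) <= c (size h))%N) ->
  exists2 E : seq (seq T), (size E <= \prod_(i < q) c i)%N &
    forall l, size l = q ->
      (forall x0 i, (i < q)%N -> nth x0 l i \in L (take i l)) -> l \in E.
Proof.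
elim: q => [|q IHq] Lc.
  by exists [:: [::]]; [rewrite big_ord0|move=> l /size0nil ->; rewrite inE].
have [h hq|E sE HE] := IHq; first by apply: Lc; exact: ltnW.
exists (flatten [seq [seq rcons h x | x <- L h] | h <- [seq h <- E | size h == q]]).
  rewrite big_ord_recr /=; apply: (@leq_trans (size [seq h <- E | size h == q] * c q)); last first.
    by rewrite leq_mul2r (leq_trans _ sE) ?orbT // size_filter count_size.
  have : all (fun h => size h == q) [seq h <- E | size h == q] by exact: filter_all.
  elim: [seq h <- E | size h == q] => [//|h s IHs] /= /andP[/eqP hq /IHs].
  by rewrite size_cat size_map mulSn => IH; rewrite leq_add // -hq Lc // hq.
case/lastP => [//|l x]; rewrite size_rcons => -[lq] hl.
apply/flatten_mapP; exists l; rewrite ?mem_filter ?lq ?eqxx /=.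
  apply: HE => // x0 i iq; have := hl x0 i (ltnW iq).
  by rewrite nth_rcons lq iq -cats1 takel_cat // lq ltnW.
apply: map_f; have := hl x q (ltnSn q).
by rewrite nth_rcons lq ltnn eqxx -cats1 takel_cat ?lq // take_oversize ?lq.
Qed.

End HistoryCount.

Section PairCount.
Variables (p R : nat).
Hypothesis pp : prime p.
Local Notation P := (p ^ R)%N.

Let p0 : (0 < p)%N. Proof. exact: prime_gt0. Qed.
Let p1 : (1 < p)%N. Proof. exact: prime_gt1. Qed.

Lemma class_count (Q : pred nat) t a : (t <= R)%N ->
  (forall B B' : nat, Q B -> Q B' -> ((p ^ t)%:Z %| B%:Z - B'%:Z)%Z) ->
  (count Q (iota a P) <= p ^ (R - t))%N.
Proof.
move=> tR h; rewrite -size_filter.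
pose f B := ((B - a) %/ p ^ t)%N.
rewrite -(size_map f) -[X in (_ <= X)%N](size_iota 0); apply: uniq_leq_size.
  rewrite map_inj_in_uniq ?filter_uniq ?iota_uniq //.
  move=> B B'; rewrite !mem_filter !mem_iota => /andP[qB /andP[aB _]] /andP[qB' /andP[aB' _]] e.
  have := h _ _ qB qB'.
  have -> : B%:Z - B'%:Z = (B - a)%:Z - (B' - a)%:Z :> int by rewrite -!subzn //; ring.
  rewrite -eqz_mod_dvd !modz_nat => /eqP[] e'.
  by rewrite -(subnK aB) -(subnK aB') (divn_eq (B - a) (p ^ t)) (divn_eq (B' - a) (p ^ t)) -/(f B) e e'.
move=> _ /mapP[B + ->]; rewrite mem_filter !mem_iota add0n => /andP[_ /andP[aB Blt]].
rewrite /= /f ltn_divLR ?expn_gt0 ?p0 // -expnD subnK //.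
by rewrite -(ltn_add2r a) subnK // addnC.
Qed.

Definition box := [seq (A, B) | A <- iota 1 P, B <- iota 1 P].

(** With a = A / p^R, b = B / p^R and gamma = c / p^(2R), the condition says that p^r a and p^r
    (gamma + a b) are integral. *)
Definition good (r : nat) (c : int) (x : nat * nat) :=
  (p ^ (R - r) %| x.1)%N && ((p ^ (2 * R - r))%:Z %| c + (x.1 * x.2)%N%:Z)%Z.

Lemma size_filter_allpairs (S T : Type) (Q : pred (S * T)) (s : seq S) (t : seq T) :
  size [seq x <- [seq (a, b) | a <- s, b <- t] | Q x] =
  (\sum_(a <- s) count (fun b => Q (a, b)) t)%N.
Proof.
elim: s => [|a s IHs]; first by rewrite big_nil.
rewrite big_cons -IHs /= filter_cat size_cat; congr (_ + _)%N.
by rewrite size_filter count_map.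
Qed.

(** Sort by v = v_p(A), which satisfies R - r <= v <= R. There are at most p^(R-v) such A, and each
    fixes B modulo p^(2R-r-v), leaving p^(r+v-R) values. The product is p^r for each of the r + 1
    values of v. *)
Lemma good_count r c : (r <= R)%N -> (size [seq x <- box | good r c x] <= r.+1 * p ^ r)%N.
Proof.
move=> rR; rewrite size_filter_allpairs.
apply: (@leq_trans (\sum_(A <- iota 1 P) \sum_(R - r <= v < R.+1 | (p ^ v %| A)%N) p ^ (r + v - R))).
  rewrite big_seq_cond [X in (_ <= X)%N]big_seq_cond; apply: leq_sum => A.
  rewrite mem_iota andbT add1n ltnS => /andP[A0 AP].
  case: (boolP (p ^ (R - r) %| A)%N) => dA; last first.
    by rewrite (@eq_count _ _ pred0) ?count_pred0 // => B; rewrite /good /= (negbTE dA).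
  set v := logn p A; have rv : (R - r <= v)%N by rewrite /v -pfactor_dvdn.
  have vR : (v <= R)%N.
    rewrite -(leq_exp2l _ _ p1); apply: leq_trans AP; apply: dvdn_leq => //.
    exact: pfactor_dvdnn.
  rewrite big_mkcond (bigD1_seq v) /=; first last.
  - exact: iota_uniq.
  - by rewrite mem_index_iota rv ltnS.
  rewrite ifT ?pfactor_dvdnn //; apply: leq_trans (leq_addr _ _).
  have -> : (r + v - R = R - (2 * R - r - v))%N by lia.
  apply: class_count; first by lia.
  move=> B B' /andP[_ d] /andP[_ d'] /=.
  have : ((p ^ (2 * R - r))%:Z %| A%:Z * (B%:Z - B'%:Z))%Z.
    rewrite mulrBr -!PoszM -[X in (_ %| X)%Z](addrKA c) !(addrC _ c).
    by rewrite rpredB.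
  rewrite !dvdzE /= abszM /= => dB.
  have [->|B0] := posnP `|B%:Z - B'%:Z|%N; first by rewrite dvdn0.
  move: `|_|%N B0 dB => X X0; clear d d' => {B B'}.
  by rewrite !pfactor_dvdn ?muln_gt0 ?A0 ?X0 // lognM // -/v => h; lia.
rewrite (exchange_big_dep xpredT) //=.
apply: (@leq_trans (\sum_(R - r <= v < R.+1) p ^ r)); last first.
  by rewrite sum_nat_const_nat leq_mul2r; apply/orP; right; lia.
rewrite big_nat_cond [X in (_ <= X)%N]big_nat_cond; apply: leq_sum => v /andP[/andP[rv vR] _].
rewrite big_const_seq iter_addn_0 mulnC.
apply: (@leq_trans (p ^ (R - v) * p ^ (r + v - R))).
  rewrite leq_mul2r; apply/orP; right; apply: class_count => //.
  by move=> B B' /= dB dB'; rewrite rpredB // dvdzE.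
by rewrite -expnD leq_exp2l //; lia.
Qed.

(** Since v_p(B) <= R on the box, divisibility of A B by p^(2R-r) already forces p^(R-r) to divide
    A. *)
Lemma good_of_dvd r x : (r <= R)%N -> x \in box -> (p ^ (2 * R - r) %| x.1 * x.2)%N -> good r 0 x.
Proof.
case: x => A B rR /allpairsP[[A' B'] /= [hA hB [-> ->]]] d.
move: hA hB; rewrite !mem_iota !add1n !ltnS => /andP[A0 AP] /andP[B0 BP].
rewrite /good /= add0r dvdzE /= d andbT.
move: d; rewrite !pfactor_dvdn ?muln_gt0 ?A0 // lognM //.
have : (logn p B' <= R)%N.
  by rewrite -(leq_exp2l _ _ p1); apply: leq_trans BP; apply: dvdn_leq => //; exact: pfactor_dvdnn.
lia.
Qed.

Section Families.
Variables (T : eqType) (s : seq T) (A B : T -> nat -> nat) (Z : T -> nat) (n : nat).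
Hypotheses (n2 : (2 <= n)%N) (us : uniq s).
Hypothesis AB_box : forall x i, x \in s -> (0 < i < n)%N -> (A x i, B x i) \in box.
Hypothesis Z_iota : forall x, x \in s -> Z x \in iota 0 P.
Hypothesis ABZ_inj : forall x y, x \in s -> y \in s ->
  (forall i, (0 < i < n)%N -> A x i = A y i /\ B x i = B y i) -> Z x = Z y -> x = y.

Let box_sym x i : x \in s -> (0 < i < n)%N -> (B x i, A x i) \in box.
Proof.
move=> xs hi; have /allpairsP[[a b] /= [ha hb [-> ->]]] := AB_box xs hi.
by apply/allpairsP; exists (b, a).
Qed.

(* The pairs (A_i, B_i) are enumerated outwards from the index m where r is minimal. To the right of
   m, A_i B_i is known modulo a power of p given its predecessors; to the left the roles of A and B
   are exchanged. *)
Lemma sequential_count (r : nat -> nat) : (forall k, (r k <= R)%N) ->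
  (forall x i, x \in s -> (0 < i < n)%N -> (p ^ (R - r i.+1) %| A x i)%N) ->
  (forall x i, x \in s -> (0 < i < n)%N -> (p ^ (R - r i) %| B x i)%N) ->
  (forall x k, x \in s -> (0 < k <= n)%N ->
    ((p ^ (2 * R - r k))%:Z %| (P * Z x)%N%:Z - (\sum_(k <= l < n) A x l * B x l)%N%:Z)%Z) ->
  (size s <= \prod_(1 <= k < n.+1) ((r k).+1 * p ^ r k))%N.
Proof.
move=> rR hA hB hZ.
have [m [m1 mn mmin]] : exists m, [/\ (0 < m)%N, (m <= n)%N & forall k, (0 < k <= n)%N -> (r m <= r k)%N].
  have Pmx : (0 < (@ord_max n))%N by apply: leq_trans n2.
  have [k k0 kmin] := @arg_minnP 'I_n.+1 ord_max (fun i => (0 < i)%N) (fun i => r i) Pmx.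
  exists k; split; rewrite ?leq_ord // => j /andP[j0 jn].
  by apply: (kmin (Ordinal (jn : (j < n.+1)%N))).
pose S x k k' := (\sum_(k <= l < k') A x l * B x l)%N.
pose Sh (h : seq (nat * nat)) := (\sum_(y <- h) y.1 * y.2)%N.
(* Subtracting the conditions at k and k' eliminates Z; the larger of the two exponents governs the
   difference. *)
have hS x k k' : x \in s -> (0 < k <= k')%N -> (k' <= n)%N ->
    ((p ^ (2 * R - maxn (r k) (r k')))%:Z %| (S x k k')%:Z)%Z.
  move=> xs /andP[k0 kk] k'n.
  have -> : (S x k k')%:Z = ((P * Z x)%N%:Z - (S x k' n)%:Z) - ((P * Z x)%N%:Z - (S x k n)%:Z).
    by rewrite {3}/S (@big_cat_nat _ _ _ k') //= PoszD -/(S x k k') -/(S x k' n); ring.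
  have dv a : (a <= maxn (r k) (r k'))%N -> (p ^ (2 * R - maxn (r k) (r k')) %| p ^ (2 * R - a))%N.
    by move=> ha; rewrite dvdn_exp2l //; lia.
  rewrite rpredB //.
    by apply: dvdz_trans (hZ _ _ xs _); rewrite ?dvdzE ?dv ?leq_maxr // (leq_trans k0 kk).
  by apply: dvdz_trans (hZ _ _ xs _); rewrite ?dvdzE ?dv ?leq_maxl // k0 (leq_trans kk).
pose cR x := [seq (A x l, B x l) | l <- iota m (n - m)].
pose cL x := [seq (B x (m - l.+1)%N, A x (m - l.+1)%N) | l <- iota 0 m.-1].
(* As r is minimal at m, the larger exponent is always the outer one: the pair of index m + i costs
   r_(m+i+1) and the pair of index m - i - 1 costs r_(m-i-1). Every index but m is used once, and
   r_m is left for Z. *)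
pose LR (h : seq (nat * nat)) := [seq y <- box | good (r (m + size h).+1) (Sh h)%:Z y].
pose LL (h : seq (nat * nat)) := [seq y <- box | good (r (m - (size h).+1)%N) (Sh h)%:Z y].
pose F k := ((r k).+1 * p ^ r k)%N.
have [h _|ER sER hER] := @enum_history _ LR (fun i => F (m + i).+1) (n - m); first exact: good_count.
have [h _|EL sEL hEL] := @enum_history _ LL (fun i => F (m - i.+1)%N) m.-1; first exact: good_count.
have inR x : x \in s -> cR x \in ER.
  move=> xs; apply: hER => [|x0 i im]; first by rewrite size_map size_iota.
  rewrite (nth_map 0%N) ?size_iota // nth_iota // -map_take take_iota (minn_idPl (ltnW im)).
  have hi : (0 < m + i < n)%N by lia.
  rewrite mem_filter AB_box // andbT /good /= size_map size_iota hA //=.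
  have -> : Sh [seq (A x l, B x l) | l <- iota m i] = S x m (m + i).
    by rewrite /Sh big_map /S /index_iota addKn.
  rewrite -PoszD; have := @hS x m (m + i).+1 xs _ _.
  rewrite (maxn_idPr (mmin _ _)); last by lia.
  rewrite {1}/S big_nat_recr /=; last by lia.
  apply; lia.
have inL x : x \in s -> cL x \in EL.
  move=> xs; apply: hEL => [|x0 i im]; first by rewrite size_map size_iota.
  rewrite (nth_map 0%N) ?size_iota // nth_iota // add0n -map_take take_iota (minn_idPl (ltnW im)).
  have hi : (0 < m - i.+1 < n)%N by lia.
  rewrite mem_filter box_sym // andbT /good /= size_map size_iota hB //=.
  have -> : Sh [seq (B x (m - l.+1)%N, A x (m - l.+1)%N) | l <- iota 0 i] = S x (m - i)%N m.
    rewrite /Sh big_map /S /= (_ : iota 0 i = index_iota 0 i); last by rewrite /index_iota subn0.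
    elim: i im {hi} => [|i IHi] im; first by rewrite subn0 !big_geq.
    rewrite big_nat_recr //= IHi ?(ltnW im) // [RHS]big_ltn; last by lia.
    by rewrite addnC mulnC (_ : (m - i.+1).+1 = m - i)%N //; lia.
  rewrite -PoszD addnC mulnC; have := @hS x (m - i.+1)%N m xs _ _.
  rewrite (maxn_idPl (mmin _ _)); last by lia.
  rewrite {1}/S big_ltn; last by lia.
  rewrite (_ : (m - i.+1).+1 = m - i)%N; last by lia.
  apply; lia.
pose LZ h := [seq z <- iota 0 P | ((p ^ (2 * R - r m))%:Z %| (P * z)%N%:Z - (Sh h)%:Z)%Z].
have sZ h : (size (LZ h) <= p ^ r m)%N.
  rewrite size_filter -{2}(subKn (rR m)); apply: class_count; first exact: leq_subr.
  move=> z z' dz dz'.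
  have : ((p ^ (2 * R - r m))%:Z %| P%:Z * (z%:Z - z'%:Z))%Z.
    have -> : P%:Z * (z%:Z - z'%:Z) = ((P * z)%N%:Z - (Sh h)%:Z) - ((P * z')%N%:Z - (Sh h)%:Z).
      by rewrite !PoszM; ring.
    by rewrite rpredB.
  rewrite (_ : (2 * R - r m = R + (R - r m))%N); last by have := rR m; lia.
  by rewrite expnD PoszM dvdz_mul2l // -lt0n expn_gt0 p0.
pose E := flatten [seq [seq (y, z) | z <- LZ y.2] | y <- [seq (l, h) | l <- EL, h <- ER]].
apply: (@leq_trans (size E)).
  rewrite -(size_map (fun x => (cL x, cR x, Z x))); apply: uniq_leq_size.
    rewrite map_inj_in_uniq // => x y xs ys [eL eR eZ]; apply: ABZ_inj => // i hi.
    move/eq_in_map: eL => eL; move/eq_in_map: eR => eR.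
    case: (leqP m i) => mi.
      have hm : i \in iota m (n - m) by rewrite mem_iota; lia.
      by have [-> ->] := eR _ hm.
    have hm : (m - i.+1)%N \in iota 0 m.-1 by rewrite mem_iota; lia.
    by have := eL _ hm; rewrite (_ : m - (m - i.+1).+1 = i)%N; [case=> -> ->|lia].
  move=> _ /mapP[x xs ->]; apply/flatten_mapP; exists (cL x, cR x).
    by apply/allpairsP; exists (cL x, cR x); rewrite inL // inR.
  apply: map_f; rewrite mem_filter Z_iota // andbT /= /Sh big_map.
  by have := hZ x m xs; rewrite /index_iota; apply; rewrite m1.
apply: (leq_trans (size_flatten_le _ _)) => [y|]; first by rewrite size_map; exact: sZ.
rewrite size_allpairs (@big_cat_nat _ _ _ m) //=; last exact: ltnW.
rewrite (@big_ltn _ _ _ m) // -mulnA leq_mul //.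
  apply: leq_trans sEL _; rewrite big_nat_rev /= big_add1 big_mkord leq_eqVlt; apply/orP; left; apply/eqP.
  by apply: eq_bigr => i _; congr F; lia.
rewrite mulnC leq_mul //; first by rewrite leq_pmull.
apply: leq_trans sER _; rewrite -[m.+1]add0n big_addn subSS big_mkord.
rewrite leq_eqVlt; apply/orP; left; apply/eqP; apply: eq_bigr => i _.
by rewrite addnS addnC.
Qed.

(** The conditions couple A_(k+1) with B_k, so the numerators are regrouped into these shifted pairs
    for 1 <= k <= n-2. The numerators A_1, B_(n-1) and Z remain and are counted separately. *)
Lemma skip_count (al be ze : nat) (rho : nat -> nat) :
  (al <= R)%N -> (be <= R)%N -> (ze <= R)%N -> (forall k, (rho k <= R)%N) ->
  (forall x, x \in s -> [/\ (p ^ (R - al) %| A x 1)%N, (p ^ (R - be) %| B x n.-1)%N & (p ^ (R - ze)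
    %| Z x)%N]) ->
  (forall x k, x \in s -> (0 < k < n.-1)%N -> (p ^ (2 * R - rho k) %| A x k.+1 * B x k)%N) ->
  (size s <= p ^ al * p ^ be * p ^ ze * \prod_(1 <= k < n.-1) ((rho k).+1 * p ^ rho k))%N.
Proof.
have n1n : (0 < n.-1 < n)%N by lia.
have n11 : (0 < 1 < n)%N by [].
move=> alR beR zeR rhoR hx hAB.
pose L (h : seq (nat * nat)) := [seq y <- box | good (rho (size h).+1) 0 y].
pose F k := ((rho k).+1 * p ^ rho k)%N.
have [h _|E sE hE] := @enum_history _ L (fun i => F i.+1) n.-2; first exact: good_count.
pose c x := [seq (A x l.+1, B x l) | l <- iota 1 n.-2].
have inE x : x \in s -> c x \in E.
  move=> xs; apply: hE => [|x0 i im]; first by rewrite size_map size_iota.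
  rewrite (nth_map 0%N) ?size_iota // nth_iota // add1n -map_take take_iota (minn_idPl (ltnW im)).
  have hb : (A x i.+2, B x i.+1) \in box.
    have /allpairsP[[a b] /= [ha _ [ea _]]] : (A x i.+2, B x i.+2) \in box by apply: AB_box => //; lia.
    have /allpairsP[[a' b'] /= [_ hb' [_ eb']]] : (A x i.+1, B x i.+1) \in box by apply: AB_box => //; lia.
    by apply/allpairsP; exists (a, b'); rewrite /= ha hb' ea eb'.
  rewrite mem_filter hb andbT size_map size_iota; apply: good_of_dvd => //.
  by apply: hAB => //; lia.
pose C t a := [seq y <- iota a P | (p ^ (R - t) %| y)%N].
have sC t a : (t <= R)%N -> (size (C t a) <= p ^ t)%N.
  move=> tR; rewrite size_filter -{2}(subKn tR); apply: class_count; first exact: leq_subr.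
  by move=> y y' dy dy'; rewrite rpredB // dvdzE.
pose G := [seq (y, e) | y <- [seq (y, z) | y <- [seq (a, b) | a <- C al 1%N, b <- C be 1%N], z <- C
  ze 0%N], e <- E].
apply: (@leq_trans (size G)); last first.
  rewrite !size_allpairs; do ![apply: leq_mul]; rewrite ?sC //.
  by apply: leq_trans sE _; rewrite big_add1 big_mkord.
rewrite -(size_map (fun x => (A x 1%N, B x n.-1, Z x, c x))); apply: uniq_leq_size.
  rewrite map_inj_in_uniq // => x y xs ys [eA eB eZ eC]; apply: ABZ_inj => // i hi.
  move/eq_in_map: eC => eC; split.
    case: i hi => [//|[//|i]] hi.
    have hm : i.+1 \in iota 1 n.-2 by rewrite mem_iota; lia.
    by have [-> _] := eC _ hm.
  case: (eqVneq i n.-1) => [->//|ni].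
  have hm : i \in iota 1 n.-2 by rewrite mem_iota; lia.
  by have [_ ->] := eC _ hm.
move=> _ /mapP[x xs ->]; have [dA dB dZ] := hx _ xs.
have hA1 : A x 1%N \in iota 1 P.
  by have /allpairsP[[a b] /= [ha _ [-> _]]] : (A x 1%N, B x 1%N) \in box by exact: AB_box.
have hBn : B x n.-1 \in iota 1 P.
  by have /allpairsP[[a b] /= [_ hb [_ ->]]] : (A x n.-1, B x n.-1) \in box by exact: AB_box.
apply: allpairs_f; last exact: inE.
apply: allpairs_f; last by rewrite mem_filter dZ Z_iota.
by apply: allpairs_f; rewrite mem_filter ?dA ?dB.
Qed.

End Families.

End PairCount.

(** * The group law on [heis] and the double cosets in [X_] *)

Section HeisenbergGroup.
Variables (F : fieldType) (n : nat).
Hypothesis n2 : (2 <= n)%N.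
Local Notation mx := (@ord_max n).
Implicit Types (a b : 'I_n.+1 -> F) (z : F).

Lemma heis_ext a b a' b' z : (forall i, inner i -> a i = a' i) ->
  (forall i, inner i -> b i = b' i) -> heis a b z = heis a' b' z.
Proof.
move=> ha hb; apply/matrixP => i j; rewrite !heisE.
case: (eqVneq i j) => // ij; case: (idxP n2 i) ij => [||k ik] ij.
- by case: (idxP n2 j) ij => // l il _; exact: ha.
- by rewrite eq_sym (negbTE ij).
- by case: (j == mx) => //; exact: hb.
Qed.

Lemma heisM a b z a' b' z' : heis a b z *m heis a' b' z' =
  heis (fun i => a i + a' i) (fun i => b i + b' i)
    (z + z' + \sum_(l < n.+1 | inner l) a l * b' l).
Proof.
have u1 := heis_unip n2 a b z; have u2 := heis_unip n2 a' b' z'.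
have m0 := max_neq0 n2; have m0' : (ord0 == mx) = false by rewrite eq_sym (negbTE m0).
rewrite [LHS](heisP n2 (unipM u1 u2)); last first.
  move=> i j ii ij nij; rewrite mxE big1 // => l _; rewrite !heisE.
  have /andP[i0 im] := ii; have /andP[j0 jm] := ij.
  case: (eqVneq i l) => [<-|il]; first by rewrite (negbTE nij) (negbTE i0) (negbTE jm) mulr0.
  rewrite (negbTE i0); case: (eqVneq l mx) => [->|lm]; last by rewrite mul0r.
  by rewrite (negbTE m0) (negbTE jm) [mx == j]eq_sym (negbTE jm) mulr0.
have big0 i : inner i -> \sum_(l < n.+1 | l != i) heis a b z i l * heis a' b' z' l mx = b i.
  move=> ii; have /andP[i0 im] := ii.
  rewrite (bigD1 mx) 1?eq_sym //= big1 ?addr0 => [|l /andP[li lm]].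
    by rewrite !heisE (negbTE im) (negbTE i0) !eqxx mulr1.
  by rewrite heisE eq_sym (negbTE li) (negbTE i0) (negbTE lm) mul0r.
have -> : (heis a b z *m heis a' b' z') ord0 mx = z + z' + \sum_(l < n.+1 | inner l) a l * b' l.
  rewrite mxE (bigD1 ord0) //= (bigD1 mx) //= !heisE !eqxx m0' mul1r mulr1 addrA [z' + z]addrC.
  congr (_ + _); apply: eq_big => [//|l /andP[l0 lm]].
  by rewrite !heisE [ord0 == l]eq_sym (negbTE l0) (negbTE lm) !eqxx.
apply: heis_ext => i ii; have /andP[i0 im] := ii.
  rewrite mxE (bigD1 ord0) //= (bigD1 i) //= big1 ?addr0 => [|l /andP[l0 li]].
    by rewrite !heisE !eqxx [ord0 == i]eq_sym (negbTE i0) (negbTE im) mul1r mulr1 addrC.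
  rewrite [heis a' _ _ _ _]heisE (negbTE li) (negbTE l0) (negbTE im) mulr0 //.
rewrite mxE (bigD1 i) //= big0 // heisE eqxx mul1r heisE (negbTE im) (negbTE i0) eqxx addrC //.
Qed.

Lemma heis0 : heis (fun=> 0) (fun=> 0) 0 = 1%:M :> 'M[F]_n.+1.
Proof.
apply/matrixP => i j; rewrite heisE mxE; case: eqP => // _.
by case: (i == ord0); case: (j == mx).
Qed.

End HeisenbergGroup.

Section Cells.
Variables (p : nat) (pp : prime p) (n : nat).
Hypothesis n2 : (2 <= n)%N.
Local Notation Zp := (Zp_ pp).
Local Notation Qp := (Qp_ pp).
Local Notation M := 'M[Qp]_n.+1.
Local Notation w := (w_star pp n).
Implicit Types u v x y : M.

Lemma UupP u : Uup u <-> unip u.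
Proof.
split=> [[/is_trig_mxP h d]|[h d]].
  by split=> [i j ji|i]; [have := h _ _ ji|have := d i]; rewrite mxE.
by split=> [|i]; [apply/is_trig_mxP => i j ij|]; rewrite mxE; [exact: h|exact: d].
Qed.

Lemma UlowP u : Ulow u <-> unip u^T.
Proof. by rewrite -UupP /Uup /= trmxK. Qed.

Lemma w_starE : w = wst Qp n. Proof. by []. Qed.

Lemma w_star_unit : w \in unitmx. Proof. exact: wst_unit. Qed.

Lemma U_wP u : U_ w u <-> exists a b z, u = heis a b z.
Proof.
split=> [[/UupP uu [v /UlowP uv e]]|[a [b [z ->]]]].
  exists (u ord0), (fun i => u i ord_max), (u ord0 ord_max); apply: (heisP n2 uu).
  apply/(heis_conj n2 uu); exists v; split=> //.
  by rewrite -w_starE -e !mulmxA mulmxV ?mul1mx // w_star_unit.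
have uu := heis_unip n2 a b z; split; first exact/UupP.
have [|v [uv e]] := (heis_conj n2 uu).2.
  move=> i j /andP[i0 im] /andP[j0 jm] ij.
  by rewrite heisE (negbTE ij) (negbTE i0) (negbTE jm).
exists v; first exact/UlowP.
by rewrite -mulmxA -e mulKmx // w_star_unit.
Qed.

Lemma GL_Zp_mul x y : GL_Zp x -> GL_Zp y -> GL_Zp (x *m y).
Proof.
move=> [A /= uA <-] [B /= uB <-]; exists (A *m B); first by rewrite /= unitmx_mul uA.
exact: map_mxM.
Qed.

Lemma GL_Zp_inv x : GL_Zp x -> x \in unitmx /\ GL_Zp (invmx x).
Proof.
move=> [A /= uA <-]; set B := map_mx _ A.
have e : B *m map_mx (@ZpQp p pp) (invmx A) = 1%:M.
  have := map_mxM (@FracField.tofrac Zp) A (invmx A); rewrite mulmxV // => <-.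
  exact: map_mx1.
have [uB _] := mulmx1_unit e; split=> //; exists (invmx A); first by rewrite /= unitmx_inv.
by rewrite -[RHS]mulmx1 -e mulKmx.
Qed.

Lemma GL_Zp_entry x i j : GL_Zp x -> isint (x i j).
Proof. by move=> [A _ <-]; exists (A i j); rewrite mxE. Qed.

Lemma GL_Zp_det1 x : (forall i j, isint (x i j)) -> \det x = 1 -> GL_Zp x.
Proof.
move=> ix dx; have [A AE] : exists A : 'M[Zp]_n.+1, map_mx (@ZpQp p pp) A = x.
  have [f fE] := choice (fun ij : 'I_n.+1 * 'I_n.+1 => ix ij.1 ij.2).
  by exists (\matrix_(i, j) f (i, j)); apply/matrixP => i j; rewrite !mxE [RHS](fE (i, j)).
exists A => //=; rewrite unitmxE.
have : ZpQp (\det A) = 1 by rewrite -dx -AE [RHS]det_map_mx.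
move/eqP; rewrite -tofrac1 tofrac_eq => /eqP ->; exact: unitr1.
Qed.

Lemma GL_Zp_unip x : (forall i j, isint (x i j)) -> unip x -> GL_Zp x.
Proof. by move=> ix ux; apply: GL_Zp_det1 => //; exact: det_unip. Qed.

Lemma U_w_mul x y : U_ w x -> U_ w y -> U_ w (x *m y).
Proof.
move=> /U_wP[a [b [z ->]]] /U_wP[a' [b' [z' ->]]]; apply/U_wP.
by rewrite heisM //; do 3!eexists.
Qed.

Lemma heis_inv (a b : 'I_n.+1 -> Qp) z : exists a' b' z', invmx (heis a b z) = heis a' b' z'.
Proof.
exists (fun i => - a i), (fun i => - b i), (- z + \sum_(l < n.+1 | inner l) a l * b l).
have uu := heis_unip n2 a b z.
rewrite -[RHS](mulKmx (unip_unit uu)) heisM //.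
have -> : z + (- z + \sum_(l < n.+1 | inner l) a l * b l) + \sum_(l < n.+1 | inner l) a l * - b l = 0.
  by rewrite addrA subrr add0r -big_split big1 //= => l _; rewrite mulrN subrr.
have -> : heis (fun i => a i - a i) (fun i => b i - b i) 0 = 1%:M.
  by rewrite -heis0; apply: (heis_ext n2) => i _; exact: subrr.
by rewrite mulmx1.
Qed.

Lemma U_w_inv x : U_ w x -> U_ w (invmx x).
Proof. by move=> /U_wP[a [b [z ->]]]; apply/U_wP; exact: heis_inv. Qed.

Lemma U_w_unip x : U_ w x -> unip x.
Proof. by move=> [/UupP]. Qed.

Variable r : 'I_n -> nat.
Local Notation t := (C_star pp r).
Local Notation N := (t *m w).
Local Notation P := (p%:R : Qp).
Local Notation rr := (ext_exp r).

Let D (i : 'I_n.+1) : Qp := P ^ ((rr i)%:Z - (rr i.+1)%:Z).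
Let D0 i : D i != 0. Proof. by rewrite expfz_neq0 // P_neq0. Qed.

Definition dec x u v := [/\ unip u, U_ w v & x = u *m N *m v].

Lemma bigcell_dec x : bigcell N x -> exists u v, dec x u v.
Proof.
move=> [[u [v [/UupP uu /UupP uv ->]]] _].
have [V [a [b [z [uV e]]]]] := bigcell_decomp n2 D0 uv.
exists (u *m V), (heis a b z); split; first exact: unipM.
  by apply/U_wP; exists a, b, z.
by rewrite -mulmxA (e : N *m v = V *m N *m heis a b z) !mulmxA.
Qed.

Lemma dec_bigcell x u v : GL_Zp x -> dec x u v -> bigcell N x.
Proof.
move=> gx [uu uv xE]; split=> //; exists u, v; split=> //; apply/UupP => //.
exact: U_w_unip.
Qed.

Lemma dec_uniq x u v u' v' : dec x u v -> dec x u' v' -> u = u' /\ v = v'.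
Proof.
move=> [uu /U_wP[a [b [z ->]]] ->] [uu' /U_wP[a' [b' [z' ->]]] e].
exact: (bigcell_uniq n2 D0 uu uu' e).
Qed.

Lemma bruhatP x : bigcell N x -> dec x (bruhat t w x).1 (bruhat t w x).2.
Proof.
move=> /bigcell_dec[u [v [uu uv xE]]].
have [] := @xgetPex _ (0, 0) [set uv | [/\ Uup uv.1, U_ w uv.2 & x = uv.1 *m N *m uv.2]]%classic.
  by exists (u, v); split=> //; exact/UupP.
by move=> /UupP.
Qed.

Definition ZU x := GL_Zp x /\ unip x.
Definition ZUw x := GL_Zp x /\ U_ w x.

Lemma double_cosetP x y : double_coset w x y <-> exists al be, [/\ ZU al, ZUw be & y = al *m x *m be].
Proof.
split=> [[al [be [[/UupP ua ga] [ub gb] e]]]|[al [be [[ga /UupP ua] [gb ub] e]]]]; by exists al, be.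
Qed.

Lemma GL_Zp1 : GL_Zp (1%:M : M).
Proof. by exists 1%:M; rewrite /= ?unitmx1 //; exact: map_mx1. Qed.

Lemma ZU1 : ZU 1%:M. Proof. by split; [exact: GL_Zp1|exact: unip1]. Qed.

Lemma ZUw1 : ZUw 1%:M.
Proof. by split; [exact: GL_Zp1|apply/U_wP; do 3!eexists; rewrite -heis0]. Qed.
Lemma ZU_mul x y : ZU x -> ZU y -> ZU (x *m y).
Proof. by move=> [gx ux] [gy uy]; split; [exact: GL_Zp_mul|exact: unipM]. Qed.
Lemma ZUw_mul x y : ZUw x -> ZUw y -> ZUw (x *m y).
Proof. by move=> [gx ux] [gy uy]; split; [exact: GL_Zp_mul|exact: U_w_mul]. Qed.
Lemma ZU_inv x : ZU x -> ZU (invmx x).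
Proof. by move=> [gx ux]; split; [exact: (GL_Zp_inv gx).2|exact: unipV]. Qed.
Lemma ZUw_inv x : ZUw x -> ZUw (invmx x).
Proof. by move=> [gx ux]; split; [exact: (GL_Zp_inv gx).2|exact: U_w_inv]. Qed.
Lemma ZU_unit x : ZU x -> x \in unitmx.
Proof. by move=> [_ /unip_unit]. Qed.
Lemma ZUw_unit x : ZUw x -> x \in unitmx.
Proof. by move=> [_ /U_w_unip/unip_unit]. Qed.

Lemma double_coset_refl x : double_coset w x x.
Proof.
apply/double_cosetP; exists 1%:M, 1%:M; split; [exact: ZU1|exact: ZUw1|].
by rewrite mul1mx mulmx1.
Qed.

Lemma double_coset_sub x al be : ZU al -> ZUw be ->
  (double_coset w (al *m x *m be) `<=` double_coset w x)%classic.
Proof.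
move=> za zb y /double_cosetP[al' [be' [za' zb' ->]]]; apply/double_cosetP.
exists (al' *m al), (be *m be'); split; [exact: ZU_mul|exact: ZUw_mul|].
by rewrite !mulmxA.
Qed.

Lemma double_coset_eq x al be : ZU al -> ZUw be ->
  double_coset w (al *m x *m be) = double_coset w x.
Proof.
move=> za zb; apply/seteqP; split; first exact: double_coset_sub.
have e : x = invmx al *m (al *m x *m be) *m invmx be.
  by rewrite -!mulmxA mulmxV ?ZUw_unit // mulmx1 mulKmx // ZU_unit.
by rewrite {1}e; apply: double_coset_sub; [exact: ZU_inv|exact: ZUw_inv].
Qed.

Lemma dec_move x u v al be : dec x u v -> ZU al -> ZUw be ->
  dec (al *m x *m be) (al *m u) (v *m be).
Proof.
move=> [uu uv ->] [_ ua] [_ ub]; split; [exact: unipM|exact: U_w_mul|].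
by rewrite !mulmxA.
Qed.

Lemma X_mem (c : set M) y : X_ t w c -> c y ->
  [/\ bigcell N y, GL_Zp y & c = double_coset w y].
Proof.
move=> [x [bx gx] <-] /double_cosetP[al [be [za zb ->]]].
have g : GL_Zp (al *m x *m be).
  by apply: GL_Zp_mul; [apply: GL_Zp_mul; [exact: za.1|]|exact: zb.1].
have [u [v d]] := bigcell_dec (conj bx gx).
split=> //; last by rewrite double_coset_eq.
exact: dec_bigcell g (dec_move d za zb).
Qed.

Lemma X_repr (c : set M) : X_ t w c -> c (xget 0 c).
Proof.
by move=> [x bx <-]; apply: xgetPex; exists x; exact: double_coset_refl.
Qed.

(** Lets any member y of c replace the chosen [xget 0 c]: the two Bruhat factors change only by
    integral unipotent matrices. *)
Lemma X_bruhat (c : set M) y u v : X_ t w c -> c y -> dec y u v ->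
  exists al be, [/\ ZU al, ZUw be, (bruhat t w (xget 0 c)).1 = al *m u &
                  (bruhat t w (xget 0 c)).2 = v *m be].
Proof.
move=> Xc cy d; have cx := X_repr Xc; have [bx _ _] := X_mem Xc cx.
have [_ _ cE] := X_mem Xc cy; have := cx; rewrite cE => /double_cosetP[al [be [za zb]]].
rewrite -cE => xE; have := bruhatP bx; rewrite {1}xE => dx.
have [e1 e2] := dec_uniq dx (dec_move d za zb).
by exists al, be.
Qed.

(** The Heisenberg factor alone determines the coset: if it is shared, y' y^-1 equals the quotient
    of the left factors, so it is both integral and upper unipotent. *)
Lemma X_eq (c c' : set M) y y' u u' v : X_ t w c -> X_ t w c' -> c y -> c' y' ->
  dec y u v -> dec y' u' v -> c = c'.
Proof.
move=> Xc Xc' cy cy' [uu uv yE] [uu' _ yE'].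
have [_ gy ->] := X_mem Xc cy; have [_ gy' ->] := X_mem Xc' cy'.
have e : y' = u' *m invmx u *m y by rewrite yE' yE !mulmxA mulmxKV // unip_unit.
have za : ZU (u' *m invmx u).
  split; last by apply: unipM => //; exact: unipV.
  have uy : y \in unitmx by case: (GL_Zp_inv gy).
  have -> : u' *m invmx u = y' *m invmx y by rewrite e mulmxK.
  by apply: GL_Zp_mul => //; exact: (GL_Zp_inv gy).2.
by rewrite e -[_ *m y]mulmx1 double_coset_eq //; exact: ZUw1.
Qed.

End Cells.

Lemma frac_scaleE (F : fieldType) (P : F) (m : F) (r R : nat) : P != 0 -> (r <= R)%N ->
  P ^ r%:Z * (m / P ^+ R) = m / P ^+ (R - r).
Proof.
move=> P0 rR; have q0 := expf_neq0 r P0.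
by rewrite -exprnP -{1}(subnK rR) exprD mulrCA; congr (m * _); rewrite invfM mulrCA divff // mulr1.
Qed.

Lemma frac_pairE (F : fieldType) (P : F) (m1 m2 : F) (r R : nat) (e f : int) :
  P != 0 -> (r <= 2 * R)%N -> e + f = r%:Z ->
  P ^ e * P ^ f * (m1 / P ^+ R * (m2 / P ^+ R)) = m2 * m1 / P ^+ (2 * R - r).
Proof.
move=> P0 rR ef; rewrite -expfzDr // ef.
rewrite -(frac_scaleE _ P0 rR) mul2n -addnn exprD.
by have q := expf_neq0 R P0; field.
Qed.

Lemma frac_zpartE (F : fieldType) (P : F) (q : nat) (I : eqType) (s : seq I) (Q : pred I)
  (A B : I -> nat) (Z r R : nat) : P = q%:R -> P != 0 -> (r <= 2 * R)%N ->
  P ^ r%:Z * (Z%:R / P ^+ R - \sum_(l <- s | Q l) (A l)%:R / P ^+ R * ((B l)%:R / P ^+ R)) =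
  ((q ^ R * Z)%N%:Z - (\sum_(l <- s | Q l) A l * B l)%N%:Z)%:~R / P ^+ (2 * R - r).
Proof.
move=> Pq P0 rR; rewrite -(frac_scaleE _ P0 rR); congr (_ * _).
have q0 := expf_neq0 R P0.
rewrite intrB -!pmulrn natrM natrX -Pq mulrBl mul2n -addnn exprD; congr (_ - _); first by field.
rewrite natr_sum mulr_suml; apply: eq_bigr => l _.
by rewrite natrM; field.
Qed.

(** * Representatives with common denominator p^R and the two coset counts *)

Section NormalForm.
Variables (p : nat) (pp : prime p) (n : nat).
Hypothesis n2 : (2 <= n)%N.
Local Notation Zp := (Zp_ pp).
Local Notation Qp := (Qp_ pp).
Local Notation M := 'M[Qp]_n.+1.
Local Notation w := (w_star pp n).
Variable r : 'I_n -> nat.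
Local Notation t := (C_star pp r).
Local Notation N := (t *m w).
Local Notation P := (p%:R : Qp).
Local Notation rr := (ext_exp r).
Implicit Types (c : set M) (u v x y : M).

Lemma ext_exp_end : rr n.+1 = 0%N.
Proof. by rewrite /ext_exp insubF //= ltnn. Qed.

Section Bounds.
Variables (u : M) (a b : 'I_n.+1 -> Qp) (z : Qp).
Hypotheses (uu : unip u) (gx : GL_Zp (u *m N *m heis a b z)).
Let Ix i j : isint ((u *m N *m heis a b z) i j) := GL_Zp_entry i j gx.

Lemma dec_a (i : 'I_n.+1) : inner i -> isint (P ^ (rr i.+1)%:Z * a i).
Proof. exact: (a_bound n2 (isint0 pp) (isint1 pp) (@isintN _ pp) (@isintD _ pp) (@isintM _ pp)
  (P_neq0 pp) ext_exp_end uu Ix). Qed.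

Lemma dec_b (i : 'I_n.+1) : inner i -> isint (P ^ (rr i)%:Z * b i).
Proof. exact: (b_bound n2 (isint0 pp) (isint1 pp) (@isintN _ pp) (@isintD _ pp) (@isintM _ pp)
  (P_neq0 pp) ext_exp_end uu Ix). Qed.

Lemma dec_z k : (0 < k <= n)%N -> isint (P ^ (rr k)%:Z * zpart a b z k).
Proof. exact: (z_bound n2 (isint0 pp) (isint1 pp) (@isintN _ pp) (@isintD _ pp) (@isintM _ pp)
  (P_neq0 pp) ext_exp_end uu Ix). Qed.

Lemma dec_skip (k : 'I_n) (l : 'I_n.+1) e : (k.+1 < n)%N -> (l <= k.+1)%N ->
  (k == 0 :> nat) || (l != widen_ord (leqnSn n) k) -> isint (P ^ e) -> isint (P ^ e * superdiag u k) ->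
  isint (P ^ e * P ^ ((rr k)%:Z - (rr k.+1)%:Z + (rr k.+2)%:Z) *
     ((if k == 0 :> nat then 1 else b (widen_ord (leqnSn n) k)) * (if l == ord0 then 1 else a l))).
Proof. exact: (skip_bound n2 (isint0 pp) (isint1 pp) (@isintN _ pp) (@isintD _ pp) (@isintM _ pp)
  (P_neq0 pp) ext_exp_end uu Ix). Qed.

Lemma dec_skip_last (k : 'I_n) (l : 'I_n.+1) e : k.+1 = n ->
  (l == ord_max) || (l == widen_ord (leqnSn n) k) -> isint (P ^ e) -> isint (P ^ e * superdiag u k) ->
  isint (P ^ e * P ^ ((rr k)%:Z - (rr k.+1)%:Z) * (if l == ord_max then b (widen_ord (leqnSn n) k) else 1)).
Proof. exact: (skip_bound_last n2 (isint0 pp) (isint1 pp) (@isintN _ pp) (@isintD _ pp) (@isintM _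
  pp) (P_neq0 pp) (erefl _) ext_exp_end uu Ix). Qed.

End Bounds.

Lemma ZUw_heis (a b : 'I_n.+1 -> Qp) z : (forall i, isint (a i)) -> (forall i, isint (b i)) ->
  isint z -> ZUw (heis a b z).
Proof.
move=> ia ib iz; split; last by apply/U_wP => //; exists a, b, z.
apply: GL_Zp_unip (heis_unip n2 a b z) => i j; rewrite heisE.
case: (i == j); first exact: isint1.
case: (i == ord0); first by case: (j == ord_max).
by case: (j == ord_max) => //; exact: isint0.
Qed.

Variable R : nat.
Hypothesis rR : forall k, (rr k <= R)%N.

Definition nheis (d : (nat -> nat) * (nat -> nat) * nat) : M :=
  heis (fun i : 'I_n.+1 => (d.1.1 i)%:R / P ^+ R) (fun i : 'I_n.+1 => (d.1.2 i)%:R / P ^+ R)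
    (d.2%:R / P ^+ R).

Definition normal c u d :=
  [/\ unip u, c (u *m N *m nheis d), (forall i, (0 < i < n)%N -> (d.1.1 i, d.1.2 i) \in box p R) &
      d.2 \in iota 0 (p ^ R)].

Lemma inner_lt (i : 'I_n.+1) : inner i = (0 < i < n)%N.
Proof. by rewrite /inner -!val_eqE /= lt0n [(i < n)%N]ltn_neqAle leq_ord andbT. Qed.

Lemma isint_scale (k : nat) (x : Qp) : (k <= R)%N -> isint (P ^ k%:Z * x) -> isint (x * P ^+ R).
Proof.
by move=> kR; rewrite mulrC; apply: (@isint_PzD _ pp x k%:Z R%:Z); rewrite lez_nat.
Qed.

(** An integral Heisenberg factor first turns a and b into fractions over p^R. This shifts z by a
    cross term, so the denominator of the corner is bounded only afterwards, from the minor with k =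
    n, where the sum in [zpart] is empty; a central factor then normalises it. *)
Lemma normal_form c : X_ t w c -> exists u d, normal c u d.
Proof.
move=> Xc; have cx := X_repr n2 Xc; have [bx gx _] := X_mem n2 Xc cx.
have [u [v [uu /(U_wP n2)[a [b [z vE]]] xE]]] := bigcell_dec n2 bx.
move: cx gx; rewrite xE vE => cx gx {xE vE v bx}.
have appr (f : 'I_n.+1 -> Qp) : (forall i, inner i -> isint (f i * P ^+ R)) ->
    exists A : nat -> nat, forall i, inner i ->
      [/\ (0 < A i)%N, (A i <= p ^ R)%N & isint ((A i)%:R / P ^+ R - f i)].
  move=> hf; have /choice[g gE] : forall i : 'I_n.+1, exists m, inner i ->
      [/\ (0 < m)%N, (m <= p ^ R)%N & isint (m%:R / P ^+ R - f i)].
    move=> i; case: (boolP (inner i)) => [/hf/isint_approx1[m [m0 mR im]]|_]; last by exists 0%N.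
    by exists m => _; split=> //; rewrite -opprB; exact: isintN.
  exists (fun k => g (inord k)) => i ii; rewrite inord_val; exact: gE.
have [A AE] := appr a (fun i ii => isint_scale (rR _) (dec_a uu gx ii)).
have [B BE] := appr b (fun i ii => isint_scale (rR _) (dec_b uu gx ii)).
pose a' (i : 'I_n.+1) : Qp := (A i)%:R / P ^+ R.
pose b' (i : 'I_n.+1) : Qp := (B i)%:R / P ^+ R.
pose al i : Qp := if inner i then a' i - a i else 0.
pose be i : Qp := if inner i then b' i - b i else 0.
have ial i : isint (al i).
  by rewrite /al; case: ifP => [/AE[]//|_]; exact: isint0.
have ibe i : isint (be i).
  by rewrite /be; case: ifP => [/BE[]//|_]; exact: isint0.
have step x g : c x -> ZUw g -> c (x *m g) /\ GL_Zp (x *m g).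
  move=> cxx zg; have [_ _ cE] := X_mem n2 Xc cxx.
  have cg : c (x *m g).
    rewrite cE; apply/double_cosetP; exists 1%:M, g; split=> //; first exact: ZU1.
    by rewrite mul1mx.
  by split=> //; have [] := X_mem n2 Xc cg.
have [c1 g1] := step _ _ cx (ZUw_heis ial ibe (isint0 pp)).
move: c1 g1; rewrite -[_ *m heis al be 0]mulmxA heisM // => c1 g1.
set z1 := z + 0 + _ in c1 g1.
have e1 : heis (fun i => a i + al i) (fun i => b i + be i) z1 = heis a' b' z1.
  apply: (heis_ext n2) => i ii; rewrite /al /be ii addrC; exact: subrK.
rewrite e1 in c1 g1.
have iz1 : isint (z1 * P ^+ R).
  apply: (isint_scale (rR n)).
  have hn : (0 < n <= n)%N by rewrite leqnn ltnW.
  have := dec_z uu g1 hn.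
  rewrite /zpart big_pred0 ?subr0 // => l.
  by apply/negbTE/negP => /andP[]; rewrite inner_lt => /andP[_ ln]; rewrite leqNgt ln.
have [Zn [ZR iZ]] := isint_approx iz1.
pose ga := Zn%:R / P ^+ R - z1.
have iga : isint ga by rewrite /ga -opprB; exact: isintN.
have [c2 _] := step _ _ c1 (ZUw_heis (fun=> isint0 pp) (fun=> isint0 pp) iga).
exists u, (A, B, Zn); split=> //.
- move: c2; rewrite -[_ *m heis _ _ ga]mulmxA heisM // big1 => [|l _]; last by rewrite mulr0.
  rewrite addr0 /ga addrC subrK /nheis /=; congr c; congr (_ *m _).
  by apply: (heis_ext n2) => i _; rewrite addr0.
- move=> i /= hi; have iN : (i < n.+1)%N by case/andP: hi => _ /ltnW.
  have ii : inner (Ordinal iN) by rewrite inner_lt.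
  have [A0 AR _] := AE _ ii; have [B0 BR _] := BE _ ii.
  by apply/allpairsP; exists (A i, B i); rewrite !mem_iota !add1n !ltnS A0 AR B0 BR.
- by rewrite mem_iota.
Qed.

Lemma X_choice : exists U : set M -> M, exists d : set M -> (nat -> nat) * (nat -> nat) * nat,
  forall c, X_ t w c -> normal c (U c) (d c).
Proof.
have [f fE] : {f : set M -> M * ((nat -> nat) * (nat -> nat) * nat) & forall c, X_ t w c -> normal c
  (f c).1 (f c).2}.
  apply: (choice (P := fun c ud => X_ t w c -> normal c ud.1 ud.2)) => c.
  case: (pselect (X_ t w c)) => [/normal_form[u [d h]]|nX]; first by exists (u, d).
  by exists (0, (fun=> 0%N, fun=> 0%N, 0%N)).
by exists (fun c => (f c).1), (fun c => (f c).2).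
Qed.

Lemma X_data : exists U : set M -> M, exists A B : set M -> nat -> nat, exists Z : set M -> nat,
  [/\ forall c, X_ t w c -> normal c (U c) (A c, B c, Z c) &
    forall c c', X_ t w c -> X_ t w c' ->
      (forall i, (0 < i < n)%N -> A c i = A c' i /\ B c i = B c' i) -> Z c = Z c' -> c = c'].
Proof.
have [U [d dE]] := X_choice.
exists U, (fun c => (d c).1.1), (fun c => (d c).1.2), (fun c => (d c).2); split=> [c|c c'] Xc.
  by have := dE _ Xc; rewrite -!surjective_pairing.
move=> Xc' hAB hZ; have [uu cy _ _] := dE _ Xc; have [uu' cy' _ _] := dE _ Xc'.
have e : nheis (d c) = nheis (d c').
  rewrite /nheis hZ; apply: (heis_ext n2) => i; by rewrite inner_lt => /hAB[e1 e2]; rewrite ?e1 ?e2.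
have uw : U_ w (nheis (d c)) by apply/(U_wP n2); do 3!eexists.
have d1 : @dec p pp n r (U c *m N *m nheis (d c)) (U c) (nheis (d c)) by split.
have d2 : @dec p pp n r (U c' *m N *m nheis (d c')) (U c') (nheis (d c)) by rewrite e; split; rewrite -?e.
exact: (X_eq n2 Xc Xc' cy cy' d1 d2).
Qed.

Lemma isint_dvd (A k : nat) : (k <= R)%N -> isint (P ^ k%:Z * (A%:R / P ^+ R)) -> (p ^ (R - k) %| A)%N.
Proof. by move=> kR; rewrite (frac_scaleE _ (P_neq0 pp) kR); exact: isint_frac. Qed.

Lemma count_X (s : seq (set M)) : uniq s -> (forall c, c \in s -> X_ t w c) ->
  (size s <= \prod_(1 <= k < n.+1) ((rr k).+1 * p ^ rr k))%N.
Proof.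
move=> us Xs; have [U [A [B [Z [nf inj]]]]] := X_data.
apply: (@sequential_count p R pp _ s A B Z n n2 us) => //.
- by move=> c i /Xs/nf[_ _ h _]; exact: h.
- by move=> c /Xs/nf[].
- by move=> c c' /Xs Xc /Xs Xc'; exact: inj.
- move=> c i /Xs Xc hi; have [uu cy _ _] := nf _ Xc; have [_ gy _] := X_mem n2 Xc cy.
  have iN : (i < n.+1)%N by case/andP: hi => _ /ltnW.
  have ii : inner (Ordinal iN) by rewrite inner_lt.
  exact: (isint_dvd (rR i.+1) (dec_a uu gy ii)).
- move=> c i /Xs Xc hi; have [uu cy _ _] := nf _ Xc; have [_ gy _] := X_mem n2 Xc cy.
  have iN : (i < n.+1)%N by case/andP: hi => _ /ltnW.
  have ii : inner (Ordinal iN) by rewrite inner_lt.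
  exact: (isint_dvd (rR i) (dec_b uu gy ii)).
- move=> c k /Xs Xc hk; have [uu cy _ _] := nf _ Xc; have [_ gy _] := X_mem n2 Xc cy.
  have rk2 : (rr k <= 2 * R)%N by rewrite (leq_trans (rR k)) // leq_pmull.
  have := dec_z uu gy hk; rewrite /zpart /=.
  rewrite (@frac_zpartE _ P p _ _ _ (fun i : 'I_n.+1 => A c i) (fun i => B c i) (Z c) _ R (erefl _)
    (P_neq0 pp) rk2).
  move=> /isint_fracz[q qE]; apply/dvdzP; exists q; rewrite -qE; congr (_ - Posz _).
  rewrite (big_nat_widen _ _ n.+1) // big_geq_mkord /=; apply: eq_bigl => l.
  by rewrite inner_lt; case/andP: hk => k0 _; case: (leqP k l) => kl;
    rewrite ?andbF // (leq_trans k0 kl) andbT.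
Qed.

Lemma superdiag_ZU al u k : ZU al -> unip u -> isint (superdiag (al *m u) k - superdiag u k).
Proof.
move=> [gal ual] uu; have -> : superdiag (al *m u) k = superdiag al k + superdiag u k by exact: sdiagM.
by rewrite addrK; exact: GL_Zp_entry.
Qed.

(** Here p^E clears the superdiagonal of u, so the skipping minors apply with c = p^E. Those for k =
    0 and k = n-1 bound the denominators of a_1 and b_(n-1), the others that of a_(k+1) b_k. The
    lower bound on R makes all resulting exponents at most R. *)
Lemma count_X_small (s : seq (set M)) E : uniq s -> (forall c, c \in s -> X_ t w c) ->
  (forall c k, c \in s -> isint (P ^+ E * superdiag (bruhat t w (xget 0 c)).1 k)) ->
  (forall k, (0 < k < n.-1)%N -> (rr k.+1 <= E + rr k + rr k.+2)%N) ->
  (forall j k, (E + rr j + rr k <= R)%N) -> (0 < size s)%N ->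
  [/\ (rr 1 <= rr 2 + E)%N, (rr n <= rr n.-1 + E)%N &
   (size s <= p ^ (E + rr 2 - rr 1) * p ^ (E + rr n.-1 - rr n) * p ^ rr n *
     \prod_(1 <= k < n.-1) ((E + rr k + rr k.+2 - rr k.+1).+1 * p ^ (E + rr k + rr k.+2 - rr k.+1)))%N].
Proof.
move=> us Xs hE hconv hR s0; have [U [A [B [Z [nf inj]]]]] := X_data.
have iPE : isint (P ^ E%:Z) by exact: isint_Pz.
have hU c k : c \in s -> isint (P ^ E%:Z * superdiag (U c) k).
  move=> cs; have Xc := Xs _ cs; have [uu cy _ _] := nf _ Xc.
  have uw : U_ w (nheis (A c, B c, Z c)) by apply/(U_wP n2); do 3!eexists.
  have d1 : @dec p pp n r (U c *m N *m nheis (A c, B c, Z c)) (U c) (nheis (A c, B c, Z c)) by split.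
  have [al [be [za _ e _]]] := X_bruhat n2 Xc cy d1.
  have := isintB (hE c k cs) (isintM iPE (superdiag_ZU k za uu)); rewrite e => h.
  by move: h; rewrite -exprnP -mulrBr opprB addrC subrK.
pose k0 : 'I_n := Ordinal (ltnW n2).
have nn : (n.-1 < n)%N by rewrite prednK // ltnW.
pose kl : 'I_n := Ordinal nn.
have kln : kl.+1 = n by rewrite /= prednK // ltnW.
have l1n : (1 < n.+1)%N by rewrite ltnS ltnW.
pose l1 : 'I_n.+1 := Ordinal l1n.
have hs c : c \in s -> GL_Zp (U c *m N *m nheis (A c, B c, Z c)) /\ unip (U c).
  by move=> cs; have [uu cy _ _] := nf _ (Xs _ cs); have [] := X_mem n2 (Xs _ cs) cy.
have [c0 c0s] : exists c0, c0 \in s by case: (s) s0 => // c0 s' _; exists c0; rewrite inE eqxx.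
have [g0 u0] := hs _ c0s.
(* With l = 0 the minor is a pure power of p, so one existing coset forces its exponent to be
   nonnegative. [rl] follows in the same way from column n - 1. *)
have r0 : (rr 1 <= rr 2 + E)%N.
  have := dec_skip u0 g0 (n2 : (k0.+1 < n)%N) (leq0n _ : ((ord0 : 'I_n.+1) <= k0.+1)%N) isT iPE (hU
    _ k0 c0s).
  rewrite eqxx !mulr1 -expfzDr ?P_neq0 //= => /isint_Pz1; rewrite add0r.
  by rewrite /=; lia.
have rl : (rr n <= rr n.-1 + E)%N.
  have := dec_skip_last u0 g0 kln (_ : (widen_ord (leqnSn n) kl == ord_max) || (widen_ord (leqnSn n)
    kl == widen_ord (leqnSn n) kl)) iPE (hU _ kl c0s).
  rewrite eqxx orbT (negbTE (_ : widen_ord (leqnSn n) kl != ord_max));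
    last by rewrite -val_eqE /= neq_ltn nn.
  move=> /(_ isT); rewrite mulr1 -expfzDr ?P_neq0 // kln -[nat_of_ord kl]/(n.-1) => /isint_Pz1.
  by lia.
split=> //.
have rn1 := hR n.-1 n; have rn2 := hR 1%N 2%N.
apply: (@skip_count p R pp _ s A B Z n n2 us _ _ _ (E + rr 2 - rr 1) (E + rr n.-1 - rr n) (rr n)
  (fun k => E + rr k + rr k.+2 - rr k.+1)%N).
- by move=> c i /Xs/nf[_ _ h _]; exact: h.
- by move=> c /Xs/nf[].
- by move=> c c' /Xs Xc /Xs Xc'; exact: inj.
- by lia.
- by lia.
- exact: rR.
- by move=> k; have := hR k k.+2; lia.
- move=> c cs; have [gy uu] := hs _ cs; split.
  + apply: isint_dvd; first by lia.
    have := dec_skip uu gy (n2 : (k0.+1 < n)%N) (leqnn _ : (l1 <= k0.+1)%N) isT iPE (hU _ k0 cs).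
    rewrite eqxx mul1r -expfzDr ?P_neq0 // -[nat_of_ord k0]/0%N -[rr 0]/0%N.
    by congr (isint (_ ^ _ * _)); move: r0; lia.
  + apply: isint_dvd; first by lia.
    have := dec_skip_last uu gy kln (_ : (ord_max == ord_max) || (ord_max == widen_ord (leqnSn n)
      kl)) iPE (hU _ kl cs).
    rewrite eqxx => /(_ isT); rewrite -expfzDr ?P_neq0 // kln -[nat_of_ord kl]/(n.-1).
    by congr (isint (_ ^ _ * _)); move: rl; lia.
  + apply: (isint_dvd (rR n)).
    have hn : (0 < n <= n)%N by rewrite leqnn ltnW.
    have := dec_z uu gy hn; rewrite /zpart big_pred0 ?subr0 // => l.
    by apply/negbTE/negP => /andP[]; rewrite inner_lt => /andP[_ ln]; rewrite leqNgt ln.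
- move=> c k cs hk; have [gy uu] := hs _ cs.
  have kn : (k < n)%N by lia.
  have kn1 : (k.+1 < n.+1)%N by lia.
  have kn2 : (k.+1 < n)%N by lia.
  have hl : (Ordinal kn == 0 :> nat) || (Ordinal kn1 != widen_ord (leqnSn n) (Ordinal kn)).
    by apply/orP; right; rewrite -val_eqE /= neq_ltn ltnSn orbT.
  have := dec_skip uu gy (kn2 : ((Ordinal kn).+1 < n)%N) (leqnn _ : (Ordinal kn1 <= (Ordinal
    kn).+1)%N) hl iPE (hU _ (Ordinal kn) cs).
  rewrite ifF; last by apply/negbTE; rewrite -lt0n; case/andP: hk.
  have hc := hconv _ hk.
  have e : E%:Z + ((rr k)%:Z - (rr k.+1)%:Z + (rr k.+2)%:Z) = (E + rr k + rr k.+2 - rr k.+1)%N%:Z by lia.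
  have hr2 : (E + rr k + rr k.+2 - rr k.+1 <= 2 * R)%N by have := hR k k.+2; lia.
  have hl0 : (Ordinal kn1 == ord0) = false by [].
  rewrite hl0 -[nat_of_ord (Ordinal kn)]/k (frac_pairE _ _ (P_neq0 pp) hr2 e) -natrM.
  exact: isint_frac.
Qed.

End NormalForm.

(** * Denominator exponents and averages over units *)

Section Pole.
Variables (p : nat) (pp : prime p).
Local Notation Zp := (Zp_ pp).
Local Notation Qp := (Qp_ pp).
Local Notation P := (p%:R : Qp).
Implicit Types (x y : Qp) (k : nat).

Lemma pole_ex x : exists k, `[< isint (x * P ^+ k) >].
Proof. by have [k kx] := isint_bounded x; exists k; apply/asboolP. Qed.

(** This is max(0, -v_p(x)), obtained without a valuation on Q_p. *)
Definition pole x := ex_minn (pole_ex x).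

Lemma poleP x k : isint (x * P ^+ k) <-> (pole x <= k)%N.
Proof.
rewrite /pole; case: ex_minnP => m /asboolP mx mmin; split=> [kx|mk].
  by apply: mmin; apply/asboolP.
by apply: (@isint_PzD _ pp x m%:Z k%:Z).
Qed.

Lemma pole_eq x y : (forall k, isint (x * P ^+ k) <-> isint (y * P ^+ k)) -> pole x = pole y.
Proof.
move=> h; apply/eqP; rewrite eqn_leq; apply/andP; split.
  by apply/poleP/h/poleP.
by apply/poleP/h/poleP.
Qed.

Lemma poleDr x i : isint i -> pole (x + i) = pole x.
Proof.
move=> ii; apply: pole_eq => k; rewrite mulrDl; apply: isintDr.
by apply: isintM => //; apply: isintX; exact: isint_nat.
Qed.

Lemma poleM_unit x i j : isint i -> isint j -> i * j = 1 -> pole (i * x) = pole x.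
Proof.
move=> ii ij e; apply: pole_eq => k; rewrite -mulrA; split=> h; last exact: isintM.
by have := isintM ij h; rewrite mulrA [j * i]mulrC e mul1r.
Qed.

Lemma ZpQp_nat m : ZpQp (m%:R : Zp) = m%:R.
Proof. by rewrite /ZpQp tofracMn tofrac1. Qed.

Lemma nat_unit_Zp m : coprime p m -> exists v : Zp, m%:R * v = 1.
Proof.
move=> cp; apply: dg0_unit; rewrite dg_nat expn1 -/(dvdn p m).
by rewrite -prime_coprime.
Qed.

Lemma isint_unit_cancel m x : coprime p m -> isint (m%:R * x) -> isint x.
Proof.
move=> /nat_unit_Zp[v vE] h; have : isint (ZpQp v * (m%:R * x)) by apply: isintM => //; exists v.
by rewrite mulrA -ZpQp_nat /ZpQp -tofracM [v * _]mulrC vE tofrac1 mul1r.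
Qed.

(** The part of m prime to p is a unit of Z_p, so dividing by m costs only v_p(m). *)
Lemma isint_intr_cancel (m : int) x e : m != 0 -> isint (m%:~R * x * P ^ e) ->
  isint (x * P ^ (e + (logn p `|m|%N)%:Z)).
Proof.
move=> m0 h; have m0' : (0 < `|m|)%N by rewrite absz_gt0.
have {}h : isint (`|m|%N%:R * x * P ^ e).
  case: m m0 h {m0'} => m // m0; rewrite NegzE mulrNz !mulNr => /isintNE //.
have [m' cm' mE] := pfactor_coprime pp m0'; move: h; rewrite {1}mE natrM natrX.
rewrite -[_ * x]mulrA -[m'%:R * _ * _]mulrA => /(isint_unit_cancel cm').
by rewrite [_ * x]mulrC -mulrA expfzDr ?P_neq0 // [P ^ e * _]mulrC.
Qed.

Lemma logn_ge0_of_isint (m : int) e : m != 0 -> isint (m%:~R * P ^ e) ->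
  0 <= e + (logn p `|m|%N)%:Z.
Proof.
move=> m0 h; apply: (@isint_Pz1 _ pp); rewrite -[_ ^ _]mul1r.
by apply: (isint_intr_cancel m0); rewrite mulr1.
Qed.

End Pole.

Lemma torus_fracE (F : fieldType) (x y s c c' a b Q : F) :
  c * x + s * y - (c * a + c' * b) / Q = c * (x - a / Q) + c' * (y - b / Q) - (c' - s) * y.
Proof. ring. Qed.

Lemma torus_remE (F : fieldType) (y s c c' q b Q : F) : Q != 0 -> s * c = 1 -> c * c' = 1 + q * Q ->
  (c' - s) * y = s * q * (b + Q * (y - b / Q)).
Proof.
move=> Q0 sc cc; have -> : c' - s = s * q * Q.
  have -> : c' = s * (c * c') by rewrite mulrA sc mul1r.
  by rewrite cc; ring.
by field.
Qed.

Section Average.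
Variables (R : realType) (p : nat) (pp : prime p).
Local Notation Zp := (Zp_ pp).
Local Notation Qp := (Qp_ pp).
Local Notation P := (p%:R : Qp).
Local Notation e := (padic_e R).

Definition ulift M (c : 'Z_(p ^ M)) : Zp := (c : nat)%:R.

Lemma ulift_unit M (c : 'Z_(p ^ M)) : (0 < M)%N -> c \is a GRing.unit ->
  ulift c \is a GRing.unit.
Proof.
move=> M0 cu; apply/unitrPr; apply: nat_unit_Zp.
rewrite -(coprime_pexpl _ _ M0) -(@unitZpE (p ^ M)) ?expM_gt1 //.
by rewrite natr_Zp.
Qed.

(** The inverse of the lift and the lift of the inverse agree only modulo p^M, which suffices
    because y has denominator at most p^M. *)
Lemma ulift_e M (x y : Qp) (a b : nat) (c : 'Z_(p ^ M)) : (0 < M)%N -> c \is a GRing.unit ->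
  isint (x - a%:R / P ^+ M) -> isint (y - b%:R / P ^+ M) ->
  e (ZpQp (ulift c) * x + ZpQp (ulift c)^-1 * y) = zchar R (a%:R * c + b%:R / c).
Proof.
move=> M0 cu ix iy; have uc := ulift_unit M0 cu.
pose c' : nat := c^-1; pose s := ZpQp (ulift c)^-1.
have [q qE] : exists q, (c * c' = 1 + q * p ^ M)%N.
  have e1 : ((c * c')%N%:R : 'Z_(p ^ M)) = 1%:R by rewrite natrM !natr_Zp divrr.
  have {}e1 := congr1 (@nat_of_ord _) e1.
  rewrite (val_Zp_nat (expM_gt1 pp M0)) (val_Zp_nat (expM_gt1 pp M0)) in e1.
  rewrite (modn_small (expM_gt1 pp M0)) in e1.
  by exists (c * c' %/ p ^ M)%N; rewrite {1}(divn_eq (c * c') (p ^ M)) e1 addnC.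
have sc : s * c%:R = 1.
  rewrite -(ZpQp_nat pp) /s /ZpQp -tofracM -[X in _ * X]/(ulift c) mulVr // tofrac1 //.
have cc : (c%:R : Qp) * c'%:R = 1 + q%:R * P ^+ M.
  by rewrite -natrM qE natrD natrM natrX.
rewrite (@padic_eE R p pp _ (c * a + c' * b)%N%:Z M).
  rewrite -pmulrn -natrX -zchar_nat ?expM_gt1 // natrD !natrM !natr_Zp.
  by congr zchar; rewrite mulrC [c^-1 * _]mulrC.
rewrite -pmulrn natrD !natrM -/s ZpQp_nat torus_fracE.
have P0 : P ^+ M != 0 by rewrite expf_neq0 // P_neq0.
rewrite (torus_remE y b%:R P0 sc cc).
apply: isintB; first by apply: isintD; apply: isintM => //; exact: isint_nat.
apply: isintM; first by apply: isintM; [exists (ulift c)^-1|exact: isint_nat].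
apply: isintD; first exact: isint_nat.
by apply: isintM => //; apply: isintX; exact: isint_nat.
Qed.

(** M is the exact larger denominator exponent, so at least one numerator is prime to p, as
    [kloost_bound] requires. J = E %/ 3 + 1 satisfies 3 (J - 1) <= E < M. *)
Lemma kloosterman_average E (x y : Qp) (M := maxn (pole x) (pole y)) : (E < M)%N ->
  Normc.normc (\sum_(c : 'Z_(p ^ M) | c \is a GRing.unit)
     e (ZpQp (ulift c) * x + ZpQp (ulift c)^-1 * y)) ^+ 4 <=
  96 * p%:R ^- (E %/ 3).+1 * (totient (p ^ M))%:R ^+ 4.
Proof.
move=> EM; have M0 : (0 < M)%N by exact: leq_ltn_trans EM.
have [a [_ ia]] := isint_approx ((poleP x M).2 (leq_maxl _ _)).
have [b [_ ib]] := isint_approx ((poleP y M).2 (leq_maxr _ _)).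
have t0 : (0 < (totient (p ^ M))%:R :> R) by rewrite ltr0n totient_gt0 expn_gt0 prime_gt0.
rewrite (eq_bigr _ (fun c cu => ulift_e M0 cu ia ib)) -ler_pdivrMr ?exprn_gt0 // -expr_div_n.
apply: (kloost_bound R pp M0); [by have := leq_trunc_div E 3; lia|by have := leq_trunc_div E 3; lia|].
rewrite !unitZpE ?expM_gt1 // !coprime_pexpl // !prime_coprime //.
have dv (z : Qp) (d : nat) : isint (z - d%:R / P ^+ M) -> (p %| d)%N -> (pole z <= M.-1)%N.
  move=> iz /dvdnP[d' dE]; apply/poleP.
  have -> : z = (z - d%:R / P ^+ M) + d%:R / P ^+ M by rewrite subrK.
  rewrite mulrDl; apply: isintD; first by apply: isintM => //; apply: isintX; exact: isint_nat.
  rewrite dE natrM -{1}(prednK M0) exprS invfM mulrA mulfK ?P_neq0 // divfK ?expf_neq0 ?P_neq0 //.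
  exact: isint_nat.
case: (boolP (p %| a)%N) => //= /(dv _ _ ia) xM; apply/negP => /(dv _ _ ib) yM.
have : (M <= M.-1)%N by rewrite {1}/M geq_max xM.
by case: (M) M0 => // k _; rewrite ltnn.
Qed.

End Average.

(** * The torus action on the cell and on its cosets *)

Section DiagonalConjugation.
Variables (F : fieldType) (n : nat).
Hypothesis n2 : (2 <= n)%N.
Implicit Types (f D : 'I_n.+1 -> F) (u v : 'M[F]_n.+1).

Definition dmx f : 'M[F]_n.+1 := diag_mx (\row_i f i).
Definition dconj f u : 'M[F]_n.+1 := \matrix_(i, j) (f i * u i j / f j).

Lemma dmx_mull f u i j : (dmx f *m u) i j = f i * u i j.
Proof. by rewrite mul_diag_mx !mxE. Qed.

Lemma dmx_mulr f u i j : (u *m dmx f) i j = u i j * f j.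
Proof. by rewrite mul_mx_diag !mxE. Qed.

Lemma dmxK f : (forall i, f i != 0) -> dmx f *m dmx (fun i => (f i)^-1) = 1%:M.
Proof.
move=> f0; apply/matrixP => i j; rewrite dmx_mull !mxE.
by case: eqVneq => [->|]; rewrite /= ?mulr1n ?mulr0n ?mulr0 ?divff.
Qed.

Lemma dmxVK f : (forall i, f i != 0) -> dmx (fun i => (f i)^-1) *m dmx f = 1%:M.
Proof. by move=> f0; apply: mulmx1C; exact: dmxK. Qed.

Lemma dconjE f u : dmx f *m u *m dmx (fun i => (f i)^-1) = dconj f u.
Proof. by apply/matrixP => i j; rewrite dmx_mulr dmx_mull mxE. Qed.

Lemma dconj_unip f u : (forall i, f i != 0) -> unip u -> unip (dconj f u).
Proof.
move=> f0 [u0 u1]; split=> [i j ji|i]; rewrite mxE; first by rewrite u0 // mulr0 mul0r.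
by rewrite u1 mulr1 divff.
Qed.

Lemma dconj_heis f a b z : (forall i, f i != 0) ->
  exists a' b' z', dconj f (heis a b z) = heis a' b' z'.
Proof.
move=> f0; exists (fun j => f ord0 * a j / f j), (fun i => f i * b i / f ord_max).
exists (f ord0 * z / f ord_max); apply/matrixP => i j; rewrite mxE !heisE.
case: (eqVneq i j) => [->|ij]; first by rewrite mulr1 divff.
case: (eqVneq i ord0) => [->|i0]; case: (eqVneq j ord_max) => [->|jm] //.
by rewrite mulr0 mul0r.
Qed.

Lemma sdiag_dconj f u j :
  sdiag (dconj f u) j = f (widen_ord (leqnSn n) j) / f (lift ord0 j) * sdiag u j.
Proof. by rewrite /sdiag mxE mulrAC. Qed.

Lemma dmx_cell D f : (forall i, f i != 0) ->
  dmx f *m (dmx D *m wst F n) *m dmx (fun j => (f (sg j))^-1) = dmx D *m wst F n.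
Proof.
move=> f0; apply/matrixP => i j; rewrite dmx_mulr !dmx_mull wstE //.
case: eqVneq => [->|_]; last by rewrite !mulr0 mul0r.
by rewrite sgK // mulrC mulKf.
Qed.

(** The right factor compensates the left one across [wst], so [tor f] fixes [dmx D *m wst F n] (see
    [dmx_cell]). On a Bruhat decomposition it conjugates u by f and u' by f o [sg]. *)
Definition tor f u := dmx f *m u *m dmx (fun j => (f (sg j))^-1).

Lemma tor_mul f a u b : (forall i, f i != 0) ->
  tor f (a *m u *m b) = dconj f a *m tor f u *m dconj (fun j => f (sg j)) b.
Proof.
move=> f0; have fs0 i : f (sg i) != 0 by [].
rewrite /tor -!dconjE -!mulmxA.
congr (_ *m (_ *m _)); rewrite [RHS]mulmxA dmxVK // mul1mx; congr (_ *m _).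
by rewrite [RHS]mulmxA dmxVK // mul1mx.
Qed.

Lemma torK f u : (forall i, f i != 0) -> tor (fun i => (f i)^-1) (tor f u) = u.
Proof.
move=> f0; apply/matrixP => i j; rewrite /tor !dmx_mulr !dmx_mull !dmx_mulr dmx_mull.
by rewrite invrK mulrA mulKf // divfK.
Qed.

Lemma tor_move f x y a b : (forall i, f i != 0) -> tor f x = a *m tor f y *m b ->
  x = dconj (fun i => (f i)^-1) a *m y *m dconj (fun i => (f (sg i))^-1) b.
Proof.
move=> f0 h; have fV0 i : (f i)^-1 != 0 by rewrite invr_eq0.
by rewrite -(torK x f0) h (tor_mul _ _ _ fV0) torK.
Qed.

Lemma tor_bruhat D f u v : (forall i, f i != 0) ->
  tor f (u *m (dmx D *m wst F n) *m v) =
  dconj f u *m (dmx D *m wst F n) *m dconj (fun j => f (sg j)) v.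
Proof. by move=> f0; rewrite tor_mul // /tor dmx_cell. Qed.

End DiagonalConjugation.

Section TorusAction.
Variables (p : nat) (pp : prime p) (n : nat).
Hypothesis n2 : (2 <= n)%N.
Local Notation Zp := (Zp_ pp).
Local Notation Qp := (Qp_ pp).
Local Notation M := 'M[Qp]_n.+1.
Local Notation w := (w_star pp n).
Variable r : 'I_n -> nat.
Local Notation t := (C_star pp r).
Local Notation N := (t *m w).

Definition intunit (x : Qp) := [/\ x != 0, isint x & isint x^-1].

Lemma intunitV x : intunit x -> intunit x^-1.
Proof. by move=> [x0 ix iV]; split; rewrite ?invr_eq0 ?invrK. Qed.

Lemma GL_Zp_dmx (f : 'I_n.+1 -> Qp) : (forall i, intunit (f i)) -> GL_Zp (dmx f).
Proof.
move=> fu.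
have [g gE] := choice (fun i => let: And3 _ h _ := fu i in h).
have [h hE] := choice (fun i => let: And3 _ _ h := fu i in h).
exists (diag_mx (\row_i g i)); last first.
  by apply/matrixP => i j; rewrite !mxE gE /ZpQp tofracMn.
have gh i : g i * h i = 1.
  apply/eqP; rewrite -tofrac_eq tofracM tofrac1 -[X in X * _]gE -[X in _ * X]hE.
  by rewrite divff //; case: (fu i).
rewrite /= unitmxE det_diag rpred_prod // => i _; rewrite mxE; apply/unitrPr; by exists (h i).
Qed.

Lemma isint_dconj (f : 'I_n.+1 -> Qp) (u : M) : (forall i, intunit (f i)) ->
  (forall i j, isint (u i j)) -> forall i j, isint (dconj f u i j).
Proof.
move=> fu iu i j; rewrite mxE; have [_ fi _] := fu i; have [_ _ fj] := fu j.
by apply: isintM => //; exact: isintM.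
Qed.

Lemma ZU_dconj (f : 'I_n.+1 -> Qp) u : (forall i, intunit (f i)) -> ZU u -> ZU (dconj f u).
Proof.
move=> fu [gu uu]; have f0 i : f i != 0 by case: (fu i).
have uu' := dconj_unip f0 uu; split=> //; apply: GL_Zp_unip => //; apply: isint_dconj => // i j.
exact: GL_Zp_entry.
Qed.

Lemma U_w_dconj (f : 'I_n.+1 -> Qp) u : (forall i, f i != 0) -> U_ w u -> U_ w (dconj f u).
Proof.
move=> f0 /(U_wP n2)[a [b [z ->]]]; apply/(U_wP n2).
by have [a' [b' [z' ->]]] := dconj_heis a b z f0; exists a', b', z'.
Qed.

Lemma ZUw_dconj (f : 'I_n.+1 -> Qp) u : (forall i, intunit (f i)) -> ZUw u -> ZUw (dconj f u).
Proof.
move=> fu [gu uu]; have f0 i : f i != 0 by case: (fu i).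
have uu' := U_w_dconj f0 uu; split=> //; apply: GL_Zp_unip; last exact: U_w_unip uu'.
by apply: isint_dconj => // i j; exact: GL_Zp_entry.
Qed.

Lemma GL_Zp_tor (f : 'I_n.+1 -> Qp) x : (forall i, intunit (f i)) -> GL_Zp x -> GL_Zp (tor f x).
Proof.
move=> fu gx; apply: GL_Zp_mul; last by apply: GL_Zp_dmx => i; exact: intunitV.
by apply: GL_Zp_mul => //; exact: GL_Zp_dmx.
Qed.

Lemma tor_dec (f : 'I_n.+1 -> Qp) x u v : (forall i, f i != 0) -> @dec p pp n r x u v ->
  @dec p pp n r (tor f x) (dconj f u) (dconj (fun j => f (sg j)) v).
Proof.
move=> f0 [uu uv ->]; split; first exact: dconj_unip f0 uu.
  by apply: U_w_dconj uv => i; exact: f0.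
exact: (tor_bruhat n2 _ u v f0).
Qed.

Definition act (f : 'I_n.+1 -> Qp) (c : set M) : set M := double_coset w (tor f (xget 0 c)).

Section Act.
Variable f : 'I_n.+1 -> Qp.
Hypothesis fu : forall i, intunit (f i).
Let f0 i : f i != 0. Proof. by case: (fu i). Qed.

Lemma X_act c : X_ t w c -> X_ t w (act f c).
Proof.
move=> Xc; have [bx gx _] := X_mem n2 Xc (X_repr n2 Xc).
exists (tor f (xget 0 c)) => //; exact: dec_bigcell (GL_Zp_tor fu gx) (tor_dec f0 (bruhatP n2 bx)).
Qed.

Lemma act_mem c : act f c (tor f (xget 0 c)).
Proof. exact: double_coset_refl. Qed.

Lemma act_superdiag c k : X_ t w c ->
  let uv := bruhat t w (xget 0 c) in let uv' := bruhat t w (xget 0 (act f c)) in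
  isint (superdiag uv'.1 k -
    f (widen_ord (leqnSn n) k) / f (lift ord0 k) * superdiag uv.1 k) /\
  isint (superdiag uv'.2 k -
    f (sg (widen_ord (leqnSn n) k)) / f (sg (lift ord0 k)) * superdiag uv.2 k).
Proof.
move=> Xc uv uv'; have [bx gx _] := X_mem n2 Xc (X_repr n2 Xc).
have d := tor_dec f0 (bruhatP n2 bx); have [uu uw _] := d.
have [al [be [za zb e1 e2]]] := X_bruhat n2 (X_act Xc) (act_mem c) d.
have uE : superdiag (dconj f uv.1) k = f (widen_ord (leqnSn n) k) / f (lift ord0 k) * superdiag uv.1 k.
  exact: sdiag_dconj.
have vE : superdiag (dconj (fun j => f (sg j)) uv.2) k =
    f (sg (widen_ord (leqnSn n) k)) / f (sg (lift ord0 k)) * superdiag uv.2 k.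
  exact: (sdiag_dconj (fun j => f (sg j))).
split; first by rewrite -uE /uv' e1; exact: superdiag_ZU.
rewrite -vE /uv' e2; have -> : forall v b : M, unip v -> unip b -> superdiag (v *m b) k = superdiag
  v k + superdiag b k.
- by move=> v b uv1 ub; exact: sdiagM.
- by rewrite addrC addKr; exact: GL_Zp_entry zb.1.
- exact: U_w_unip uw.
- exact: U_w_unip zb.2.
Qed.

Lemma act_inj c c' : X_ t w c -> X_ t w c' -> act f c = act f c' -> c = c'.
Proof.
move=> Xc Xc' e; have [_ _ cE] := X_mem n2 Xc (X_repr n2 Xc).
have [_ _ cE'] := X_mem n2 Xc' (X_repr n2 Xc').
have := act_mem c; rewrite e => /double_cosetP[al [be [za zb h]]].
have fV i : intunit (f i)^-1 by exact: intunitV.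
have zaV := ZU_dconj fV za; have zbV := ZUw_dconj (fun i => fV (sg i)) zb.
by rewrite cE cE' {1}(tor_move f0 h); exact: double_coset_eq.
Qed.

End Act.

End TorusAction.

(** * Averaging the phases over torus orbits *)

Lemma normc_sum (R : realType) (I : Type) (s : seq I) (Q : pred I) (F : I -> R[i]) :
  Normc.normc (\sum_(i <- s | Q i) F i) <= \sum_(i <- s | Q i) Normc.normc (F i).
Proof.
rewrite -lecR -norm_normc rmorph_sum /= (le_trans (ler_norm_sum _ _ _)) //.
Qed.

Lemma sum_by_labels (R : realType) (T L : eqType) (s : seq T) (lab : T -> L) (F : T -> R[i])
    (b : L -> R) :
  (forall l, Normc.normc (\sum_(c <- s | lab c == l) F c) <= \sum_(c <- s | lab c == l) b l) ->
  Normc.normc (\sum_(c <- s) F c) <= \sum_(c <- s) b (lab c).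
Proof.
move=> h; pose ls := undup [seq lab c | c <- s].
have split_sum (V : nmodType) (G : T -> V) :
    \sum_(c <- s) G c = \sum_(l <- ls) \sum_(c <- s | lab c == l) G c.
  rewrite (exchange_big_dep predT) //= big_seq [RHS]big_seq; apply: eq_bigr => c cs.
  rewrite -big_filter (_ : [seq l <- ls | lab c == l] = [:: lab c]) ?big_seq1 //.
  have -> : [seq l <- ls | lab c == l] = [seq l <- ls | pred1 (lab c) l].
    by apply: eq_filter => l; rewrite /= eq_sym.
  by rewrite filter_pred1_uniq ?undup_uniq // mem_undup map_f.
rewrite split_sum (le_trans (normc_sum _ _ _)) // (split_sum _ (fun c => b (lab c))).
apply: ler_sum => l _; apply: (le_trans (h l)); apply: ler_sum => c /eqP -> //.
Qed.

Section TorusWeights.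
Variables (F : fieldType) (n : nat).
Hypothesis n2 : (2 <= n)%N.
Implicit Types (k j : 'I_n) (x : F).

Definition tw x k (i : 'I_n.+1) : F := if (i <= k)%N then x else 1.
(** The superdiagonal of a Heisenberg matrix can be nonzero only at j = 0 and j = n-1. These are the
    positions among the two where [tw x k] o [sg] scales by x^-1; at the other it acts trivially. *)
Definition twisted k j := (j == 0%N :> nat) && (0 < k)%N || (j == n.-1 :> nat) && (k < n.-1)%N.

Lemma tw_ratio x k j : x != 0 ->
  tw x k (widen_ord (leqnSn n) j) / tw x k (lift ord0 j) = if j == k then x else 1.
Proof.
move=> x0; rewrite /tw -[nat_of_ord (lift ord0 j)]/(j.+1) -[nat_of_ord (widen_ord _ _)]/(j : nat).
rewrite -val_eqE /=; case: ltngtP => jk; rewrite ?divff ?oner_eq0 ?divr1 //.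
Qed.

Lemma tw_sg x k j : x != 0 ->
  tw x k (sg (widen_ord (leqnSn n) j)) / tw x k (sg (lift ord0 j)) =
  if twisted k j then x^-1 else if (j == 0%N :> nat) || (j == n.-1 :> nat) then 1
    else if j == k then x else 1.
Proof.
move=> x0; rewrite /tw /sg -!val_eqE /= ?/bump /= ?add1n /twisted.
have jn := ltn_ord j; have kn := ltn_ord k.
have -> : (j == n :> nat) = false by lia.
have -> : (j.+1 == n) = (j == n.-1 :> nat) by lia.
case: (eqVneq (j : nat) 0%N) => [j0|j0] /=; case: (eqVneq (j : nat) n.-1) => [j1|j1] /=.
- lia.
- have -> : (n <= k)%N = false by lia.
  by rewrite j0; case: (0 < k)%N; rewrite ?div1r ?divr1 // invr1.
- have -> : (j <= k)%N = ~~ (k < n.-1)%N by lia.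
  by case: (k < n.-1)%N; rewrite /= ?div1r ?divff.
- rewrite /bump leq0n add1n.
  by case: ltngtP => jk; rewrite ?divff ?oner_eq0 ?divr1.
Qed.

Lemma sdiag_heis_inner a b (z : F) j : j != 0%N :> nat -> j != n.-1 :> nat ->
  sdiag (heis a b z) j = 0.
Proof.
move=> j0 j1; rewrite /sdiag heisE -!val_eqE /= ?/bump /= ?add1n.
have jn := ltn_ord j; rewrite (negbTE j0).
have -> : (j == j.+1 :> nat) = false by lia.
by have -> : (j.+1 == n) = false by lia.
Qed.

Lemma tw_sg_heis a b (z : F) x k j : x != 0 ->
  tw x k (sg (widen_ord (leqnSn n) j)) / tw x k (sg (lift ord0 j)) * sdiag (heis a b z) j =
  (if twisted k j then x^-1 else 1) * sdiag (heis a b z) j.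
Proof.
move=> x0; rewrite tw_sg //; case: ifP => // tj; case: ifP => // /negbT; rewrite negb_or => /andP[j0 j1].
by rewrite sdiag_heis_inner // !mulr0.
Qed.

End TorusWeights.

Lemma ZpQp_intunit (p : nat) (pp : prime p) (a : Zp_ pp) : a \is a GRing.unit ->
  intunit (ZpQp a) /\ (ZpQp a)^-1 = ZpQp a^-1.
Proof.
move=> ua; have h : ZpQp a * ZpQp a^-1 = 1 by rewrite /ZpQp -tofracM divrr // tofrac1.
have a0 : ZpQp a != 0.
  by apply/eqP => e; move: h; rewrite e mul0r => /esym/eqP; rewrite oner_eq0.
have aV : (ZpQp a)^-1 = ZpQp a^-1 by rewrite -[RHS]mul1r -(mulVf a0) -mulrA h mulr1.
by split=> //; split; rewrite ?aV //; [exists a|exists a^-1].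
Qed.

Section Averaging.
Variables (R : realType) (p : nat) (pp : prime p) (n : nat).
Hypothesis n2 : (2 <= n)%N.
Local Notation Zp := (Zp_ pp).
Local Notation Qp := (Qp_ pp).
Local Notation M := 'M[Qp]_n.+1.
Local Notation w := (w_star pp n).
Variable r : 'I_n -> nat.
Local Notation t := (C_star pp r).
Local Notation N := (t *m w).
Variables psi psi' : 'I_n -> int.
Local Notation e := (padic_e R).
Implicit Types (c : set M) (k j : 'I_n).

Lemma padic_e_congr (x y : Qp) : isint (x - y) -> e x = e y.
Proof. by move=> h; rewrite -[x](subrK y) padic_eD padic_e_int // mul1r. Qed.

Definition phase_u c j : Qp := (psi j)%:~R * superdiag (bruhat t w (xget 0 c)).1 j.
Definition phase_v c j : Qp := (psi' j)%:~R * superdiag (bruhat t w (xget 0 c)).2 j.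
Definition phase c : Qp := \sum_j phase_u c j + \sum_j phase_v c j.
(** Under [tw x k] the phase splits, modulo integers, into [phase_u c k] scaled by x, [phase_tw]
    scaled by x^-1, and the fixed [phase_rest]. *)
Definition phase_tw c k : Qp := \sum_(j | twisted k j) phase_v c j.
Definition phase_rest c k : Qp :=
  \sum_(j | j != k) phase_u c j + \sum_(j | ~~ twisted k j) phase_v c j.

Lemma phaseE c k : phase c = phase_u c k + phase_tw c k + phase_rest c k.
Proof. by rewrite /phase (bigD1 k) //= [X in _ + X](bigID (twisted k)) /= addrACA. Qed.

Section Act.
Variables (x : Qp) (k : 'I_n).
Hypothesis xu : intunit x.
Let x0 : x != 0. Proof. by case: xu. Qed.

Lemma intunit_tw (i : 'I_n.+1) : intunit (tw x k i).
Proof.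
rewrite /tw; case: ifP => // _; split; rewrite ?oner_eq0 ?invr1 //; exact: isint1.
Qed.

Definition tact c := act (tw x k) c.

Lemma phase_u_tact c j : X_ t w c ->
  isint (phase_u (tact c) j - (if j == k then x else 1) * phase_u c j).
Proof.
move=> Xc; have [h _] := act_superdiag n2 intunit_tw j Xc.
rewrite /phase_u mulrCA -mulrBr -(tw_ratio k j x0).
by apply: isintM h; exact: isint_int.
Qed.

Lemma phase_v_tact c j : X_ t w c ->
  isint (phase_v (tact c) j - (if twisted k j then x^-1 else 1) * phase_v c j).
Proof.
move=> Xc; have [_ h] := act_superdiag n2 intunit_tw j Xc.
rewrite /phase_v mulrCA -mulrBr; apply: isintM; first exact: isint_int.
have [bx _ _] := X_mem n2 Xc (X_repr n2 Xc); have [_ /(U_wP n2)[a [b [z vE]]] _] := bruhatP n2 bx.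
have := tw_sg_heis n2 a b z k j x0.
by move: h; rewrite vE => h hE; rewrite -hE.
Qed.

Lemma phase_tw_tact c : X_ t w c -> isint (phase_tw (tact c) k - x^-1 * phase_tw c k).
Proof.
move=> Xc; rewrite /phase_tw mulr_sumr -sumrB; apply: isint_sum => j tj.
by have := phase_v_tact j Xc; rewrite tj.
Qed.

Lemma phase_rest_tact c : X_ t w c -> isint (phase_rest (tact c) k - phase_rest c k).
Proof.
move=> Xc; rewrite /phase_rest opprD addrACA -!sumrB; apply: isintD; apply: isint_sum => j hj.
  by have := phase_u_tact j Xc; rewrite (negbTE hj) mul1r.
by have := phase_v_tact j Xc; rewrite (negbTE hj) mul1r.
Qed.

Lemma e_phase_tact c : X_ t w c ->
  e (phase (tact c)) = e (x * phase_u c k + x^-1 * phase_tw c k) * e (phase_rest c k).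
Proof.
move=> Xc; have -> : e (phase (tact c)) =
    e (phase_u (tact c) k + phase_tw (tact c) k) * e (phase_rest (tact c) k).
  by rewrite (phaseE _ k) padic_eD.
rewrite (padic_e_congr (phase_rest_tact Xc)); congr (_ * _); apply: padic_e_congr.
rewrite opprD addrACA; apply: isintD; last exact: phase_tw_tact.
by have := phase_u_tact k Xc; rewrite eqxx.
Qed.

Lemma pole_congr (y y' : Qp) : isint (y' - y) -> pole y' = pole y.
Proof. by move=> h; rewrite -[y'](subrK y) addrC poleDr. Qed.

Lemma pole_intunit y : pole (x * y) = pole y.
Proof. by case: xu => _ ix iV; apply: poleM_unit ix iV _; rewrite divff. Qed.

Lemma pole_phase_u_tact c j : X_ t w c -> pole (phase_u (tact c) j) = pole (phase_u c j).
Proof.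
move=> Xc; rewrite (pole_congr (phase_u_tact j Xc)); case: ifP => _; rewrite ?mul1r //.
exact: pole_intunit.
Qed.

Lemma pole_phase_tw_tact c : X_ t w c -> pole (phase_tw (tact c) k) = pole (phase_tw c k).
Proof.
move=> Xc; rewrite (pole_congr (phase_tw_tact Xc)); case: xu => _ ix iV.
by apply: poleM_unit iV ix _; rewrite mulVf.
Qed.

End Act.

Variable E : nat.

(* k is an index with a non-negligible phase, and the second component is the conductor exponent of
   the Kloosterman sum obtained by averaging over the torus element tw x k. Both are invariant under
   that torus element, so it permutes each class. *)
Definition label c : option ('I_n * nat) :=
  if [pick k | (E < pole (phase_u c k))%N] is Some k
  then Some (k, maxn (pole (phase_u c k)) (pole (phase_tw c k))) else None.

Lemma label_tact x k m c : intunit x -> X_ t w c -> label c = Some (k, m) ->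
  label (tact x k c) = Some (k, m).
Proof.
move=> xu Xc; rewrite /label.
under [X in _ -> match X with Some _ => _ | None => _ end = _]eq_pick => j do
  rewrite (pole_phase_u_tact k xu j Xc).
case: pickP => // j _ [-> <-].
by rewrite (pole_phase_u_tact k xu k Xc) (pole_phase_tw_tact k xu Xc).
Qed.

(** Every unit a modulo p^m permutes the class. Summing over all a, the totient of p^m times the
    class sum becomes a sum over c of Kloosterman sums, each multiplied by a constant phase of
    absolute value 1. *)
Lemma label_class_bound (s : seq (set M)) (B : R) k m : uniq s -> (forall c, c \in s <-> X_ t w c) ->
  0 <= B -> 96 * p%:R ^- (E %/ 3).+1 <= B ^+ 4 ->
  Normc.normc (\sum_(c <- s | label c == Some (k, m)) e (phase c)) <=
  \sum_(c <- s | label c == Some (k, m)) B.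
Proof.
move=> us sX B0 Bp; 
pose s' := [seq c <- s | label c == Some (k, m)]; rewrite -big_filter -[leRHS]big_filter -/s'.
have s'P c : c \in s' -> label c = Some (k, m) /\ X_ t w c.
  by rewrite mem_filter => /andP[/eqP ? /sX].
have us' : uniq s' by exact: filter_uniq.
have s'M c : c \in s' -> (E < m)%N /\ m = maxn (pole (phase_u c k)) (pole (phase_tw c k)).
  move=> /s'P[+ _]; rewrite /label; case: pickP => // j Ej [<- <-]; split=> //.
  by rewrite (leq_trans Ej) // leq_maxl.
case: (posnP (size s')) => [/size0nil ->|]; first by rewrite !big_nil Normc.normc0.
case s'E : s' => [//|c0 s0] _; rewrite -s'E.
have [|Em _] := s'M c0; first by rewrite s'E mem_head.
have m0 : (0 < m)%N by exact: leq_ltn_trans Em.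
have permE (a : 'Z_(p ^ m)) : a \is a GRing.unit ->
    \sum_(c <- s') e (phase c) =
    \sum_(c <- s') e (ZpQp (ulift pp a) * phase_u c k + ZpQp (ulift pp a)^-1 * phase_tw c k) * e
      (phase_rest c k).
  move=> ua; have uu := ulift_unit pp m0 ua.
  have [xu xV] := ZpQp_intunit uu.
  rewrite -(perm_big _ (_ : perm_eq [seq tact (ZpQp (ulift pp a)) k c | c <- s'] s')); last first.
    have um : uniq [seq tact (ZpQp (ulift pp a)) k c | c <- s'].
      have inj : {in s' &, injective (tact (ZpQp (ulift pp a)) k)}.
        by move=> c c' /s'P[_ Xc] /s'P[_ Xc']; exact: (act_inj n2 (intunit_tw k xu) Xc Xc').
      by rewrite (map_inj_in_uniq inj).
    apply: uniq_perm => //; apply: (uniq_min_size um _ _).2; last by rewrite size_map.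
    move=> _ /mapP[c /s'P[lc Xc] ->]; rewrite mem_filter (label_tact xu Xc lc) eqxx /=.
    by apply/sX; exact: (X_act n2 (intunit_tw k xu) Xc).
  rewrite big_map big_seq [RHS]big_seq; apply: eq_bigr => c /s'P[_ Xc].
  by rewrite (e_phase_tact k xu Xc) xV.
have tE : (totient (p ^ m))%:R * \sum_(c <- s') e (phase c) = \sum_(c <- s')
   (\sum_(a : 'Z_(p ^ m) | a \is a GRing.unit)
     e (ZpQp (ulift pp a) * phase_u c k + ZpQp (ulift pp a)^-1 * phase_tw c k)) * e (phase_rest c k).
  rewrite [RHS](eq_bigr _ (fun c _ => mulr_suml _ _ _ _)).
  rewrite exchange_big /= -(eq_bigr _ permE) sumr_const -[RHS]mulr_natl.
  by rewrite -(card_Zp_units pp m) cardsE.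
have t0 : (0 < (totient (p ^ m))%:R :> R) by rewrite ltr0n totient_gt0 expn_gt0 prime_gt0.
rewrite -(ler_pM2l t0).
have -> : forall z : R[i], (totient (p ^ m))%:R * Normc.normc z = Normc.normc ((totient (p ^ m))%:R * z).
  by move=> z; rewrite !mulr_natl; exact: esym (normcMn _ _).
rewrite tE (le_trans (normc_sum _ _ _)) // mulr_sumr big_seq [leRHS]big_seq.
apply: ler_sum => c cs; rewrite Normc.normcM padic_e_norm mulr1.
have [_ mE] := s'M c cs.
have := kloosterman_average R (E := E) (x := phase_u c k) (y := phase_tw c k); rewrite -mE => /(_ Em) h.
have tB0 := mulr_ge0 (ltW t0) B0.
have S0 : 0 <= Normc.normc (\sum_(a : 'Z_(p ^ m) | a \is a GRing.unit)
   e (ZpQp (ulift pp a) * phase_u c k + ZpQp (ulift pp a)^-1 * phase_tw c k)).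
  by rewrite -lecR -norm_normc normr_ge0.
rewrite -(ler_pXn2r (_ : 0 < 4)%N S0 tB0) //; apply: (le_trans h).
by rewrite exprMn mulrC ler_pM2l // exprn_gt0.
Qed.

Lemma sum_bound (s : seq (set M)) (B : R) : uniq s -> (forall c, c \in s <-> X_ t w c) ->
  0 <= B -> 96 * p%:R ^- (E %/ 3).+1 <= B ^+ 4 ->
  Normc.normc (\sum_(c <- s) e (phase c)) <=
  (size [seq c <- s | [forall k, pole (phase_u c k) <= E]%N])%:R + B * (size s)%:R.
Proof.
(* Cosets without a label, exactly those with all [phase_u] of denominator at most p^E, get the
   trivial weight 1. *)
move=> us sX B0 Bp; pose b (l : option ('I_n * nat)) := if l is Some _ then B else 1.
have h := @sum_by_labels R _ _ s label (fun c => e (phase c)) b.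
have {}h : Normc.normc (\sum_(c <- s) e (phase c)) <= \sum_(c <- s) b (label c).
  apply: h; case=> [[k m]|]; first exact: label_class_bound.
  rewrite (le_trans (normc_sum _ _ _)) //; apply: ler_sum => c _.
  by rewrite padic_e_norm.
rewrite (le_trans h) // -sum1_size natr_sum big_filter -sum1_size natr_sum mulr_sumr [X in _ <= X +
  _]big_mkcond.
rewrite -big_split /=; apply: ler_sum => c _; rewrite mulr1 /label.
case: pickP => [k Ek|nE]; first by rewrite /= lerDr; case: ifP.
rewrite ifT ?lerDl //; apply/forallP => k; by rewrite leqNgt nE.
Qed.

End Averaging.

(** * Finiteness and the consequences of well-definedness *)

Section Elementary.
Variables (F : fieldType) (n : nat).
Hypothesis n2 : (2 <= n)%N.
Implicit Types (k j : 'I_n).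

Definition elem k : 'M[F]_n.+1 := \matrix_(i, j)
  ((i == j) || (i == widen_ord (leqnSn n) k) && (j == lift ord0 k))%:R.

Lemma elem_unip k : unip (elem k).
Proof.
split=> [i j ji|i]; last by rewrite mxE eqxx.
rewrite mxE -!val_eqE /= /bump add1n.
by have -> : ((i == j :> nat) || (i == k :> nat) && (j == k.+1 :> nat)) = false by lia.
Qed.

Lemma sdiag_elem k j : sdiag (elem k) j = (j == k)%:R.
Proof.
rewrite /sdiag mxE -!val_eqE /= /bump !add1n eqSS andbb.
by have -> : (j == j.+1 :> nat) = false by lia.
Qed.

(** For 0 < k < n-1 both k and k+1 are inner, where [wst] is -1. Hence [elem k] lies in
    [Ubar_ w_star] and well-definedness can be tested on it. *)
Lemma elem_wst k : (0 < k < n.-1)%N -> wst F n *m elem k = elem k *m wst F n.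
Proof.
move=> kn; apply/matrixP => i j; rewrite wst_mull // wst_mulr // !mxE.
have kn' := ltn_ord k; have w0 : widen_ord (leqnSn n) k <> ord0 by move=> /(congr1 val) /=; lia.
have wm : widen_ord (leqnSn n) k <> ord_max by move=> /(congr1 val) /=; lia.
have l0 : lift ord0 k <> ord0 by move=> /(congr1 val) /=; rewrite /bump; lia.
have lm : lift ord0 k <> ord_max by move=> /(congr1 val) /=; rewrite /bump; lia.
have sgw (l : 'I_n.+1) a : a <> ord0 -> a <> ord_max -> (sg l == a) = (l == a).
  move=> /eqP a0 /eqP am; rewrite -[in LHS](_ : sg a = a) ?(inj_eq (inv_inj (sgK n2))) //.
  by apply: sg_inner; rewrite /inner a0.
rewrite (sgw _ _ w0 wm) (sgw _ _ l0 lm) [i == sg j](_ : _ = (sg i == j));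
  last by rewrite -[in RHS](inj_eq (inv_inj (sgK n2))) sgK.
case: (eqVneq (sg i) j) => [<-|_] /=; first by rewrite sgK // mulrC.
case: andP => [[/eqP-> /eqP->]|_]; last by rewrite mulr0 mul0r.
rewrite mulrC; congr (_ * _); rewrite /eps /sg.
by rewrite (introF eqP w0) (introF eqP wm) (introF eqP l0) (introF eqP lm) (introF eqP l0) (introF eqP lm).
Qed.

Lemma cell_conj_elem (D : 'I_n.+1 -> F) k : (forall i, D i != 0) -> (0 < k < n.-1)%N ->
  dmx D *m wst F n *m elem k *m invmx (dmx D *m wst F n) = dconj D (elem k).
Proof.
move=> D0 kn; have uN : dmx D *m wst F n \in unitmx by exact: cell_unit.
have -> : dmx D *m wst F n *m elem k = dconj D (elem k) *m (dmx D *m wst F n).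
  rewrite -mulmxA elem_wst // !mulmxA; congr (_ *m _).
  by rewrite -dconjE -!mulmxA dmxVK // mulmx1.
by rewrite mulmxK.
Qed.

End Elementary.

Section KloostermanSum.
Variables (R : realType) (p : nat) (pp : prime p) (n : nat).
Hypothesis n2 : (2 <= n)%N.
Local Notation Zp := (Zp_ pp).
Local Notation Qp := (Qp_ pp).
Local Notation M := 'M[Qp]_n.+1.
Local Notation w := (w_star pp n).
Variable r : 'I_n -> nat.
Local Notation t := (C_star pp r).
Local Notation P := (p%:R : Qp).
Local Notation rr := (ext_exp r).
Variables psi psi' : 'I_n -> int.

Lemma ext_exp_sum k : (rr k <= \sum_i r i)%N.
Proof.
case: k => [|k] //=; case: insubP => [i _ _|//] /=.
by rewrite (bigD1 i) //= leq_addr.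
Qed.

(** [count_X] bounds all finite subsets uniformly. Finiteness makes the finitely supported sum in
    [Kl] a genuine sum over [X_]. *)
Lemma X_finite : finite_set (X_ t w).
Proof.
apply: contrapT => /infinite_set_fset h.
have [B BX] := h (\prod_(1 <= k < n.+1) ((rr k).+1 * p ^ rr k)).+1.
rewrite leqNgt ltnS => /negP; apply; apply: (count_X n2 ext_exp_sum (finmap.fset_uniq B)).
by move=> c cB; apply: BX.
Qed.

Lemma Kl_phase : exists s : seq (set M), [/\ uniq s, forall c, c \in s <-> X_ t w c &
  Kl R psi psi' t w = \sum_(c <- s) padic_e R (phase r psi psi' c)].
Proof.
exists (finmap.enum_fset (fset_set (X_ t w))); split; first exact: finmap.fset_uniq.
  by move=> c; rewrite in_fset_set ?inE //; exact: X_finite.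
rewrite /Kl fsbig_finite /=; last exact: X_finite.
apply: eq_bigr => c _; rewrite /phase padic_eD /psi_char /phase_u /phase_v.
by case: (bruhat _ _ _).
Qed.

Hypothesis wd : Kl_well_defined R psi psi' t w.

(* Well-definedness at v = 1 + E_(k,k+1), where psi' is trivial: psi_k p^(r_k + r_(k+2) - 2 r_(k+1))
   must be an integer. *)
Lemma exponent_convex (k : 'I_n) : (0 < k < n.-1)%N -> psi k != 0 ->
  (2 * rr k.+1 <= logn p `|psi k| + rr k + rr k.+2)%N.
Proof.
move=> kn psi0; pose v : M := elem Qp k.
pose D (i : 'I_n.+1) : Qp := P ^ ((rr i)%:Z - (rr i.+1)%:Z).
have D0 i : D i != 0 by rewrite expfz_neq0 // P_neq0.
have uv : Uup v by apply/UupP; exact: elem_unip.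
have vU : Ubar_ w v.
  split=> //; exists v => //; rewrite -mulmxA w_starE -elem_wst // mulKmx //; exact: w_star_unit.
have := wd vU; rewrite /psi_char (cell_conj_elem n2 D0 kn).
have superE (a : 'I_n -> int) (u : M) : (forall j, j != k -> superdiag u j = 0) ->
    \sum_(j < n) (a j)%:~R * superdiag u j = (a k)%:~R * superdiag u k.
  by move=> u0; rewrite (bigD1 k) //= big1 ?addr0 // => j jk; rewrite u0 // mulr0.
have ve j : superdiag v j = (j == k)%:R by exact: sdiag_elem.
have Dve j : superdiag (dconj D v) j = D (widen_ord (leqnSn n) j) / D (lift ord0 j) * (j == k)%:R.
  by rewrite -ve; exact: sdiag_dconj.
rewrite superE; last by move=> j /negbTE jk; rewrite Dve jk mulr0.
rewrite superE; last by move=> j /negbTE jk; rewrite ve jk.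
rewrite Dve ve eqxx !mulr1 [RHS]padic_e_int; last exact: isint_int.
move=> /padic_e_eq1.
have -> : D (widen_ord (leqnSn n) k) / D (lift ord0 k) =
    P ^ ((rr k)%:Z + (rr k.+2)%:Z - 2 * (rr k.+1)%:Z).
  rewrite /D invr_expz -expfzDr ?P_neq0 //; congr (_ ^ _).
  rewrite -[nat_of_ord (lift ord0 k)]/(k.+1) -[nat_of_ord (widen_ord _ k)]/(k : nat).
  lia.
by move=> /(logn_ge0_of_isint psi0); lia.
Qed.

(** Passing from psi_k u_k to u_k loses at most v_p(psi_k) <= m in the denominator, and
    near-convexity has the same defect m; both are covered by e = E + m. *)
Lemma small_count (s : seq (set M)) E m : uniq s -> (forall c, c \in s -> X_ t w c) ->
  (forall c k, c \in s -> (pole (phase_u r psi c k) <= E)%N) ->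
  (forall k, psi k != 0) -> (forall k, (logn p `|psi k| <= m)%N) -> (0 < size s)%N ->
  let e := (E + m)%N in
  [/\ (rr 1 <= rr 2 + e)%N, (rr n <= rr n.-1 + e)%N,
    forall k, (0 < k < n.-1)%N -> (2 * rr k.+1 <= e + rr k + rr k.+2)%N &
    (size s <= p ^ (e + rr 2 - rr 1) * p ^ (e + rr n.-1 - rr n) * p ^ rr n *
     \prod_(1 <= k < n.-1) ((e + rr k + rr k.+2 - rr k.+1).+1 * p ^ (e + rr k + rr k.+2 - rr k.+1)))%N].
Proof.
move=> us Xs ps psi0 psim s0 e.
have conv k : (0 < k < n.-1)%N -> (2 * rr k.+1 <= e + rr k + rr k.+2)%N.
  move=> kn; have kn' : (k < n)%N by lia.
  by have := @exponent_convex (Ordinal kn') kn (psi0 _); have := psim (Ordinal kn'); rewrite /e /=; lia.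
(* The common denominator R = e + 2 S is large enough for every exponent e + r_j + r_k. *)
have rR k : (rr k <= e + 2 * \sum_i r i)%N by have := ext_exp_sum k; lia.
have uint c k : c \in s -> isint (P ^+ e * superdiag (bruhat t w (xget 0 c)).1 k).
  move=> cs; have /poleP h := ps c k cs; have := isint_intr_cancel (psi0 k) (h : isint (_ * P ^ E%:Z)).
  have me : E%:Z + (logn p `|psi k|)%:Z <= e%:Z by have := psim k; rewrite /e; lia.
  by move=> /(isint_PzD me); rewrite mulrC.
have convw k : (0 < k < n.-1)%N -> (rr k.+1 <= e + rr k + rr k.+2)%N by move=> /conv; lia.
have sumR j k : (e + rr j + rr k <= e + 2 * \sum_i r i)%N.
  by have := ext_exp_sum j; have := ext_exp_sum k; lia.
by have [h1 h2 h3] := count_X_small n2 rR us Xs uint convw sumR s0.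
Qed.

End KloostermanSum.

(** * Almost convex exponent sequences *)

Section Exponents.
Variables (a : nat -> nat) (n e : nat).
Hypotheses (n2 : (2 <= n)%N) (a12 : (a 1 <= a 2 + e)%N) (an : (a n <= a n.-1 + e)%N).
Hypothesis conv : forall k, (0 < k < n.-1)%N -> (2 * a k.+1 <= e + a k + a k.+2)%N.
Local Notation S := (\sum_(1 <= k < n.+1) a k)%N.

(** A telescoping sum; [conv] guarantees that the truncated subtractions are exact. *)
Lemma second_difference_sum m : (0 < m < n)%N ->
  (\sum_(1 <= k < m) (e + a k + a k.+2 - a k.+1) + a 2 + a m =
   \sum_(1 <= k < m.+2) a k + m.-1 * e)%N.
Proof.
elim: m => [//|m IHm]; case: m IHm => [_ _|m IHm mn].
  by rewrite big_geq // big_nat_recr //= big_nat1; lia.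
rewrite big_nat_recr //= [in RHS]big_nat_recr //=; have := IHm ltac:(lia).
by have := conv (k := m.+1) ltac:(lia); rewrite mulSn /=; lia.
Qed.

(** The exponent in the count of small cosets is S + n e - a_1, so all of a_1 is saved. *)
Lemma small_exponentE :
  (e + a 2 - a 1 + (e + a n.-1 - a n) + a n +
   \sum_(1 <= k < n.-1) (e + a k + a k.+2 - a k.+1) + a 1 = S + n * e)%N.
Proof.
have h := @second_difference_sum n.-1 ltac:(lia).
have nE : n.-1.+2 = n.+1 by lia.
rewrite nE in h; have -> : (n * e = n.-1.-1 * e + 2 * e)%N by rewrite -mulnDl; congr (_ * _)%N; lia.
lia.
Qed.

(** The last slope is at most e by [an], and near-convexity adds at most e for each step towards the
    start. *)
Lemma slope_le i : (i < n.-1)%N -> (a (n - i) <= a (n - i).-1 + i.+1 * e)%N.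
Proof.
elim: i => [|i IHi] hi; first by rewrite subn0 mul1n.
have := IHi ltac:(lia); have := conv (k := (n - i).-2) ltac:(lia).
have -> : (n - i.+1 = (n - i).-1)%N by lia.
have -> : (n - i).-2.+1 = (n - i).-1 by lia.
have -> : (n - i).-1.+1 = (n - i)%N by lia.
rewrite [(i.+2 * e)%N]mulSn; lia.
Qed.

Lemma exponent_le_first k : (k < n)%N -> (a k.+1 <= a 1 + k * (n * e))%N.
Proof.
elim: k => [|k IHk] kn; first by rewrite mul0n addn0.
have := IHk ltac:(lia); have := @slope_le (n - k.+2) ltac:(lia).
have -> : (n - (n - k.+2) = k.+2)%N by lia.
have := leq_mul (_ : (n - k.+2).+1 <= n)%N (leqnn e); rewrite mulSn => /(_ ltac:(lia)) /=; lia.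
Qed.

Lemma exponent_sum_le : (S <= n * a 1 + n ^ 3 * e)%N.
Proof.
rewrite big_add1 /= big_mkord; apply: (@leq_trans (\sum_(i < n) (a 1 + n * (n * e)))%N).
  apply: leq_sum => i _; rewrite (leq_trans (exponent_le_first (ltn_ord i))) //.
  by rewrite leq_add2l leq_mul // ltnW.
by rewrite sum_nat_const card_ord mulnDr !expnS expn0 muln1 !mulnA.
Qed.

(** Writing T for the exponent, n T = n S + n^2 e - n a_1 <= (n - 1) S + (n^2 + n^3) e, and the
    hypothesis gives 2 n^3 e <= S / 2. Thus T <= S (1 - 1 / (2 n)). *)
Lemma small_exponent_le : (8 * n ^ 3 * e <= 2 * S)%N ->
  (2 * n * (e + a 2 - a 1 + (e + a n.-1 - a n) + a n +
    \sum_(1 <= k < n.-1) (e + a k + a k.+2 - a k.+1)) + S <= 2 * n * S)%N.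
Proof.
have h1 := small_exponentE; have h2 := exponent_sum_le.
set T := (_ + \sum_(1 <= k < n.-1) _)%N in h1 *.
have h3 : (n * T + n * a 1 = n * S + n ^ 2 * e)%N by rewrite -mulnDr h1 mulnDr expnS expn1 -mulnA.
have h4 : (n ^ 2 * e <= n ^ 3 * e)%N by rewrite leq_mul // leq_pexp2l //; lia.
rewrite -!mulnA; move: h2 h3 h4; set x := (n * T)%N; set y := (n ^ 3 * e)%N; set z := (n ^ 2 * e)%N.
set u := (n * a 1)%N; set v := (n * S)%N. set s := S; lia.
Qed.

End Exponents.

(** * Absorbing polynomial factors and the final estimate *)

Lemma prod_expn_le (p A m l : nat) (f : nat -> nat) : (forall k, (m <= k < l)%N -> (f k < A)%N) ->
  (\prod_(m <= k < l) ((f k).+1 * p ^ f k) <= A ^ (l - m) * p ^ (\sum_(m <= k < l) f k))%N.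
Proof.
move=> fA; rewrite big_split /= -expn_sum leq_mul // -prod_nat_const_nat big_nat [leqRHS]big_nat.
by apply: leq_prod.
Qed.

(** After taking roots it remains to bound S + 1 by (1 + 1/y) (1 + y S), and 1 + y S <= exp(y S).
    The ln 2 in y, the least value of ln q, makes the constant independent of q. *)
Lemma poly_bound (R : realType) (n : nat) (eta : R) : 0 < eta ->
  exists K : R, 0 < K /\ forall q S : nat, (2 <= q)%N -> S.+1%:R ^+ n <= K * q%:R `^ (eta * S%:R).
Proof.
move=> eta0; case: n => [|n].
  exists 1; split=> // q S q2; rewrite expr0 mul1r -[leLHS](powRr0 (q%:R : R)).
  by apply: ler_powR; rewrite ?ler1n ?mulr_ge0 ?ler0n ?(ltW eta0) ?(ltnW q2).
pose y := eta * ln 2 / n.+1%:R.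
have y0 : 0 < y by rewrite divr_gt0 ?mulr_gt0 ?ln_gt0 ?ltr1n.
exists ((1 + y^-1) ^+ n.+1); split; first by rewrite exprn_gt0 // addr_gt0 ?invr_gt0.
move=> q S q2; have -> : eta * S%:R = eta / n.+1%:R * S%:R * n.+1%:R.
  by rewrite mulrAC divfK // pnatr_eq0.
rewrite powRrM powR_mulrn ?powR_ge0 // -exprMn lerXn2r ?nnegrE //.
  by rewrite mulr_ge0 ?powR_ge0 // addr_ge0 // invr_ge0 ltW.
have q0 : (0 : R) < q%:R by rewrite ltr0n ltnW.
have lnq : ln 2 <= ln q%:R :> R by rewrite ler_ln ?posrE // ler_nat.
have : 1 + y * S%:R <= q%:R `^ (eta / n.+1%:R * S%:R).
  rewrite /powR (gt_eqF q0) (le_trans _ (expR_ge1Dx _)) // lerD2l.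
  have -> : y * S%:R = eta / n.+1%:R * S%:R * ln 2 by rewrite /y; ring.
  by rewrite ler_wpM2l // mulr_ge0 // divr_ge0 // ltW.
move=> h; have yV : 0 < y^-1 by rewrite invr_gt0.
have h1 : (1 + y^-1) * (1 + y * S%:R) <= (1 + y^-1) * q%:R `^ (eta / n.+1%:R * S%:R).
  by rewrite ler_pM2l // addr_gt0.
apply: le_trans h1.
have -> : (1 + y^-1) * (1 + y * S%:R) = S.+1%:R + (y^-1 + y * S%:R).
  rewrite mulrDl mul1r mulrDr mulr1 mulKf ?gt_eqF // -[S.+1%:R]natr1; lra.
have := mulr_ge0 (ltW y0) (ler0n R S); lra.
Qed.

(** V stands for the absolute value of the Kloosterman sum, N and sm for the numbers of all and of
    small cosets, m for a bound on the valuations of the psi_k. With J = S %/ Q %/ 3 + 1 > S / (3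
    Q), the factor q^(-J/4) saves at least S / (12 Q) = 2 delta S for delta = 1 / (24 Q); half of it
    pays for the polynomial factor in N. *)
Lemma combined_bound (R : realType) (n : nat) : (2 <= n)%N ->
  let Q := (8 * n ^ 3)%N in
  exists delta K : R, 0 < delta /\ 0 < K /\ forall (q S m N sm : nat) (V : R), (2 <= q)%N ->
    (N <= S.+1 ^ n * q ^ S)%N -> V <= N%:R ->
    ((m * Q < S)%N -> V <= sm%:R + 4 * q%:R `^ (- ((S %/ Q %/ 3).+1%:R / 4)) * N%:R) ->
    ((m * Q < S)%N -> exists2 T, (sm <= (3 * S.+1) ^ n * q ^ T)%N & (2 * n * T + S <= 2 * n * S)%N) ->
    V <= K * q%:R `^ (m%:R / 2) * q%:R `^ (S%:R * (1 - delta)).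
Proof.
move=> n2 Q; have Q0 : (0 < Q)%N by rewrite muln_gt0 expn_gt0; lia.
have nQ : (n <= Q)%N by rewrite /Q !expnS expn0 muln1; nia.
have QR0 : 0 < Q%:R :> R by rewrite ltr0n.
pose d : R := (24 * Q%:R)^-1.
have d0 : 0 < d by rewrite invr_gt0 mulr_gt0.
have [K1 [K10 hK]] := poly_bound n d0.
have dQ : 24 * d * Q%:R = 1 by rewrite /d; field; rewrite gt_eqF.
pose K := K1 * (3 ^+ n + 4).
have K30 : 0 < 3 ^+ n :> R by rewrite exprn_gt0.
exists d, K; split=> //; split; first by rewrite mulr_gt0 // addr_gt0.
move=> q S m N sm V q2 hN hV hB hsm.
have q0 : (0 : R) < q%:R by rewrite ltr0n ltnW.
have q1 : (1 : R) <= q%:R by rewrite ler1n ltnW.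
have qD x y : (q%:R : R) `^ (x + y) = q%:R `^ x * q%:R `^ y.
  by rewrite powRD // (gt_eqF q0) implybT.
have qX k : (q%:R : R) ^+ k = q%:R `^ k%:R by rewrite powR_mulrn // ltW.
have NE : N%:R <= K1 * q%:R `^ (d * S%:R + S%:R).
  rewrite (le_trans (_ : _ <= (S.+1 ^ n * q ^ S)%N%:R)) ?ler_nat //.
  rewrite natrM !natrX qX qD mulrA.
  by rewrite ler_wpM2r ?powR_ge0 ?hK.
have S0 : 0 <= S%:R :> R by [].
(* If S <= m Q, the trivial bound exceeds the target by at most q^(2 d S), and 2 d S <= 2 d m Q = m
   / 12 is covered by q^(m/2). *)
have [Sm|mS] := leqP S (m * Q).
  have SmR : S%:R <= m%:R * Q%:R :> R by rewrite -natrM ler_nat.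
  rewrite (le_trans hV) // (le_trans NE) // -[leRHS]mulrA -qD.
  apply: ler_pM; rewrite ?powR_ge0 ?(ltW K10) //.
    by rewrite /K ler_pMr //; lra.
  rewrite ler_powR //; nra.
have [T smT TS] := hsm mS; rewrite (le_trans (hB mS)) //.
apply: (@le_trans _ _ (K * q%:R `^ (S%:R * (1 - d)))); last first.
  rewrite [leRHS]mulrAC; apply: ler_peMr.
    by rewrite mulr_ge0 ?powR_ge0 // ltW // mulr_gt0 // addr_gt0.
  by rewrite -[leLHS](powRr0 (q%:R : R)); apply: ler_powR; rewrite ?divr_ge0.
rewrite /K mulrDr mulrDl lerD //.
  apply: (@le_trans _ _ ((3 * S.+1) ^ n * q ^ T)%N%:R); first by rewrite ler_nat.
  rewrite natrM natrX natrM exprMn natrX qX.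
  apply: (@le_trans _ _ (3 ^+ n * (K1 * q%:R `^ (d * S%:R)) * q%:R `^ T%:R)).
    by rewrite ler_wpM2r ?powR_ge0 // ler_wpM2l ?(ltW K30) ?hK.
  rewrite -!mulrA -qD mulrCA ler_pM2l // ler_pM2l //.
  rewrite ler_powR //.
  have TSR : 2 * n%:R * T%:R + S%:R <= 2 * n%:R * S%:R :> R.
    by rewrite -!natrM -natrD ler_nat.
  have nQR : n%:R <= Q%:R :> R by rewrite ler_nat.
  have n2R : 2 <= n%:R :> R by rewrite ler_nat.
  have dn : 24 * d * n%:R <= 1 by rewrite -[leRHS]dQ ler_wpM2l // ltW // mulr_gt0.
  have : 2 * n%:R * (d * S%:R + T%:R) <= 2 * n%:R * (S%:R * (1 - d)).
    have : 24 * d * n%:R * S%:R <= S%:R by rewrite ler_piMl.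
    lra.
  rewrite ler_pM2l //; lra.
apply: (@le_trans _ _ (4 * q%:R `^ (- ((S %/ Q %/ 3).+1%:R / 4)) * (K1 * q%:R `^ (d * S%:R + S%:R)))).
  by rewrite ler_wpM2l // mulr_ge0 // powR_ge0.
have -> : forall x y : R, 4 * x * (K1 * y) = K1 * 4 * (x * y) by move=> x y; ring.
rewrite -qD ler_pM2l ?mulr_gt0 // ler_powR //.
have SE : (S < 3 * Q * (S %/ Q %/ 3).+1)%N.
  have := ltn_ceil S Q0; have := ltn_ceil (S %/ Q) (_ : 0 < 3)%N => /(_ isT) h1 h2.
  rewrite (leq_trans h2) // mulnC -mulnA mulnCA leq_mul // mulnC //.
have : S%:R <= 3 * Q%:R * (S %/ Q %/ 3).+1%:R :> R by rewrite -!natrM ler_nat ltnW.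
set J : R := (S %/ Q %/ 3).+1%:R => SJ.
have : 8 * d * S%:R <= J.
  have : d * S%:R <= d * (3 * Q%:R * J) by rewrite ler_wpM2l // ltW.
  have -> : d * (3 * Q%:R * J) = (24 * d * Q%:R) * J / 8 by field.
  rewrite dQ; lra.
lra.
Qed.

Lemma ext_exp_total n (r : 'I_n -> nat) : (\sum_(1 <= k < n.+1) ext_exp r k = \sum_i r i)%N.
Proof.
by rewrite big_add1 /= big_mkord; apply: eq_bigr => i _; rewrite /ext_exp /= valK.
Qed.

Lemma invsqrt_powR (R : realType) (p : nat) (a : int) : prime p -> a != 0 ->
  padic_abs_invsqrt R p a = (p%:R `^ ((logn p `|a|%N)%:R / 2))%:E.
Proof.
move=> pp a0; rewrite /padic_abs_invsqrt /padic_abs (negbTE a0); congr (_%:E).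
by rewrite -powR_mulrn // -powRN -powRrM mulrNN.
Qed.

Lemma Kl_bound (R : realType) (n : nat) : (2 <= n)%N ->
  exists delta K : R, 0 < delta /\ 0 < K /\
    forall (p : nat) (pp : prime p) (r : 'I_n -> nat) (psi psi' : 'I_n -> int) (m : nat),
      Kl_well_defined R psi psi' (C_star pp r) (w_star pp n) ->
      (forall k, psi k != 0) -> (forall k, (logn p `|psi k| <= m)%N) ->
      Normc.normc (Kl R psi psi' (C_star pp r) (w_star pp n)) <=
        K * p%:R `^ (m%:R / 2) * p%:R `^ ((\sum_i r i)%:R * (1 - delta)).
Proof.
move=> n2; have [delta [K [d0 [K0 bound]]]] := combined_bound R n2.
exists delta, K; split=> //; split=> // p pp r psi psi' m wd psi0 psim.
set S := (\sum_i r i)%N; set Q := (8 * n ^ 3)%N in bound; pose E := (S %/ Q)%N.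
have [s [us sX ->]] := Kl_phase R pp n2 r psi psi'.
have Q8 : (8 <= Q)%N by rewrite /Q leq_pmulr // expn_gt0; lia.
have rS := ext_exp_sum r; have rE := ext_exp_total r.
pose small := [seq c <- s | [forall k, pole (phase_u r psi c k) <= E]%N].
apply: (bound p S m (size s) (size small)); first exact: prime_gt1.
- have sX' c : c \in s -> X_ (C_star pp r) (w_star pp n) c by move/sX.
  rewrite (leq_trans (count_X n2 rS us sX')) //.
  have fA k : (1 <= k < n.+1)%N -> (ext_exp r k < S.+1)%N by move=> _; rewrite ltnS; exact: rS.
  by have := prod_expn_le p fA; rewrite rE subn1.
- rewrite (le_trans (normc_sum _ _ _)) // (eq_bigr _ (fun c _ => padic_e_norm R _)).
  by rewrite big_const_seq count_predT iter_addr_0.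
- move=> _; apply: sum_bound => //.
  (* The fourth power of the weight 4 q^(-J/4) is 256 q^-J, which dominates 96 q^-J. *)
  rewrite exprMn -[X in _ <= _ * X]powR_mulrn ?powR_ge0 // -powRrM mulNr divfK // powRN powR_mulrn //.
  by apply: ler_wpM2r; [rewrite invr_ge0 exprn_ge0|rewrite -natrX ler_nat].
move=> mQ; case: (posnP (size small)) => [->|s0]; first by exists 0%N; nia.
have smallP c : c \in small -> X_ (C_star pp r) (w_star pp n) c /\
    forall k, (pole (phase_u r psi c k) <= E)%N.
  by rewrite mem_filter => /andP[/forallP ? /sX].
have [h1 h2 h3 h4] := small_count n2 wd (filter_uniq _ us) (fun c cs => (smallP c cs).1)
  (fun c k cs => (smallP c cs).2 k) psi0 psim s0.
have EQ : (E * Q <= S)%N by exact: leq_trunc_div.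
(* Both Q E <= S and Q m < S, which is the smallness of e = E + m required by
   [small_exponent_le]. *)
have eQ : (Q * (E + m) <= 2 * S)%N by rewrite mulnDr ![(Q * _)%N]mulnC; lia.
have := small_exponent_le n2 h1 h2 h3; rewrite rE => /(_ eQ) hT.
eexists; last exact: hT.
have e8 := leq_trans (leq_mul Q8 (leqnn (E + m)%N)) eQ.
have eS : (E + m <= S)%N by clear - e8; lia.
have fA k : (1 <= k < n.-1)%N ->
    (E + m + ext_exp r k + ext_exp r k.+2 - ext_exp r k.+1 < 3 * S.+1)%N.
  by move=> _; have := rS k; have := rS k.+2; lia.
apply: (leq_trans h4); apply: (leq_trans (leq_mul (leqnn _) (prod_expn_le p fA))).
rewrite mulnCA -!expnD leq_mul // leq_pexp2l //; lia.
Qed.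

Theorem corollary2 (R : realType) (n : nat) (hn : (2 <= n)%N) :
  exists delta K : R, 0 < delta /\ 0 < K /\
    forall (p : nat) (pp : prime p) (r : 'I_n -> nat) (psi psi' : 'I_n -> int),
      Kl_well_defined R psi psi' (C_star pp r) (w_star pp n) ->
      ((Normc.normc (Kl R psi psi' (C_star pp r) (w_star pp n)))%:E
        <= K%:E * (\big[maxe/-oo]_(j < n) padic_abs_invsqrt R p (psi j))
           * ((\prod_(k < n) (p%:R : R) ^+ r k) `^ (1 - delta))%:E)%E.
Proof.
have [delta [K [d0 [K0 bound]]]] := Kl_bound R hn.
exists delta, K; split=> //; split=> // p pp r psi psi' wd.
have p0 : (0 : R) < p%:R by rewrite ltr0n prime_gt0.
rewrite prodrXr -powR_mulrn ?(ltW p0) // -powRrM.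
have [[k psik]|psi0] := pselect (exists k, psi k = 0).
  have -> : (\big[maxe/-oo]_(j < n) padic_abs_invsqrt R p (psi j) = +oo)%E.
    apply/eqP; rewrite -leye_eq.
    have -> : (+oo = padic_abs_invsqrt R p (psi k))%E by rewrite /padic_abs_invsqrt psik eqxx.
    exact: le_bigmax.
  by rewrite gt0_muley ?lte_fin // gt0_mulye ?leey // lte_fin powR_gt0.
have {}psi0 k : psi k != 0 by apply/eqP => psik; apply: psi0; exists k.
(* The index of largest valuation supplies the m of [Kl_bound], and its term is at most the maximum
   on the right-hand side. *)
have [|j jmax] := bigop.eq_bigmax (fun k => logn p `|psi k|%N); first by rewrite card_ord ltnW.
have psij k : (logn p `|psi k| <= logn p `|psi j|)%N by rewrite -jmax leq_bigmax.
apply: (@le_trans _ _ (K%:E * padic_abs_invsqrt R p (psi j) *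
    (p%:R `^ ((\sum_i r i)%:R * (1 - delta)))%:E)%E).
  by rewrite invsqrt_powR // -!EFinM lee_fin bound.
apply: lee_wpmul2r; first by rewrite lee_fin powR_ge0.
by apply: lee_wpmul2l; [rewrite lee_fin ltW|exact: le_bigmax].
Qed.
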